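(* Let $\mathbb F$ be an algebraically closed field with a nonidentity involution $a\mapsto\bar a$, let $\mathbb P=\{\lambda\in\mathbb F:\bar\lambda=\lambda\}$, and fix $i\in\mathbb F$ with $i^2=-1$, so that $\mathbb F=\mathbb P+\mathbb P i$. (a) Every pair $(A,B)$ of Hermitian matrices over $\mathbb F$ of the same size is *congruent to a direct sum, determined uniquely up to permutation of summands, of pairs $(X,Y)$ of $n\times n$ tridiagonal matrices ($n$ a positive integer) of the following two types: (i) $X$ has zero diagonal and $X_{j,j+1}=X_{j+1,j}=1$ for $j=1,\dots,n-1$; $Y$ has zero diagonal, $Y_{j,j+1}=\mu$ and $Y_{j+1,j}=\bar\mu$ for $j=1,\dots,n-1$; here $\mu\in\mathbb F\smallsetminus\mathbb P$ if $n$ is even, $\mu=\pm i$ if $n$ is odd, and $\mu$ is determined up to replacement by $\bar\mu$; (ii) $X$ is symmetric with diagonal $(a,0,\dots,0)$ and with the entries $X_{j,j+1}=X_{j+1,j}$ ($j=1,\dots,n-1$) forming the sequence $b,a,b,a,\dots$; $Y$ is symmetric with diagonal $(b,0,\dots,0)$ and with the entries $Y_{j,j+1}=Y_{j+1,j}$ forming the sequence $-a,b,-a,b,\dots$; here $a,b\in\mathbb P$ and $a^2+b^2=1$. (b) The Kronecker canonical form of $(A,B)$ under equivalence determines this direct sum uniquely up to permutation of summands and multiplication by $-1$ of any direct summand of type (ii). The Kronecker canonical form of each of the direct summands is as follows: - type (i): $(F_k,G_k)\oplus(F_k^T,G_k^T)$ if $n=2k+1$, and $(I_k,J_k(\mu))\oplus(I_k,J_k(\bar\mu))$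 if $n=2k$; - type (ii): $(I_n,J_n(b/a))$ if $n$ is odd and $a\neq0$; $(I_n,J_n(-a/b))$ if $n$ is even and $b\ne0$; $(J_n(0),I_n)$ otherwise.
   Context: An involution on $\mathbb F$ is a bijection $a\mapsto\bar a$ with $\overline{a+b}=\bar a+\bar b$, $\overline{ab}=\bar a\bar b$, $\bar{\bar a}=a$. It is known that, in the setting of the claim, $\mathbb F$ has characteristic $0$, each element of $\mathbb F$ is uniquely of the form $a+bi$ with $a,b\in\mathbb P$, and $\overline{a+bi}=a-bi$. For a matrix $S$, $S^*=\bar S^T$; $A$ is Hermitian if $A=A^*$. Pairs $(A,B)$ and $(A',B')$ of square matrices are *congruent if there is a nonsingular $S$ with $S^*AS=A'$ and $S^*BS=B'$. Matrix pairs $(A,B)$ and $(A',B')$ are equivalent if there are nonsingular $R,S$ with $RAS=A'$ and $RBS=B'$. Direct sums of pairs are taken componentwise: $(A,B)\oplus(A',B')=(A\oplus A',B\oplus B')$, and $-(X,Y)=(-X,-Y)$. $I_n$ is the $n\times n$ identity matrix and $J_n(\lambda)$ is the $n\times n$ upper triangular Jordan block with eigenvalue $\lambda$ (ones on the superdiagonal). For $n\ge 0$, $F_n$ and $G_n$ are the $n\times(n+1)$ matrices $F_n=[\,I_n\ |\ 0\,]$ (identity followed by a zero column) and $G_n=[\,0\ |\ I_n\,]$ (zero column followed by the identity); $F_0=G_0$ is the $0\times 1$ matrix (taking a direct sum with it adjoins a zero column; with its transpose, a zero row). Kronecker's theorem: each pair of matrices of the same size is equivalent to a direct sum, determined uniquely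 up to permutation of summands, of pairs of the form $(I_n,J_n(\lambda))$, $(J_n(0),I_n)$, $(F_n,G_n)$, $(F_n^T,G_n^T)$; this direct sum is the Kronecker canonical form of the pair. *)

(* Defs.v *)
From HB Require Import structures.
From mathcomp Require Import all_boot all_order all_algebra.

Set Implicit Arguments.
Unset Strict Implicit.
Unset Printing Implicit Defensive.

Import GRing.Theory.
Local Open Scope ring_scope.

Definition is_involution (F : fieldType) (bar : F -> F) : Prop :=
  [/\ bijective bar, {morph bar : x y / x + y}, {morph bar : x y / x * y}
    & involutive bar].

Definition adjmx (F : fieldType) (bar : F -> F) m n (S : 'M[F]_(m, n)) :
  'M[F]_(n, m) := map_mx bar S^T.

Definition is_hermitian (F : fieldType) (bar : F -> F) n (A : 'M[F]_n) : Prop :=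
  A = adjmx bar A.

Record mxpair (F : fieldType) := MxPair {
  nrows : nat;
  ncols : nat;
  mxfst : 'M[F]_(nrows, ncols);
  mxsnd : 'M[F]_(nrows, ncols) }.

Record sqpair (F : fieldType) := SqPair {
  sqdim : nat;
  sqfst : 'M[F]_sqdim;
  sqsnd : 'M[F]_sqdim }.

Coercion mxpair_of_sqpair (F : fieldType) (P : sqpair F) : mxpair F :=
  MxPair (sqfst P) (sqsnd P).

Definition equivalent (F : fieldType) (P Q : mxpair F) : Prop :=
  exists (er : nrows P = nrows Q) (ec : ncols P = ncols Q)
         (R : 'M[F]_(nrows P)) (S : 'M[F]_(ncols P)),
    [/\ R \in unitmx, S \in unitmx,
        castmx (er, ec) (R *m mxfst P *m S) = mxfst Q
      & castmx (er, ec) (R *m mxsnd P *m S) = mxsnd Q].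

Definition star_congruent (F : fieldType) (bar : F -> F) (P Q : sqpair F) :
    Prop :=
  exists (e : sqdim P = sqdim Q) (S : 'M[F]_(sqdim P)),
    [/\ S \in unitmx,
        castmx (e, e) (adjmx bar S *m sqfst P *m S) = sqfst Q
      & castmx (e, e) (adjmx bar S *m sqsnd P *m S) = sqsnd Q].

Definition mxpair_add (F : fieldType) (P Q : mxpair F) : mxpair F :=
  MxPair (block_mx (mxfst P) 0 0 (mxfst Q)) (block_mx (mxsnd P) 0 0 (mxsnd Q)).

Definition sqpair_add (F : fieldType) (P Q : sqpair F) : sqpair F :=
  SqPair (block_mx (sqfst P) 0 0 (sqfst Q)) (block_mx (sqsnd P) 0 0 (sqsnd Q)).

Definition sqpair_opp (F : fieldType) (P : sqpair F) : sqpair F :=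
  SqPair (- sqfst P) (- sqsnd P).

(* The empty direct sum is the pair of 0 x 0 matrices. *)
Definition mxpair_sum (F : fieldType) (s : seq (mxpair F)) : mxpair F :=
  foldr (@mxpair_add F) (@MxPair F 0 0 0 0) s.

Definition sqpair_sum (F : fieldType) (s : seq (sqpair F)) : sqpair F :=
  foldr (@sqpair_add F) (@SqPair F 0 0 0) s.

Definition perm_upto T (r : T -> T -> Prop) (s t : seq T) : Prop :=
  exists2 f : 'I_(size s) -> 'I_(size t), bijective f
    & forall j, r (tnth (in_tuple s) j) (tnth (in_tuple t) (f j)).

Definition jordan_block (F : fieldType) n (lambda : F) : 'M[F]_n :=
  \matrix_(j, k) if j == k then lambda else (j.+1 == k :> nat)%:R.

Definition Fmx (F : fieldType) n : 'M[F]_(n, n.+1) :=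
  \matrix_(j, k) (k == j :> nat)%:R.

Definition Gmx (F : fieldType) n : 'M[F]_(n, n.+1) :=
  \matrix_(j, k) (k == j.+1 :> nat)%:R.

Inductive kblock (F : fieldType) :=
  | KJordan of nat & F
  | KInfinite of nat
  | KWide of nat
  | KTall of nat.

Arguments KInfinite {F}.
Arguments KWide {F}.
Arguments KTall {F}.

Definition kblock_ok (F : fieldType) (c : kblock F) : bool :=
  match c with
  | KJordan n _ | KInfinite n => (0 < n)%N
  | KWide _ | KTall _ => true
  end.

Definition kblock_pair (F : fieldType) (c : kblock F) : mxpair F :=
  match c with
  | KJordan n lambda => MxPair (1%:M : 'M_n) (jordan_block n lambda)
  | KInfinite n => MxPair (jordan_block n 0) (1%:M : 'M_n)
  | KWide n => MxPair (Fmx F n) (Gmx F n)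
  | KTall n => MxPair (Fmx F n)^T (Gmx F n)^T
  end.

(* The list ks is only determined up to permutation by P. *)
Definition kronecker_form (F : fieldType) (P : mxpair F) (ks : seq (kblock F)) :
    Prop :=
  all (@kblock_ok F) ks /\
  equivalent P (mxpair_sum (map (@kblock_pair F) ks)).

(* Parameters of the summands: n and mu for the first type, n, a and b for the
   second one. *)
Inductive summand (F : fieldType) :=
  | TypeI of nat & F
  | TypeII of nat & F & F.

Definition summand_ok (F : fieldType) (bar : F -> F) (i : F) (c : summand F) :
    bool :=
  match c with
  | TypeI n mu =>
      (0 < n)%N && (if odd n then (mu == i) || (mu == - i) else bar mu != mu)
  | TypeII n a b =>
      [&& (0 < n)%N, bar a == a, bar b == b & a ^+ 2 + b ^+ 2 == 1]
  end.

(* The tridiagonal n x n matrix with diagonal (d, 0, ..., 0), superdiagonal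
   (u 0, u 1, ...) and subdiagonal (l 0, l 1, ...); indices start at 0, so that
   u j is the entry usually written (j + 1, j + 2). *)
Definition tridiag (F : fieldType) n (d : F) (u l : nat -> F) : 'M[F]_n :=
  \matrix_(j, k) if j.+1 == k :> nat then u j
                 else if k.+1 == j :> nat then l k
                 else if (j == 0%N :> nat) && (k == 0%N :> nat) then d
                 else 0.

Definition alternate (F : fieldType) (x y : F) (j : nat) : F :=
  if odd j then y else x.

Definition summand_pair (F : fieldType) (bar : F -> F) (c : summand F) :
    sqpair F :=
  match c with
  | TypeI n mu =>
      SqPair (tridiag n 0 (fun=> 1) (fun=> 1))
             (tridiag n 0 (fun=> mu) (fun=> bar mu))
  | TypeII n a b =>
      SqPair (tridiag n a (alternate b a) (alternate b a))
             (tridiag n b (alternate (- a) b) (alternate (- a) b))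
  end.

Definition summand_sum (F : fieldType) (bar : F -> F) (s : seq (summand F)) :
  sqpair F := sqpair_sum (map (summand_pair bar) s).

Definition eq_summand (F : fieldType) (bar : F -> F) (c d : summand F) : Prop :=
  match c, d with
  | TypeI n mu, TypeI n' mu' => n' = n /\ (mu' = mu \/ mu' = bar mu)
  | TypeII n a b, TypeII n' a' b' => [/\ n' = n, a' = a & b' = b]
  | _, _ => False
  end.

Definition opp_typeII (F : fieldType) (c d : summand F) : Prop :=
  match c, d with
  | TypeII n a b, TypeII n' a' b' => [/\ n' = n, a' = - a & b' = - b]
  | _, _ => False
  end.

Definition eq_summand_sign (F : fieldType) (bar : F -> F) (c d : summand F) :
    Prop :=
  eq_summand bar c d \/ opp_typeII c d.

(* Negating the parameters of a summand of the second type amounts to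
   multiplying the pair by -1. *)
Lemma summand_pair_opp (F : fieldType) (bar : F -> F) (c d : summand F) :
  opp_typeII c d -> summand_pair bar d = sqpair_opp (summand_pair bar c).
Proof.
case: c d => [n mu|n a b] [n' mu'|n' a' b'] //= [-> -> ->].
rewrite /sqpair_opp /=; congr SqPair; apply/matrixP => j k; rewrite !mxE;
  rewrite /alternate; do ![case: ifP => _ //]; by rewrite ?oppr0 ?opprK.
Qed.

(* Main.v *)
(** Let P be the fixed field of the involution.  Every norm [x * bar x] is a
    square in P, sums of norms are norms, and every element of P is a norm up
    to sign: this is all that is used of "P is real closed".

    A morphism of matrix pairs (A, B) -> (A', B') is a couple (E, g) with
    A' E = g A and B' E = g B; a Hermitian pair is its own dual, so a morphism
    phi : M -> P into a Hermitian pair P has an adjoint phi^* : P -> M^*.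
    An indecomposable summand M of P is found by linear duality: a minimal
    kernel polynomial of the pencil, or a Jordan chain that cannot be prolonged,
    has a retraction, since an obstruction to it would shorten the polynomial or
    prolong the chain.  If M is not isomorphic to M^*, the morphism M -> P and
    the adjoint of its retraction can be corrected to split off M + M^*, which
    is of type (i); if M is a Jordan block with eigenvalue in P or infinity,
    polarization produces phi with phi^* phi invertible, and phi^* phi is
    normalized to +1 or -1, which gives a summand of type (ii).

    For uniqueness, the multiplicity of an indecomposable K in P is the rank of
    the trace pairing between Hom(P, K) and Hom(K, P), and when K is itself
    Hermitian the sign is read off from the positive index of the Hermitian form
    tr (phi^* psi) on Hom(K, P). *)

Require Import Defs.
From HB Require Import structures.
From mathcomp Require Import all_boot all_order all_algebra.
From mathcomp Require Import fingroup perm ring zify.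

Set Implicit Arguments.
Unset Strict Implicit.
Unset Printing Implicit Defensive.

Import GRing.Theory.
Local Open Scope ring_scope.

(** * Fields with an involution *)

(** Combinations of the two matrices with coefficients in P commute with *congruence, and natural
    numbers lie in P. So when some $B-tA$ is invertible, the pair $(B-tA,A)$ is treated in place of
    $(A,B)$: infinity then stops being a special eigenvalue, and the Möbius change of parameter is
    undone on the canonical blocks. Type (ii) blocks absorb this change because their parameters are
    points of a circle. After reordering the basis, such a pair is obtained from [flip n] and
    [flip n *m shift n] by an orthogonal change with coefficients $\pm a,\pm b$. The circle
    $a^2+b^2=1$ covers the projective line of eigenvalues twice, and the two antipodal points over
    an eigenvalue carry the two signs. Hence existence never computes a sign: if the wrong one
    occurs, the antipodal point is taken. Uniqueness rests on characteristic 0: an endomorphism of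
    one of the blocks used as tests is a scalar plus a nilpotent, and its trace is that scalar times
    the size, so the trace tells invertible endomorphisms from nilpotent ones. *)

Section InvolutiveField.

Variables (F : closedFieldType) (bar : {rmorphism F -> F}) (i : F).
Hypothesis barK : involutive bar.
Hypothesis bar_nonid : exists x : F, bar x <> x.
Hypothesis i_sqr : i ^+ 2 = -1.

Lemma closed_quadratic (b c : F) : exists y : F, y ^+ 2 + b * y = c.
Proof.
have [y Hy] := @solve_monicpoly F 2 (fun k => if k == 0%N then c else - b) isT.
exists y; rewrite Hy !big_ord_recr big_ord0 /=; ring.
Qed.

(* In characteristic 2, rescale [x] so that [x + bar x = 1] and solve
   [y^2 + y = (x bar x) x]: then [v = y + bar y] is fixed and is, like [x], a
   root of [X^2 + X + x bar x], so [x] is fixed. *)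
Lemma two_neq0 : 2%:R != 0 :> F.
Proof.
apply/eqP => two0; case: bar_nonid => x0 Hx0.
have DD (z : F) : z + z = 0 by rewrite -mulr2n -mulr_natl two0 mul0r.
have NN (z : F) : - z = z by apply/eqP; rewrite eq_sym -addr_eq0 DD.
pose t := x0 + bar x0.
have t0 : t != 0 by apply/eqP => /eqP; rewrite addr_eq0 NN => /eqP E; apply: Hx0.
have bt : bar t = t by rewrite rmorphD /= barK addrC.
have [x x1] : exists x, x + bar x = 1.
  by exists (x0 / t); rewrite rmorphM /= fmorphV /= bt -mulrDl divff.
have [y Hy] := closed_quadratic 1 (x * bar x * x).
pose v := y + bar y.
have bv : bar v = v by rewrite rmorphD /= barK addrC.
have Hv : v ^+ 2 + v = x * bar x.
  have := congr1 bar Hy; rewrite mul1r rmorphD rmorphXn !rmorphM /= barK => Hy'.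
  have -> : v ^+ 2 + v = (y ^+ 2 + 1 * y) + (bar y ^+ 2 + bar y) + (y * bar y + y * bar y).
    by rewrite /v; ring.
  rewrite Hy Hy' DD addr0.
  have -> : x * bar x * x + bar x * x * bar x = x * bar x * (x + bar x) by ring.
  by rewrite x1 mulr1.
have bx : bar x = 1 + x by rewrite -x1 addrAC DD add0r.
have : (v + x) * (v + x + 1) = 0.
  have -> : (v + x) * (v + x + 1) = (v ^+ 2 + v) + (x * (1 + x)) + (v * x + v * x).
    by ring.
  by rewrite DD Hv bx DD addr0.
have nx : bar x <> x.
  move=> E; have := x1; rewrite E DD => /esym /eqP; apply/negP; exact: oner_neq0.
move/eqP; rewrite mulf_eq0 => /orP [] /eqP E.
  apply: nx; have -> : x = v by rewrite -[LHS]NN; apply/eqP; rewrite eq_sym -addr_eq0 E.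
  exact: bv.
apply: nx; have -> : x = v + 1.
  by rewrite -[LHS]NN; apply/eqP; rewrite eq_sym -addr_eq0 addrAC E.
by rewrite rmorphD rmorph1 bv.
Qed.

Lemma i_neq0 : i != 0.
Proof. by apply/eqP => E; move/eqP: i_sqr; rewrite E expr0n eq_sym oppr_eq0 oner_eq0. Qed.

Lemma eq_opp0 (x : F) : x = - x -> x = 0.
Proof.
move=> E; apply/eqP; have : x *+ 2 = 0 by rewrite mulr2n {1}E addNr.
by move/eqP; rewrite -mulr_natl mulf_eq0 (negPf two_neq0).
Qed.

(* If [bar i = i], choose [d] with [bar d = - d] and a square root [e] of [d]:
   then [bar e = i e] up to sign, and [bar] has order 4 on [e]. *)
Lemma bar_i : bar i = - i.
Proof.
have : (bar i) ^+ 2 = i ^+ 2 by rewrite -rmorphXn i_sqr rmorphN1.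
move/eqP; rewrite eqf_sqr => /orP [] /eqP // bi.
case: bar_nonid => x0 Hx0; pose d := x0 - bar x0.
have d0 : d != 0 by rewrite subr_eq0; apply/eqP => E; apply: Hx0.
have bd : bar d = - d by rewrite rmorphB /= barK opprB.
have [e He] := closed_quadratic 0 d; rewrite mul0r addr0 in He.
have e0 : e != 0 by apply: contraNneq d0 => E; rewrite -He E expr0n.
have : (bar e) ^+ 2 = (i * e) ^+ 2 by rewrite -rmorphXn He bd exprMn i_sqr He mulN1r.
move/eqP; rewrite eqf_sqr => /orP [] /eqP be; have := barK e; rewrite be.
  rewrite rmorphM /= bi be mulrA -expr2 i_sqr mulN1r => /esym /eq_opp0 /eqP.
  by rewrite (negPf e0).
rewrite rmorphN rmorphM /= bi be mulrN opprK mulrA -expr2 i_sqr mulN1r => /esym /eq_opp0 /eqP.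
by rewrite (negPf e0).
Qed.

Lemma i_not_fixed (x : F) : x ^+ 2 = -1 -> bar x <> x.
Proof.
rewrite -i_sqr => /eqP; rewrite eqf_sqr => /orP [] /eqP ->.
  by rewrite bar_i => /esym /eq_opp0 /eqP; rewrite (negPf i_neq0).
by rewrite rmorphN bar_i => /esym /eq_opp0 /eqP; rewrite oppr_eq0 (negPf i_neq0).
Qed.

Lemma norm_is_fixed_square (x : F) : exists2 r, bar r = r & x * bar x = r ^+ 2.
Proof.
have [z] := closed_quadratic 0 x; rewrite mul0r addr0 => <-.
exists (z * bar z); first by rewrite rmorphM /= barK mulrC.
by rewrite rmorphXn exprMn.
Qed.

(** Both norms are squares $r^2$, $s^2$ of fixed elements, and $r^2+s^2=(r+is)(r-is)$ is the norm of
    $r+is$ since the involution changes the sign of $i$. *)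
Lemma norm_add (x y : F) : exists z, x * bar x + y * bar y = z * bar z.
Proof.
have [r br ->] := norm_is_fixed_square x; have [s bs ->] := norm_is_fixed_square y.
exists (r + i * s); rewrite rmorphD rmorphM /= bar_i br bs.
have -> : (r + i * s) * (r + - i * s) = r ^+ 2 - i ^+ 2 * s ^+ 2 by ring.
by rewrite i_sqr mulN1r opprK.
Qed.

Lemma norm_eq0 (x : F) : (x * bar x == 0) = (x == 0).
Proof. by rewrite mulf_eq0 fmorph_eq0 orbb. Qed.

(** Otherwise $r^2=-s^2$ with $r,s$ fixed and $s\neq0$, and $r/s$ would be a fixed square root of
    $-1$. *)
Lemma norm_add_eq0 (x y : F) : x * bar x + y * bar y = 0 -> x = 0.
Proof.
have [r br Er] := norm_is_fixed_square x; have [s bs Es] := norm_is_fixed_square y.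
move=> E; apply/eqP; rewrite -norm_eq0 Er; move: E; rewrite Er Es.
have [->|s0] := eqVneq s 0; first by rewrite expr0n addr0 => ->.
move/eqP; rewrite addr_eq0 => /eqP E.
case: (@i_not_fixed (r / s)); last by rewrite rmorphM /= fmorphV br bs.
by rewrite expr_div_n E mulNr divff ?expf_neq0.
Qed.

Lemma norm_sum n (f : 'I_n -> F) : exists z, \sum_j f j * bar (f j) = z * bar z.
Proof.
elim: n f => [|n IHn] f; first by exists 0; rewrite big_ord0 mul0r.
have [z Hz] := IHn (fun j => f (lift ord0 j)).
by rewrite big_ord_recl Hz; apply: norm_add.
Qed.

Lemma norm_sum_eq0 n (f : 'I_n -> F) : \sum_j f j * bar (f j) = 0 -> forall j, f j = 0.
Proof.
elim: n f => [|n IHn] f; first by move=> _ [].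
rewrite big_ord_recl; have [z Hz] := norm_sum (fun j => f (lift ord0 j)).
rewrite Hz => E; have f0 := norm_add_eq0 E.
move: E; rewrite f0 mul0r add0r -Hz => /IHn fS j.
by case: (unliftP ord0 j) => [k ->|->].
Qed.

(** Characteristic 0: $n+1$ is a sum of $n+1$ norms of 1, and a sum of norms vanishes only if every
    term does. *)
Lemma natr_neq0 n : n.+1%:R != 0 :> F.
Proof.
apply/eqP => E; have := @norm_sum_eq0 n.+1 (fun=> 1).
rewrite (eq_bigr (fun=> 1)) => [|j _]; last by rewrite rmorph1 mulr1.
by rewrite sumr_const card_ord E => /(_ erefl ord0) /eqP; rewrite oner_eq0.
Qed.

Lemma natr_eq0 n : (n%:R == 0 :> F) = (n == 0%N).
Proof. by case: n => [|n]; rewrite ?eqxx // (negPf (natr_neq0 n)). Qed.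

Lemma natr_inj : injective (fun n : nat => n%:R : F).
Proof.
suff: forall m n : nat, (m <= n)%N -> m%:R = n%:R :> F -> m = n.
  move=> H m n E; case: (leqP m n) => [|/ltnW] le; first exact: H.
  by apply/esym; apply: H.
move=> m n le /esym /eqP; rewrite -subr_eq0 -natrB // natr_eq0 subn_eq0 => le'.
by apply/eqP; rewrite eqn_leq le le'.
Qed.

(** A square root $z$ of $a$ satisfies $\bar z=\pm z$, so $a=z^2=\pm z\bar z$. *)
Lemma fixed_pm_norm (a : F) : bar a = a ->
  exists e z : F, [/\ e = 1 \/ e = -1 & a = e * (z * bar z)].
Proof.
move=> ba; have [z] := closed_quadratic 0 a; rewrite mul0r addr0 => Hz.
have : (bar z) ^+ 2 = z ^+ 2 by rewrite -rmorphXn Hz.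
move/eqP; rewrite eqf_sqr => /orP [] /eqP bz.
  by exists 1, z; split; [left | rewrite bz mul1r -Hz].
by exists (-1), z; split; [right | rewrite bz mulN1r mulrN opprK -Hz].
Qed.

Lemma fixed_sqrt_sum (x y : F) : bar x = x -> bar y = y ->
  exists2 r, bar r = r & x ^+ 2 + y ^+ 2 = r ^+ 2.
Proof.
move=> bx by_; have [z Hz] := norm_add x y.
by rewrite !expr2 -{2}bx -{2}by_ Hz; apply: norm_is_fixed_square.
Qed.

Lemma fixed_sqr_sum_eq0 (x y : F) : bar x = x -> bar y = y ->
  x ^+ 2 + y ^+ 2 = 0 -> x = 0.
Proof. by move=> bx by_ E; apply: (@norm_add_eq0 x y); rewrite bx by_ -!expr2. Qed.

End InvolutiveField.

(** * Equivalence and *congruence *)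

Section Relations.

Variables (F : fieldType).

(* With rectangular inverses no cast is needed when two dimensions are only
   provably equal. *)
Definition mxiso m n (S : 'M[F]_(m, n)) (T : 'M[F]_(n, m)) : Prop :=
  S *m T = 1%:M /\ T *m S = 1%:M.

Lemma mxiso_sym m n (S : 'M[F]_(m, n)) T : mxiso S T -> mxiso T S.
Proof. by case. Qed.

Lemma mxiso1 m : mxiso (1%:M : 'M[F]_m) 1%:M.
Proof. by split; rewrite mulmx1. Qed.

Lemma mxisoM m n p (S : 'M[F]_(m, n)) T (S' : 'M[F]_(n, p)) T' :
  mxiso S T -> mxiso S' T' -> mxiso (S *m S') (T' *m T).
Proof.
move=> [ST TS] [ST' TS']; split.
  by rewrite mulmxA -(mulmxA S) ST' mulmx1.
by rewrite mulmxA -(mulmxA T') TS mulmx1.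
Qed.

Lemma mxiso_dim m n (S : 'M[F]_(m, n)) T : mxiso S T -> m = n.
Proof.
by move=> [ST TS]; apply/eqP; rewrite eqn_leq (mulmx1_min ST) (mulmx1_min TS).
Qed.

Lemma mxiso_unit n (S : 'M[F]_n) : S \in unitmx -> mxiso S (invmx S).
Proof. by move=> uS; split; rewrite ?mulmxV ?mulVmx. Qed.

Lemma mxiso_unitmx n (S T : 'M[F]_n) : mxiso S T -> S \in unitmx /\ T = invmx S.
Proof.
move=> [ST _]; have [uS _] := mulmx1_unit ST; split=> //.
by rewrite -[RHS]mulmx1 -ST mulKmx.
Qed.

Lemma mxiso_block m n p q (S : 'M[F]_(m, n)) T (S' : 'M[F]_(p, q)) T' :
  mxiso S T -> mxiso S' T' -> mxiso (block_mx S 0 0 S') (block_mx T 0 0 T').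
Proof.
move=> [ST TS] [ST' TS'].
by split; rewrite mulmx_block ?mul0mx ?mulmx0 ?addr0 ?add0r ?ST ?TS ?ST' ?TS' -scalar_mx_block.
Qed.

Definition equivalentI (P Q : mxpair F) : Prop :=
  exists (R : 'M[F]_(nrows Q, nrows P)) R' (S : 'M[F]_(ncols P, ncols Q)) S',
    [/\ mxiso R R', mxiso S S', R *m mxfst P *m S = mxfst Q
      & R *m mxsnd P *m S = mxsnd Q].

Lemma equivalentP P Q : equivalent P Q <-> equivalentI P Q.
Proof.
split.
  case: P Q => [m n A B] [m' n' A' B'] [/= er [/= ec [R [S [/= uR uS]]]]].
  case: m' / er A' B' => A' B'; case: n' / ec A' B' => A' B'.
  rewrite !castmx_id => EA EB.
  exists R, (invmx R), S, (invmx S).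
  by split=> //; apply: mxiso_unit.
case: P Q => [m n A B] [m' n' A' B'] [/= R [R' [S [S' [/= iR iS EA EB]]]]].
have er := mxiso_dim iR; have ec := mxiso_dim iS.
case: m / er A B R R' iR EA EB => A B R R' iR EA EB.
case: n' / ec A' B' S S' iS EA EB => A' B' S S' iS EA EB.
exists (erefl _), (erefl _), R, S; rewrite !castmx_id.
by have [uR _] := mxiso_unitmx iR; have [uS _] := mxiso_unitmx iS.
Qed.

Lemma equivalentI_refl P : equivalentI P P.
Proof. by exists 1%:M, 1%:M, 1%:M, 1%:M; split; rewrite ?mulmx1 ?mul1mx //; apply: mxiso1. Qed.

Lemma equivalentI_sym P Q : equivalentI P Q -> equivalentI Q P.
Proof.
move=> [R [R' [S [S' [iR iS EA EB]]]]]; exists R', R, S', S.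
have [RR R'R] := iR; have [SS S'S] := iS.
split; [exact: mxiso_sym | exact: mxiso_sym | rewrite -EA | rewrite -EB];
  by rewrite !mulmxA R'R mul1mx -mulmxA SS mulmx1.
Qed.

Lemma equivalentI_trans P Q T : equivalentI P Q -> equivalentI Q T -> equivalentI P T.
Proof.
move=> [R [R' [S [S' [iR iS EA EB]]]]] [R2 [R2' [S2 [S2' [iR2 iS2 EA2 EB2]]]]].
exists (R2 *m R), (R' *m R2'), (S *m S2), (S2' *m S').
split; [exact: mxisoM | exact: mxisoM | rewrite -EA2 -EA | rewrite -EB2 -EB];
  by rewrite !mulmxA.
Qed.

Lemma equivalentI_add P P' Q Q' : equivalentI P P' -> equivalentI Q Q' ->
  equivalentI (mxpair_add P Q) (mxpair_add P' Q').
Proof.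
move=> [R [R' [S [S' [iR iS EA EB]]]]] [R2 [R2' [S2 [S2' [iR2 iS2 EA2 EB2]]]]].
exists (block_mx R 0 0 R2), (block_mx R' 0 0 R2').
exists (block_mx S 0 0 S2), (block_mx S' 0 0 S2').
split; [exact: mxiso_block | exact: mxiso_block | |];
  by rewrite /= !mulmx_block !(mul0mx, mulmx0, addr0, add0r) ?EA ?EB ?EA2 ?EB2.
Qed.

(** Direct sums of lists end with the empty pair, and [m + 0] is not convertible to [m]; the
    rectangular matrices below play the role of identities between these sizes. *)
Lemma equivalentI_addn0 P : equivalentI P (mxpair_add P (@MxPair F 0 0 0 0)).
Proof.
exists (col_mx 1%:M 0), (row_mx 1%:M 0), (row_mx 1%:M 0), (col_mx 1%:M 0).
have iso m : mxiso (row_mx (1%:M : 'M[F]_m) (0 : 'M_(m, 0))) (col_mx 1%:M 0).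
  split; first by rewrite mul_row_col mulmx1 mul0mx addr0.
  rewrite mul_col_row mulmx1 mulmx0 !mul0mx; apply/matrixP => j k.
  case: (split_ordP j) => [j' ->|[]//]; case: (split_ordP k) => [k' ->|[]//].
  by rewrite block_mxEul !mxE eq_lshift.
split; [exact/mxiso_sym/iso | exact: iso | |];
  by rewrite /= mul_col_mx mul_col_row !(mul1mx, mul0mx, mulmx1, mulmx0).
Qed.

(** A change of basis of the pencil, which moves the eigenvalues (infinity included) by a Möbius
    transformation. *)
Definition lin_pair (x y z w : F) (P : mxpair F) : mxpair F :=
  MxPair (x *: mxfst P + y *: mxsnd P) (z *: mxfst P + w *: mxsnd P).

Lemma equivalentI_lin x y z w P Q :
  equivalentI P Q -> equivalentI (lin_pair x y z w P) (lin_pair x y z w Q).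
Proof.
move=> [R [R' [S [S' [iR iS EA EB]]]]]; exists R, R', S, S'.
by split=> //=; rewrite mulmxDr -!scalemxAr mulmxDl -!scalemxAl EA EB.
Qed.

Lemma mxiso_reindex m m' (f : 'I_m' -> 'I_m) : m' = m -> injective f ->
  mxiso (\matrix_(i, j) (i == f j)%:R : 'M[F]_(m, m')) (\matrix_(i, j) (j == f i)%:R).
Proof.
move=> Em; case: m / Em f => f f_inj; have [g fK gK] := injF_bij f_inj.
split; apply/matrixP => j k; rewrite !mxE.
  rewrite (bigD1 (g j)) //= !mxE gK eqxx mul1r big1 ?addr0 => [|l ne].
    by rewrite eq_sym.
  by rewrite !mxE; case: eqP => [E|]; rewrite ?mul0r //; rewrite E fK eqxx in ne.
rewrite (bigD1 (f j)) //= !mxE eqxx mul1r big1 ?addr0 => [|l ne].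
  by rewrite (inj_eq f_inj).
by rewrite !mxE (negPf ne) mul0r.
Qed.

Lemma mxsubE_mul m n m' n' (f : 'I_m' -> 'I_m) (g : 'I_n' -> 'I_n) (A : 'M[F]_(m, n)) :
  (\matrix_(i, j) (j == f i)%:R) *m A *m (\matrix_(i, j) (i == g j)%:R) = mxsub f g A.
Proof.
apply/matrixP => j k; rewrite !mxE (bigD1 (g k)) //= big1 ?addr0 => [|l ne].
  rewrite !mxE eqxx mulr1 (bigD1 (f j)) //= big1 ?addr0 => [|l ne].
    by rewrite !mxE eqxx mul1r.
  by rewrite !mxE (negPf ne) mul0r.
by rewrite !mxE (negPf ne) mulr0.
Qed.

End Relations.

Section StarCongruence.

Variables (F : fieldType) (bar : {rmorphism F -> F}).
Hypothesis barK : involutive bar.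
Local Notation adj := (adjmx bar).

Lemma adjmxM m n p (A : 'M[F]_(m, n)) (B : 'M[F]_(n, p)) : adj (A *m B) = adj B *m adj A.
Proof. by rewrite /adjmx trmx_mul map_mxM. Qed.

Lemma adjmxK m n (A : 'M[F]_(m, n)) : adj (adj A) = A.
Proof. by apply/matrixP => j k; rewrite !mxE barK. Qed.

Lemma adjmxD m n (A B : 'M[F]_(m, n)) : adj (A + B) = adj A + adj B.
Proof. by apply/matrixP => j k; rewrite !mxE rmorphD. Qed.

Lemma adjmxN m n (A : 'M[F]_(m, n)) : adj (- A) = - adj A.
Proof. by apply/matrixP => j k; rewrite !mxE rmorphN. Qed.

Lemma adjmxB m n (A B : 'M[F]_(m, n)) : adj (A - B) = adj A - adj B.
Proof. by rewrite adjmxD adjmxN. Qed.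

Lemma adjmxZ m n a (A : 'M[F]_(m, n)) : adj (a *: A) = bar a *: adj A.
Proof. by apply/matrixP => j k; rewrite !mxE rmorphM. Qed.

Lemma adjmx1 n : adj (1%:M : 'M[F]_n) = 1%:M.
Proof. by rewrite /adjmx trmx1 map_mx1. Qed.

Lemma adjmx0 m n : adj (0 : 'M[F]_(m, n)) = 0.
Proof. by rewrite /adjmx trmx0 map_mx0. Qed.

Lemma adjmx_row_mx m n p (A : 'M[F]_(m, n)) (B : 'M[F]_(m, p)) :
  adj (row_mx A B) = col_mx (adj A) (adj B).
Proof. by rewrite /adjmx tr_row_mx map_col_mx. Qed.

Lemma adjmx_block m n p q (A : 'M[F]_(m, n)) (B : 'M[F]_(m, p)) (C : 'M[F]_(q, n)) (D : 'M[F]_(q, p)) :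
  adj (block_mx A B C D) = block_mx (adj A) (adj C) (adj B) (adj D).
Proof. by rewrite /adjmx tr_block_mx map_block_mx. Qed.

Lemma mxtrace_adj n (A : 'M[F]_n) : \tr (adj A) = bar (\tr A).
Proof. by rewrite /adjmx trace_map_mx mxtrace_tr. Qed.

Lemma mxiso_adj m n (S : 'M[F]_(m, n)) T : mxiso S T -> mxiso (adj T) (adj S).
Proof. by move=> [ST TS]; split; rewrite -adjmxM ?ST ?TS adjmx1. Qed.

Definition hermitian_pair (P : sqpair F) : Prop :=
  adj (sqfst P) = sqfst P /\ adj (sqsnd P) = sqsnd P.

Definition starI (P Q : sqpair F) : Prop :=
  exists (S : 'M[F]_(sqdim P, sqdim Q)) S',
    [/\ mxiso S S', adj S *m sqfst P *m S = sqfst Q & adj S *m sqsnd P *m S = sqsnd Q].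

Lemma star_congruentP P Q : star_congruent bar P Q <-> starI P Q.
Proof.
split.
  case: P Q => [m A B] [m' A' B'] [/= e [S [/= uS]]].
  case: m' / e A' B' => A' B'; rewrite !castmx_id => EA EB.
  by exists S, (invmx S); split=> //; apply: mxiso_unit.
case: P Q => [m A B] [m' A' B'] [/= S [S' [/= iS EA EB]]].
have e := mxiso_dim iS; case: m' / e A' B' S S' iS EA EB => A' B' S S' iS EA EB.
exists (erefl _), S; rewrite !castmx_id.
by have [uS _] := mxiso_unitmx iS.
Qed.

Lemma starI_equivalentI P Q : starI P Q -> equivalentI P Q.
Proof.
move=> [S [S' [iS EA EB]]]; exists (adj S), (adj S'), S, S'.
by split=> //; apply/mxiso_adj/mxiso_sym.
Qed.

Lemma starI_refl P : starI P P.
Proof. by exists 1%:M, 1%:M; split; rewrite ?adjmx1 ?mulmx1 ?mul1mx //; apply: mxiso1. Qed.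

Lemma starI_sym P Q : starI P Q -> starI Q P.
Proof.
move=> [S [S' [iS EA EB]]]; exists S', S.
split; [exact: mxiso_sym | rewrite -EA | rewrite -EB];
  by have [SS _] := iS; rewrite !mulmxA -adjmxM SS adjmx1 mul1mx -mulmxA SS mulmx1.
Qed.

Lemma starI_trans P Q T : starI P Q -> starI Q T -> starI P T.
Proof.
move=> [S [S' [iS EA EB]]] [S2 [S2' [iS2 EA2 EB2]]]; exists (S *m S2), (S2' *m S').
by split; [exact: mxisoM | rewrite -EA2 -EA | rewrite -EB2 -EB]; rewrite adjmxM !mulmxA.
Qed.

Lemma starI_add P P' Q Q' : starI P P' -> starI Q Q' ->
  starI (sqpair_add P Q) (sqpair_add P' Q').
Proof.
move=> [S [S' [iS EA EB]]] [S2 [S2' [iS2 EA2 EB2]]].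
exists (block_mx S 0 0 S2), (block_mx S' 0 0 S2').
split; [exact: mxiso_block | |];
  by rewrite /= adjmx_block !adjmx0 !mulmx_block !(mul0mx, mulmx0, addr0, add0r) ?EA ?EB ?EA2 ?EB2.
Qed.

Lemma starI_swap P Q T : starI (sqpair_add P (sqpair_add Q T)) (sqpair_add Q (sqpair_add P T)).
Proof.
case: P Q T => [m A B] [n A' B'] [p A'' B''].
(* The block permutation exchanging the first two summands; its adjoint and its inverse are the same
   matrix with the sizes exchanged. *)
pose U (m n p : nat) : 'M[F]_(m + (n + p), n + (m + p)) :=
  block_mx 0 (row_mx 1%:M 0) (col_mx 1%:M 0) (block_mx 0 0 0 1%:M).
have UU a1 b1 c1 : U a1 b1 c1 *m U b1 a1 c1 = 1%:M.
  rewrite /U mulmx_block.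
  rewrite !(mul_row_col, mul_row_block, mul_block_col, mul_col_row, mulmx_block, mul_col_mx, mul_mx_row).
  rewrite !(mul0mx, mulmx0, mul1mx, mulmx1, addr0, add0r).
  rewrite !scalar_mx_block /block_mx.
  by rewrite !(row_mx0, col_mx0, addr0, add0r, add_col_mx, add_row_mx).
have adjU a1 b1 c1 : adj (U a1 b1 c1) = U b1 a1 c1.
  rewrite /U adjmx_block adjmx_row_mx !adjmx_block /adjmx tr_col_mx map_row_mx.
  by rewrite !trmx0 !trmx1 !map_mx0 !map_mx1.
exists (U m n p), (U n m p); rewrite /= adjU; split; first by split; apply: UU.
rewrite /U /block_mx !(mul_row_col, mul_col_row, mul_col_mx, mul_mx_row) /block_mx
  !(mul_row_col, mul_col_row, mul_col_mx, mul_mx_row, mul0mx, mulmx0, mul1mx, mulmx1,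
    row_mx0, col_mx0, addr0, add0r, add_col_mx, add_row_mx).
  by congr col_mx; rewrite -[LHS]block_mxEv block_mxEh col_mx0.
rewrite /U /block_mx !(mul_row_col, mul_col_row, mul_col_mx, mul_mx_row) /block_mx
  !(mul_row_col, mul_col_row, mul_col_mx, mul_mx_row, mul0mx, mulmx0, mul1mx, mulmx1,
    row_mx0, col_mx0, addr0, add0r, add_col_mx, add_row_mx).
by congr col_mx; rewrite -[LHS]block_mxEv block_mxEh col_mx0.
Qed.

End StarCongruence.

(** * Splitting off direct summands *)

Section Splitting.

Variables (F : fieldType) (bar : {rmorphism F -> F}).
Hypothesis barK : involutive bar.
Local Notation adj := (adjmx bar).

(** In a full rank factorization the outer factors of $KLKL=KL$ can be cancelled. *)
Lemma idempotent_factor n (Pi : 'M[F]_n) : Pi *m Pi = Pi ->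
  exists d (K : 'M_(n, d)) (L : 'M_(d, n)), Pi = K *m L /\ L *m K = 1%:M.
Proof.
move=> idem; exists (\rank Pi), (col_base Pi), (row_base Pi).
rewrite mulmx_base; split=> //.
have /row_fullP [U HU] := col_base_full Pi; have /row_freeP [V HV] := row_base_free Pi.
move: (mulmx_base Pi); move: (col_base Pi) (row_base Pi) U V HU HV.
move: (\rank Pi) => d K L U V HU HV KL.
suff: (U *m K) *m (L *m K) *m (L *m V) = (U *m K) *m (L *m V).
  by rewrite HU HV !mul1mx mulmx1.
by rewrite !mulmxA -!(mulmxA U K L) KL -(mulmxA _ K L) KL -(mulmxA U Pi) idem.
Qed.

(* [1 - E g^*] projects onto a complement of the image of [E]. *)
Lemma split_summand N m (A B : 'M[F]_N) (E g : 'M_(N, m)) (X Y : 'M_m) :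
  adj A = A -> adj B = B -> A *m E = g *m X -> B *m E = g *m Y ->
  adj g *m E = 1%:M ->
  exists2 T : sqpair F, hermitian_pair bar T
    & starI bar (SqPair A B) (sqpair_add (SqPair X Y) T).
Proof.
move=> hA hB EA EB gE.
pose Pi := 1%:M - E *m adj g.
have gPi : adj g *m Pi = 0 by rewrite mulmxBr mulmx1 mulmxA gE mul1mx subrr.
have PiE : Pi *m E = 0 by rewrite mulmxBl mul1mx -mulmxA gE mulmx1 subrr.
have idem : Pi *m Pi = Pi by rewrite {1}/Pi mulmxBl mul1mx -mulmxA gPi mulmx0 subr0.
have [d [K [L [PiKL LK]]]] := idempotent_factor idem.
have gK : adj g *m K = 0 by rewrite -[K]mulmx1 -LK (mulmxA K) -PiKL mulmxA gPi mul0mx.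
have LE : L *m E = 0 by rewrite -[L]mul1mx -LK -(mulmxA L) -PiKL -mulmxA PiE mulmx0.
have Eg : adj E *m g = 1%:M by rewrite -[g](adjmxK barK) -adjmxM gE adjmx1.
have Kg : adj K *m g = 0 by rewrite -[g](adjmxK barK) -adjmxM gK adjmx0.
(* $CE=gZ$ makes both off-diagonal blocks vanish: one through [Kg], the other, by taking adjoints,
   through [gK]. *)
have red (C Z : 'M_(_, _)) : adj C = C -> C *m E = g *m Z ->
    adj (row_mx E K) *m C *m row_mx E K = block_mx Z 0 0 (adj K *m C *m K).
  move=> hC EC; rewrite adjmx_row_mx mul_col_mx mul_col_row -!(mulmxA _ C E) EC !mulmxA Eg Kg.
  have -> : adj E *m C *m K = 0.
    by rewrite -{1}hC -adjmxM EC adjmxM -mulmxA gK mulmx0.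
  by rewrite mul1mx mul0mx.
exists (SqPair (adj K *m A *m K) (adj K *m B *m K)).
  by split; rewrite /= !adjmxM (adjmxK barK) ?hA ?hB mulmxA.
exists (row_mx E K), (col_mx (adj g) L) => /=; split; [split| |]; last 2 first.
- exact: red.
- exact: red.
- by rewrite mul_row_col -PiKL /Pi addrC subrK.
- by rewrite mul_col_row gE gK LE LK -scalar_mx_block.
Qed.

Definition hom (P Q : mxpair F) (E : 'M_(ncols Q, ncols P)) (g : 'M_(nrows Q, nrows P)) : Prop :=
  mxfst Q *m E = g *m mxfst P /\ mxsnd Q *m E = g *m mxsnd P.

(** The hyperbolic pair on the sum of $M$ and its dual: both summands are isotropic, and the pencil
    of $M$ is the lower left block. *)
Definition hyp (M : mxpair F) : sqpair F :=
  @SqPair F (ncols M + nrows M) (block_mx 0 (adj (mxfst M)) (mxfst M) 0)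
    (block_mx 0 (adj (mxsnd M)) (mxsnd M) 0).

Definition adj_pair (P : mxpair F) : mxpair F := MxPair (adj (mxfst P)) (adj (mxsnd P)).

(** An equivalence by $R$ and $S$ acts on the hyperbolic pair as the *congruence by the block
    diagonal of [S] and [adj R]. This is how normal forms under equivalence become normal forms
    under *congruence. *)
Lemma starI_hyp P Q : equivalentI P Q -> starI bar (hyp P) (hyp Q).
Proof.
move=> [R [R' [S [S' [iR iS EA EB]]]]].
exists (block_mx S 0 0 (adj R)), (block_mx S' 0 0 (adj R')).
split; first by apply: mxiso_block => //; apply/mxiso_adj/mxiso_sym.
  by rewrite /= -EA adjmx_block !adjmx0 (adjmxK barK) !mulmx_block !adjmxM !mulmxA
    !(mul0mx, mulmx0, addr0, add0r).
by rewrite /= -EB adjmx_block !adjmx0 (adjmxK barK) !mulmx_block !adjmxM !mulmxA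
    !(mul0mx, mulmx0, addr0, add0r).
Qed.

Lemma hyp_equivalent_lr M : equivalentI (hyp M) (mxpair_add (adj_pair M) M).
Proof.
exists 1%:M, 1%:M, (block_mx 0 1%:M 1%:M 0), (block_mx 0 1%:M 1%:M 0).
have iso m n : mxiso (block_mx 0 1%:M 1%:M 0 : 'M[F]_(m + n, n + m)) (block_mx 0 1%:M 1%:M 0).
  by split; rewrite mulmx_block !(mul0mx, mulmx0, mulmx1, addr0, add0r) -scalar_mx_block.
split; [exact: mxiso1 | exact: iso | |];
  by rewrite /= mul1mx mulmx_block !(mul0mx, mulmx0, mulmx1, addr0, add0r).
Qed.

Lemma hyp_equivalent_rl M : equivalentI (hyp M) (mxpair_add M (adj_pair M)).
Proof.
exists (block_mx 0 1%:M 1%:M 0), (block_mx 0 1%:M 1%:M 0), 1%:M, 1%:M.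
have iso m n : mxiso (block_mx 0 1%:M 1%:M 0 : 'M[F]_(m + n, n + m)) (block_mx 0 1%:M 1%:M 0).
  by split; rewrite mulmx_block !(mul0mx, mulmx0, mulmx1, addr0, add0r) -scalar_mx_block.
split; [exact: iso | exact: mxiso1 | |];
  by rewrite /= mulmx1 mulmx_block !(mul0mx, mulmx0, mul1mx, addr0, add0r).
Qed.

Hypothesis two_neq0 : 2%:R != 0 :> F.

(* If [phi : M -> P] has a left inverse [psi] and [phi^* phi = 0], then after
   replacing [psi] by [psi - psi psi^* phi^* / 2] the morphism
   [(phi, psi^* ) : M + M^* -> P] is left inverse to its own adjoint. *)
Lemma split_hyp_inverse N (A B : 'M[F]_N) (M : mxpair F)
    (E : 'M_(N, ncols M)) (g : 'M_(N, nrows M)) (p : 'M_(ncols M, N)) (q : 'M_(nrows M, N)) :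
  adj A = A -> adj B = B ->
  hom (Q := MxPair A B) E g -> hom (P := MxPair A B) p q ->
  p *m E = 1%:M -> q *m g = 1%:M -> adj g *m E = 0 ->
  exists2 T : sqpair F, hermitian_pair bar T
    & starI bar (SqPair A B) (sqpair_add (hyp M) T).
Proof.
move=> hA hB [/= EA EB] [/= pA pB] pE qg gE.
have Eg : adj E *m g = 0 by rewrite -[g](adjmxK barK) -adjmxM gE adjmx0.
pose p' := p - 2%:R^-1 *: (p *m adj q *m adj g).
pose q' := q - 2%:R^-1 *: (q *m adj p *m adj E).
have b2 : bar 2%:R^-1 = 2%:R^-1 by rewrite fmorphV rmorph_nat.
have p'E : p' *m E = 1%:M by rewrite mulmxBl pE -scalemxAl -(mulmxA _ (adj g)) gE mulmx0 scaler0 subr0.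
have q'g : q' *m g = 1%:M by rewrite mulmxBl qg -scalemxAl -(mulmxA _ (adj E)) Eg mulmx0 scaler0 subr0.
have pq' : p' *m adj q' = 0.
  have -> : adj q' = adj q - 2%:R^-1 *: (E *m (p *m adj q)).
    by rewrite /q' adjmxB adjmxZ b2 !adjmxM !(adjmxK barK).
  rewrite mulmxBr -scalemxAr (mulmxA p' E) p'E mul1mx mulmxBl -scalemxAl -(mulmxA _ (adj g)).
  rewrite -adjmxM qg adjmx1 mulmx1 -addrA -opprD -scalerDl.
  have -> : 2%:R^-1 + 2%:R^-1 = 1 :> F.
    by apply: (mulfI two_neq0); rewrite mulrDr divff // mulr1 -(natrD F 1 1).
  by rewrite scale1r subrr.
have hom' (C Z : 'M_(_, _)) : adj C = C -> C *m E = g *m Z -> Z *m p = q *m C -> Z *m p' = q' *m C.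
  move=> hC EC pC; rewrite mulmxBr mulmxBl pC -!scalemxAr -!scalemxAl; congr (_ - _ *: _).
  rewrite !mulmxA pC -(mulmxA _ (adj E)) -{2}hC -adjmxM EC adjmxM !mulmxA.
  by congr (_ *m _); rewrite -(mulmxA _ (adj p)) -adjmxM pC adjmxM hC mulmxA.
apply: (@split_summand N _ A B (row_mx E (adj q')) (row_mx (adj p') g)) => //=.
- rewrite mul_mx_row mul_row_block !mulmx0 addr0 add0r EA; congr row_mx.
  by rewrite -{1}hA -adjmxM -(hom' A (mxfst M)) // adjmxM.
- rewrite mul_mx_row mul_row_block !mulmx0 addr0 add0r EB; congr row_mx.
  by rewrite -{1}hB -adjmxM -(hom' B (mxsnd M)) // adjmxM.
- rewrite adjmx_row_mx (adjmxK barK) mul_col_row p'E gE pq' -adjmxM q'g adjmx1.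
  by rewrite -scalar_mx_block.
Qed.

(** [p *m E] and [q *m g] form an automorphism of $M$; composing the retraction with its inverse
    makes it a genuine left inverse. *)
Lemma split_hyp N (A B : 'M[F]_N) (M : mxpair F)
    (E : 'M_(N, ncols M)) (g : 'M_(N, nrows M)) (p : 'M_(ncols M, N)) (q : 'M_(nrows M, N)) :
  adj A = A -> adj B = B ->
  hom (Q := MxPair A B) E g -> hom (P := MxPair A B) p q ->
  p *m E \in unitmx -> q *m g \in unitmx -> adj g *m E = 0 ->
  exists2 T : sqpair F, hermitian_pair bar T
    & starI bar (SqPair A B) (sqpair_add (hyp M) T).
Proof.
move=> hA hB hE [/= pA pB] upE uqg gE.
apply: (@split_hyp_inverse N A B M E g (invmx (p *m E) *m p) (invmx (q *m g) *m q)) => //.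
- have [/= EA EB] := hE.
  have tw (C Z : 'M_(_, _)) : C *m E = g *m Z -> Z *m p = q *m C ->
      Z *m (invmx (p *m E) *m p) = invmx (q *m g) *m q *m C.
    move=> EC pC.
    have com : Z *m (p *m E) = q *m g *m Z by rewrite mulmxA pC -mulmxA EC mulmxA.
    have : Z *m invmx (p *m E) = invmx (q *m g) *m Z.
      by apply: (can_inj (mulKmx uqg)); rewrite mulmxA -com mulmxK // mulKVmx.
    by rewrite mulmxA => ->; rewrite -!mulmxA pC.
  by split => /=; apply: tw.
- by rewrite -mulmxA mulVmx.
- by rewrite -mulmxA mulVmx.
Qed.

End Splitting.

(** * Nilpotent shifts and Jordan chains *)

Section Shift.

Variable F : fieldType.

Local Notation shift n := (jordan_block n (0 : F)).

Lemma shiftE n (j k : 'I_n) : shift n j k = (j.+1 == k :> nat)%:R.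
Proof. by rewrite mxE; case: eqP => [->|//]; case: eqP => // /esym /n_Sn. Qed.

Lemma jordan_shift n (a : F) : jordan_block n a = a%:M + shift n.
Proof.
apply/matrixP => j k; rewrite mxE [in RHS]mxE shiftE mxE.
by case: eqP => [->|_]; rewrite ?mulr1n ?mulr0n ?add0r //; case: eqP => [/esym /n_Sn|]; rewrite ?addr0.
Qed.

Lemma shift_exp n k (i j : 'I_n) : (shift n ^+ k) i j = (i + k == j)%N%:R.
Proof.
elim: k i j => [|k IHk] i j; first by rewrite expr0 mxE addn0.
rewrite exprS -mulmxE mxE; case: (ltnP i.+1 n) => [lt|ge].
  rewrite (bigD1 (Ordinal lt)) //= big1 ?addr0 => [|l ne].
    by rewrite shiftE eqxx mul1r IHk /= addSnnS.
  by rewrite shiftE; case: eqP => [E|_]; rewrite ?mul0r //; case/eqP: ne; apply: val_inj.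
rewrite big1 => [|l _].
  have lt : (j < i + k.+1)%N by rewrite (leq_trans (ltn_ord j)) // (leq_trans ge) // -addSnnS leq_addr.
  by rewrite eqn_leq leqNgt lt.
rewrite shiftE; case: eqP => [E|_]; last by rewrite mul0r.
by have := ltn_ord l; rewrite -E ltnNge ge.
Qed.

Lemma shift_nilp n : shift n ^+ n = 0.
Proof.
apply/matrixP => i j; rewrite shift_exp mxE.
by case: eqP => // E; have := ltn_ord j; rewrite -E ltnNge leq_addl.
Qed.

Lemma mul_mx_shiftS m n (X : 'M[F]_(m, n)) i (j k : 'I_n) :
  k.+1 = j :> nat -> (X *m shift n) i j = X i k.
Proof.
move=> E; rewrite mxE (bigD1 k) //= big1 ?addr0 => [|l ne]; first by rewrite shiftE E eqxx mulr1.
by rewrite shiftE -E eqSS (inj_eq val_inj) (negPf ne) mulr0.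
Qed.

Lemma mul_mx_shift0 m n (X : 'M[F]_(m, n)) i (j : 'I_n) : j = 0%N :> nat -> (X *m shift n) i j = 0.
Proof. by move=> E; rewrite mxE big1 // => l _; rewrite shiftE E mulr0. Qed.

Lemma mul_shift_mxS m n (X : 'M[F]_(m, n)) (i k : 'I_m) j :
  i.+1 = k :> nat -> (shift m *m X) i j = X k j.
Proof.
move=> E; rewrite mxE (bigD1 k) //= big1 ?addr0 => [|l ne]; first by rewrite shiftE E eqxx mul1r.
by rewrite shiftE E eq_sym (inj_eq val_inj) (negPf ne) mul0r.
Qed.

Lemma mul_shift_mx_last m n (X : 'M[F]_(m, n)) (i : 'I_m) j : i.+1 = m -> (shift m *m X) i j = 0.
Proof.
move=> E; rewrite mxE big1 // => l _.
by rewrite shiftE E; case: eqP => [e|_]; rewrite ?mul0r //; have := ltn_ord l; rewrite -e ltnn.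
Qed.

(** The operator $X\mapsto aX-Xb$ is nilpotent, so $c\neq0$ is not an eigenvalue: $a^kXb^l$ vanishes
    for $k+l\ge s+t$, and the equation lowers this bound one unit at a time. *)
Lemma nilp_sylvester m n (a : 'M[F]_m) (b : 'M_n) s t c (X : 'M_(m, n)) :
  a ^+ s = 0 -> b ^+ t = 0 -> c != 0 -> c *: X = a *m X - X *m b -> X = 0.
Proof.
move=> as0 bt0 c0 EX.
suff H d : forall k l, (s + t <= k + l + d)%N -> a ^+ k *m X *m b ^+ l = 0.
  by have := H (s + t)%N 0%N 0%N (leqnn _); rewrite !expr0 -!idmxE mul1mx mulmx1.
elim: d => [|d IHd] k l le.
  case: (leqP s k) => [sk|ks].
    by rewrite -(subnK sk) exprD as0 mulr0 !mul0mx.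
  have tl : (t <= l)%N by rewrite addn0 in le; rewrite -(leq_add2l s) (leq_trans le) // leq_add2r ltnW.
  by rewrite -(subnKC tl) exprD bt0 mul0r mulmx0.
apply: (scalerI c0); rewrite scaler0 scalemxAl scalemxAr EX mulmxBr mulmxBl.
have -> : a ^+ k *m (a *m X) *m b ^+ l = a ^+ k.+1 *m X *m b ^+ l by rewrite exprSr -mulmxE !mulmxA.
have -> : a ^+ k *m (X *m b) *m b ^+ l = a ^+ k *m X *m b ^+ l.+1 by rewrite exprS -mulmxE !mulmxA.
by rewrite !IHd ?subrr // !(addSn, addnS) -addnS.
Qed.

(** The kernel of [S] is stable under the shift, and a nonzero stable subspace contains a vector
    killed by the shift, a multiple of the first basis vector. In the induction, [d] bounds the
    support of [u]. *)
Lemma chain_inj N n (L : 'M[F]_N) (S : 'M_(N, n)) :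
  L *m S = S *m shift n -> (forall j : 'I_n, j = 0%N :> nat -> col j S != 0) ->
  forall u : 'cV_n, S *m u = 0 -> u = 0.
Proof.
move=> LS S0; suff H d : forall u : 'cV_n, S *m u = 0 -> (forall j : 'I_n, (d <= j)%N -> u j 0 = 0) -> u = 0.
  by move=> u Su; apply: (H n u Su) => j; rewrite leqNgt ltn_ord.
elim: d => [|d IHd] u Su ud; first by apply/matrixP => j k; rewrite ord1 mxE ud.
have su : shift n *m u = 0.
  apply: IHd => [|j dj]; first by rewrite mulmxA -LS -mulmxA Su mulmx0.
  case: (ltnP j.+1 n) => [lt|ge]; first by rewrite (@mul_shift_mxS _ _ _ _ (Ordinal lt)) // ud.
  by apply: mul_shift_mx_last; apply/eqP; rewrite eqn_leq ge ltn_ord.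
have uS (j : 'I_n) : (0 < j)%N -> u j 0 = 0.
  case: j => [[|j] lt] // _; have := congr1 (fun M : 'M[F]_(n, 1) => M (Ordinal (ltnW lt)) 0) su.
  by rewrite (@mul_shift_mxS _ _ _ _ (Ordinal lt)) // [RHS]mxE.
apply/matrixP => j k; rewrite ord1 mxE; case: (posnP j) => [j0|/uS //].
have : S *m u = u j 0 *: col j S.
  apply/matrixP => a b; rewrite !mxE (bigD1 j) //= big1 ?addr0 => [|l ne]; first by rewrite ord1 mulrC.
  by rewrite [b]ord1 uS ?mulr0 // lt0n -j0 (inj_eq val_inj).
by rewrite Su => /esym /eqP; rewrite scaler_eq0 (negPf (S0 j j0)) orbF => /eqP.
Qed.

Lemma col_inj_row_free m n (S : 'M[F]_(m, n)) :
  (forall u : 'cV_n, S *m u = 0 -> u = 0) -> row_free S^T.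
Proof.
move=> inj; apply: inj_row_free => v vS.
by apply: trmx_inj; rewrite trmx0; apply: inj; rewrite -[S]trmxK -trmx_mul vS trmx0.
Qed.

Lemma col_inj_leq m n (S : 'M[F]_(m, n)) : (forall u : 'cV_n, S *m u = 0 -> u = 0) -> (n <= m)%N.
Proof. by move=> /col_inj_row_free /eqP <-; apply: rank_leq_col. Qed.

Lemma col_inj_unit n (S : 'M[F]_n) : (forall u : 'cV_n, S *m u = 0 -> u = 0) -> S \in unitmx.
Proof. by move=> /col_inj_row_free; rewrite row_free_unit unitmx_tr. Qed.

(** The Jordan chain of [w], written from its bottom $L^{n-1}w$ to its top $w$, so that $L$ acts on
    it as the upper shift. *)
Definition chainmx N (L : 'M[F]_N) (w : 'cV_N) n : 'M_(N, n) :=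
  \matrix_(i, j) (L ^+ (n.-1 - j) *m w) i 0.

Lemma chainmx_mul N (L : 'M[F]_N) w n : L ^+ n *m w = 0 ->
  L *m chainmx L w n = chainmx L w n *m shift n.
Proof.
move=> Lw; apply/matrixP => i j.
have -> : (L *m chainmx L w n) i j = (L ^+ (n - j) *m w) i 0.
  have -> : (n - j)%N = (n.-1 - j).+1.
    by case: n j {Lw} => [[]//|m] j; rewrite /= subSn // -ltnS.
  by rewrite exprS -mulmxE -mulmxA !mxE; apply: eq_bigr => k _; rewrite mxE.
case: (posnP j) => [j0|]; first by rewrite mul_mx_shift0 // j0 subn0 Lw mxE.
case: j => [[|j] lt] // _; rewrite (@mul_mx_shiftS _ _ _ _ _ (Ordinal (ltnW lt))) // mxE /=.
by rewrite !mxE /= subnS predn_sub; apply: eq_bigr => k _.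
Qed.

Lemma chainmx_col N (L : 'M[F]_N) w n (j : 'I_n) : col j (chainmx L w n) = L ^+ (n.-1 - j) *m w.
Proof. by apply/matrixP => a b; rewrite ord1 !mxE. Qed.

Lemma chainmx_inj N (L : 'M[F]_N) w n : L ^+ n *m w = 0 -> L ^+ n.-1 *m w != 0 ->
  forall u : 'cV_n, chainmx L w n *m u = 0 -> u = 0.
Proof.
move=> Lw Lw'; apply: (@chain_inj _ _ L); first exact: chainmx_mul.
by move=> j j0; rewrite chainmx_col j0 subn0.
Qed.

(* [q] exists by duality, since [L^(n-1) w] is not in the image of [L^n]. *)
Lemma maximal_chain N (L : 'M[F]_N) (v : 'cV_N) : v != 0 -> L *m v = 0 ->
  exists n (w : 'cV_N) (q : 'rV_N),
    [/\ (0 < n)%N, L ^+ n.-1 *m w = v, L ^+ n *m w = 0, q *m L ^+ n = 0 & q *m v != 0].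
Proof.
move=> v0 Lv; pose P k := ~~ (v^T <= (L ^+ k)^T)%MS.
(* If $v$ were in the image of $L^N$, a chain of $N+1$ independent vectors would fit into dimension
   $N$. *)
have exP : exists k, P k.
  exists N; apply/negP => /submxP [D HD].
  have Hv : v = L ^+ N *m D^T by rewrite -[v]trmxK HD trmx_mul trmxK.
  suff /col_inj_leq : forall u : 'cV_N.+1, chainmx L D^T N.+1 *m u = 0 -> u = 0 by rewrite ltnn.
  by apply: chainmx_inj; rewrite ?exprS -?mulmxE -?mulmxA -Hv.
case: (ex_minnP exP) => [[|n]]; first by rewrite /P expr0 trmx1 submx1.
rewrite {1}/P submxE => /matrix0Pn [a [j nz]] min.
have /submxP [D HD] : (v^T <= (L ^+ n)^T)%MS by case: (boolP (v^T <= (L ^+ n)^T)%MS) => // /min; rewrite ltnn.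
have Hv : v = L ^+ n *m D^T by rewrite -[v]trmxK HD trmx_mul trmxK.
exists n.+1, D^T, (col j (cokermx (L ^+ n.+1)^T))^T; split=> //.
- by rewrite exprS -mulmxE -mulmxA -Hv.
- by rewrite -[X in _ *m X = _]trmxK -trmx_mul colE mulmxA mulmx_coker mul0mx trmx0.
- apply/matrix0Pn; exists 0, 0; apply: contraNneq nz => E.
  apply/eqP; rewrite -[RHS]E [a]ord1 !mxE.
  by apply: eq_bigr => k _; rewrite !mxE mulrC.
Qed.

Definition cochainmx N (L : 'M[F]_N) (q : 'rV_N) n : 'M_(n, N) :=
  \matrix_(j, i) (q *m L ^+ j) 0 i.

Lemma cochainmx_mul N (L : 'M[F]_N) q n : q *m L ^+ n = 0 ->
  cochainmx L q n *m L = shift n *m cochainmx L q n.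
Proof.
move=> qL; apply/matrixP => j i.
have -> : (cochainmx L q n *m L) j i = (q *m L ^+ j.+1) 0 i.
  by rewrite exprSr -mulmxE mulmxA mxE [RHS]mxE; apply: eq_bigr => k _; rewrite mxE.
case: (ltnP j.+1 n) => [lt|ge]; first by rewrite (@mul_shift_mxS _ _ _ _ (Ordinal lt)) // [RHS]mxE.
have E : j.+1 = n by apply/eqP; rewrite eqn_leq ge ltn_ord.
by rewrite mul_shift_mx_last // E qL mxE.
Qed.

(** The entry $(j,k)$ is $qL^{j+(n-1-k)}w$, so the product is upper triangular with constant nonzero
    diagonal; the transpose only adapts it to [det_trig]. *)
Lemma cochain_chain_unit N (L : 'M[F]_N) (w : 'cV_N) (q : 'rV_N) n :
  (0 < n)%N -> L ^+ n *m w = 0 -> q *m (L ^+ n.-1 *m w) != 0 ->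
  cochainmx L q n *m chainmx L w n \in unitmx.
Proof.
move=> n0 Lw qv; set M := _ *m _.
have ME j k : M j k = (q *m (L ^+ (j + (n.-1 - k)) *m w)) 0 0.
  rewrite exprD -mulmxE -mulmxA mulmxA !mxE; apply: eq_bigr => l _.
  by congr (_ * _); rewrite !mxE.
rewrite -unitmx_tr unitmxE det_trig; last first.
  apply/is_trig_mxP => j k lt; rewrite mxE ME.
  have le : (n <= k + (n.-1 - j))%N by have := ltn_ord j; have := ltn_ord k; lia.
  by rewrite -(subnK le) exprD -mulmxE -mulmxA Lw !mulmx0 mxE.
rewrite unitfE; apply/prodf_neq0 => j _; rewrite mxE ME subnKC; last by rewrite -ltnS (ltn_predK n0).
by apply: contraNneq qv => E; apply/eqP/matrixP => a b; rewrite !ord1 E mxE.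
Qed.

(** The exchange matrix: up to sign, the Gram matrix of a Hermitian form in a normalized chain of a
    self-adjoint operator. *)
Definition flip n : 'M[F]_n := \matrix_(j, k) (j + k == n.-1)%N%:R.

Lemma flip_sqr n : flip n *m flip n = 1%:M.
Proof.
apply/matrixP => j k; rewrite !mxE (bigD1 (rev_ord j)) //= big1 ?addr0 => [|l ne].
  rewrite !mxE /=; have := ltn_ord j; have := ltn_ord k => ltk ltj.
  have -> : (j + (n - j.+1) == n.-1)%N by lia.
  rewrite mul1r; congr (nat_of_bool _)%:R.
  by apply/eqP/eqP => [E|<-]; [apply: val_inj => /=|]; lia.
rewrite !mxE; case: eqP => [E|]; last by rewrite mul0r.
case/eqP: ne; apply: val_inj => /=; have := ltn_ord j; have := ltn_ord l; lia.
Qed.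

Definition jordan_pair n (a : F) : mxpair F := MxPair (1%:M : 'M_n) (jordan_block n a).

Lemma flip_shiftE n (j k : 'I_n) : (flip n *m shift n) j k = (j + k == n)%N%:R.
Proof.
have ltj := ltn_ord j; have ltk := ltn_ord k.
case: (posnP k) => [k0|kp]; first by rewrite mul_mx_shift0 // k0 addn0 ltn_eqF.
have lt : (k.-1 < n)%N by lia.
rewrite (@mul_mx_shiftS _ _ _ _ _ (Ordinal lt)) ?prednK // mxE /=.
by congr (nat_of_bool _)%:R; apply/eqP/eqP; lia.
Qed.

Lemma flip_shift_comm n : flip n *m shift n = (shift n)^T *m flip n.
Proof.
apply/matrixP => j k; transitivity ((flip n *m shift n) k j); first by rewrite !flip_shiftE addnC.
by rewrite !mxE; apply: eq_bigr => l _; rewrite !mxE mulrC addnC.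
Qed.

Lemma flip_jordan_comm n a : flip n *m jordan_block n a = (jordan_block n a)^T *m flip n.
Proof.
by rewrite jordan_shift mulmxDr linearD /= tr_scalar_mx mulmxDl flip_shift_comm scalar_mxC.
Qed.

End Shift.

Arguments flip {F} n.

(** * Regular pairs *)

Section RegularPairs.

Variables (F : closedFieldType) (bar : {rmorphism F -> F}).
Hypothesis barK : involutive bar.
Hypothesis bar_nonid : exists x : F, bar x <> x.
Local Notation adj := (adjmx bar).
Local Notation shift n := (jordan_block n (0 : F)).

Let two_nz : 2%:R != 0 :> F := two_neq0 barK bar_nonid.

Lemma adj_flip n : adj (flip n) = flip n.
Proof. by apply/matrixP => j k; rewrite !mxE rmorph_nat addnC. Qed.

(** The classical normal form at an eigenvalue [a] fixed by the involution, with sign characteristic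
    [e]. *)
Definition flip_pair (e : F) n (a : F) : sqpair F :=
  SqPair (e *: flip n) (e *: (flip n *m jordan_block n a)).

Section SelfAdjoint.

Variables (N : nat) (G L : 'M[F]_N).
Hypothesis hG : adj G = G.
Hypothesis hL : adj L *m G = G *m L.

(** The value of $[x,L^sy]$ for the form $[x,y]$ given by [G]. Since $L$ is self-adjoint for it,
    powers of $L$ on either argument only increase $s$. *)
Definition hform (x y : 'cV[F]_N) s : F := (adj x *m G *m L ^+ s *m y) 0 0.

Lemma self_adjoint_exp k : adj (L ^+ k) *m G = G *m L ^+ k.
Proof.
elim: k => [|k IHk]; first by rewrite !expr0 -!idmxE adjmx1 mul1mx mulmx1.
by rewrite [in LHS]exprSr -[in LHS]mulmxE adjmxM -mulmxA IHk mulmxA hL -mulmxA exprS -mulmxE.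
Qed.

Lemma hformDl x y z s : hform (x + y) z s = hform x z s + hform y z s.
Proof. by rewrite /hform adjmxD !mulmxDl mxE. Qed.

Lemma hformDr x y z s : hform x (y + z) s = hform x y s + hform x z s.
Proof. by rewrite /hform mulmxDr mxE. Qed.

Lemma hformZl c x y s : hform (c *: x) y s = bar c * hform x y s.
Proof. by rewrite /hform adjmxZ -!scalemxAl mxE. Qed.

Lemma hformZr c x y s : hform x (c *: y) s = c * hform x y s.
Proof. by rewrite /hform -!scalemxAr mxE. Qed.

Lemma hform_expr x y k s : hform x (L ^+ k *m y) s = hform x y (s + k).
Proof. by rewrite /hform exprD -mulmxE !mulmxA. Qed.

Lemma hform_expl x y k s : hform (L ^+ k *m x) y s = hform x y (s + k).
Proof.
by rewrite /hform adjmxM -(mulmxA _ (adj (L ^+ k))) self_adjoint_exp addnC exprD -mulmxE !mulmxA.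
Qed.

Lemma hform_sym x y s : hform y x s = bar (hform x y s).
Proof.
transitivity (adj (adj x *m G *m L ^+ s *m y) 0 0); last by rewrite mxE [in LHS]mxE.
by rewrite /hform !adjmxM (adjmxK barK) hG mulmxA mulmxA -(mulmxA _ _ G) self_adjoint_exp mulmxA.
Qed.

Lemma hform_kernel x y n s : L ^+ n *m y = 0 -> (n <= s)%N -> hform x y s = 0.
Proof.
move=> Ly le; rewrite /hform -(subnK le) exprD -mulmxE -!mulmxA Ly.
by rewrite !mulmx0 mxE.
Qed.

(** If [w] and [w'] are both isotropic, [c] is chosen so that each of the two cross terms of $w+cw'$
    equals 1; they add up to $2\neq0$. *)
Lemma hform_polarize n (w w' : 'cV_N) : L ^+ n *m w = 0 -> L ^+ n *m w' = 0 ->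
  hform w' w n.-1 != 0 -> exists2 y, L ^+ n *m y = 0 & hform y y n.-1 != 0.
Proof.
move=> Lw Lw' h0.
case: (eqVneq (hform w w n.-1) 0) => [hw|]; last by exists w.
case: (eqVneq (hform w' w' n.-1) 0) => [hw'|]; last by exists w'.
pose c := (hform w w' n.-1)^-1.
have h0' : hform w w' n.-1 != 0 by rewrite hform_sym fmorph_eq0.
exists (w + c *: w'); first by rewrite mulmxDr -scalemxAr Lw Lw' scaler0 addr0.
rewrite hformDl !hformDr !hformZl !hformZr hw hw' add0r !mulr0 addr0 mulVf //.
by rewrite hform_sym -rmorphM mulVf // rmorph1 -(natrD F 1 1).
Qed.

(** The top value is first scaled to a sign $e$. Then adding $cL^{k+1}y$ with $c$ fixed leaves the
    values at $n-1-k,\dots,n-1$ alone and changes the one at $n-2-k$ by $2ce$, so the lower values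
    are cleared one after the other. *)
Lemma hform_normalize n (w : 'cV_N) : (0 < n)%N -> L ^+ n *m w = 0 ->
  hform w w n.-1 != 0 ->
  exists (e : F) (y : 'cV_N), [/\ e = 1 \/ e = -1, L ^+ n *m y = 0
    & forall s, (s < n)%N -> hform y y s = e * (s == n.-1)%:R].
Proof.
move=> n0 Lw h0.
have [e [z [He Hz]]] := fixed_pm_norm (esym (hform_sym w w n.-1)).
exists e.
suff H k : (k < n)%N -> exists y, L ^+ n *m y = 0 /\
    forall s, (n.-1 - k <= s < n)%N -> hform y y s = e * (s == n.-1)%:R.
  have [|y [Ly Hy]] := H n.-1; first by rewrite prednK.
  by exists y; split=> // s sn; apply: Hy; rewrite subnn.
have z0 : z != 0 by apply: contraNneq h0 => z0; rewrite Hz z0 mul0r mulr0.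
have e0 : e != 0 by case: He => ->; rewrite ?oppr_eq0 oner_eq0.
have be : bar e = e by case: He => ->; rewrite ?rmorphN rmorph1.
have e2 : e *+ 2 != 0 by rewrite -mulr_natr mulf_neq0.
elim: k => [_|k IHk lt].
  exists (z^-1 *: w); split; first by rewrite -scalemxAr Lw scaler0.
  move=> s; rewrite subn0 => le; have -> : s = n.-1 by lia.
  rewrite hformZl hformZr Hz eqxx mulr1 fmorphV.
  have bz0 : bar z != 0 by rewrite fmorph_eq0.
  by field; rewrite z0.
have [y [Ly Hy]] := IHk (ltnW lt).
pose c := - hform y y (n.-1 - k.+1) / (e *+ 2).
have bc : bar c = c by rewrite /c rmorphM rmorphN fmorphV rmorphMn /= be -hform_sym.
exists (y + c *: (L ^+ k.+1 *m y)); split.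
  by rewrite mulmxDr Ly add0r -scalemxAr mulmxA mulmxE -exprD addnC exprD -mulmxE -mulmxA Ly mulmx0 scaler0.
move=> s le.
rewrite hformDl !hformDr !hformZl !hformZr !hform_expl !hform_expr bc.
rewrite (@hform_kernel _ _ n (s + k.+1 + k.+1)) //; last by lia.
rewrite !mulr0 addr0.
case: (eqVneq s (n.-1 - k.+1)%N) => [E|ne].
  have -> : (s + k.+1)%N = n.-1 by lia.
  rewrite (Hy n.-1); last by lia.
  have -> : (s == n.-1) = false by apply/eqP; lia.
  rewrite eqxx mulr1 mulr0 /c -E; field.
  by rewrite two_nz e0.
rewrite (@hform_kernel _ _ n (s + k.+1)) //; last by lia.
by rewrite !mulr0 !addr0 Hy //; lia.
Qed.

(** The entry $(j,k)$ is the value of [hform y y] at $2(n-1)-j-k$: it is $e$ on the antidiagonal and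
    0 elsewhere. *)
Lemma chainmx_gram n (y : 'cV_N) e : (0 < n)%N -> L ^+ n *m y = 0 ->
  (forall s, (s < n)%N -> hform y y s = e * (s == n.-1)%:R) ->
  adj (chainmx L y n) *m G *m chainmx L y n = e *: flip n.
Proof.
move=> n0 Ly Hy; apply/matrixP => j k.
transitivity (hform (L ^+ (n.-1 - j) *m y) (L ^+ (n.-1 - k) *m y) 0).
  rewrite /hform expr0 -idmxE mulmx1 -!chainmx_col mxE [RHS]mxE; apply: eq_bigr => l _.
  rewrite !mxE; congr (_ * _); apply: eq_bigr => a _.
  by rewrite !mxE.
rewrite hform_expl hform_expr mxE [in RHS]mxE !add0n.
have := ltn_ord j; have := ltn_ord k => ltk ltj.
case: (ltnP (n.-1 - j + (n.-1 - k)) n) => [lt|ge].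
  by rewrite Hy //; congr (_ * (nat_of_bool _)%:R); lia.
have -> : (j + k == n.-1)%N = false by lia.
by rewrite (@hform_kernel _ _ n) ?mulr0.
Qed.

End SelfAdjoint.

Lemma adj_jordan n a : adj (jordan_block n a) = (jordan_block n (bar a))^T.
Proof. by apply/matrixP => j k; rewrite !mxE; case: ifP => // _; rewrite rmorph_nat. Qed.

Lemma sign_sqr (e : F) : e = 1 \/ e = -1 -> e * e = 1 /\ bar e = e.
Proof. by case=> ->; rewrite ?mulrNN mulr1 ?rmorphN rmorph1. Qed.

Lemma exists_eigenvector N (L : 'M[F]_N) : (0 < N)%N ->
  exists lam (v : 'cV_N), v != 0 /\ (L - lam%:M) *m v = 0.
Proof.
move=> N0; have /closed_rootP [lam] : size (char_poly L^T) != 1%N.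
  by rewrite size_char_poly eqSS -lt0n.
rewrite -eigenvalue_root_char => /eigenvalueP [v Ev v0].
exists lam, v^T; split; first by rewrite -trmx0 (inj_eq (@trmx_inj _ _ _)).
apply: trmx_inj; rewrite trmx0 trmx_mul trmxK linearB /= tr_scalar_mx mulmxBr Ev.
by rewrite mul_mx_scalar subrr.
Qed.

Section Step.

Variables (N : nat) (G A : 'M[F]_N).
Hypotheses (hG : adj G = G) (hA : adj A = A) (uG : G \in unitmx).
Variable lam : F.
Let L := invmx G *m A - lam%:M.

Lemma mul_resolvent : G *m L = A - lam *: G.
Proof. by rewrite mulmxBr mulKVmx // mul_mx_scalar. Qed.

Lemma resolvent_self_adjoint : bar lam = lam -> adj L *m G = G *m L.
Proof.
move=> bl; rewrite -{1}hG -adjmxM mul_resolvent adjmxB adjmxZ hA hG bl.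
by [].
Qed.

Lemma jordan_of_chain n (E : 'M_(N, n)) : L *m E = E *m shift n ->
  A *m E = G *m E *m jordan_block n lam.
Proof.
move=> LE; have -> : A = G *m L + lam *: G by rewrite mul_resolvent subrK.
rewrite mulmxDl -mulmxA LE (jordan_shift n lam) mulmxDr mul_mx_scalar addrC mulmxA.
by rewrite -scalemxAl.
Qed.

Lemma gram_chain n (y : 'cV_N) e : (0 < n)%N -> L ^+ n *m y = 0 -> bar lam = lam ->
  (forall s, (s < n)%N -> hform G L y y s = e * (s == n.-1)%:R) ->
  let E := chainmx L y n in
  adj E *m G *m E = e *: flip n /\ A *m E = G *m E *m jordan_block n lam.
Proof.
move=> n0 Ly bl Hy; split; last by apply/jordan_of_chain/chainmx_mul.
by apply: chainmx_gram => //; apply: resolvent_self_adjoint.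
Qed.

Lemma split_real_chain n (w w' : 'cV_N) : (0 < n)%N -> L ^+ n *m w = 0 ->
  L ^+ n *m w' = 0 -> bar lam = lam -> hform G L w' w n.-1 != 0 ->
  exists e, (e = 1 \/ e = -1) /\ exists2 T : sqpair F, hermitian_pair bar T
    & starI bar (SqPair G A) (sqpair_add (flip_pair e n lam) T).
Proof.
move=> n0 Lw Lw' bl h0; have hL := resolvent_self_adjoint bl.
have [y0 Ly0 hy0] := hform_polarize hG hL Lw Lw' h0.
have [e [y [He Ly Hy]]] := hform_normalize hG hL n0 Ly0 hy0.
exists e; split=> //; have [ee be] := sign_sqr He.
have [GE AE] := gram_chain n0 Ly bl Hy; set E := chainmx L y n in GE AE.
(* The second component is forced by $GE=g\,(e\,\mathrm{flip})$, as $e$ and [flip n] are their own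
   inverses. *)
apply: (@split_summand _ _ barK _ _ G A E (e *: (G *m E *m flip n))) => //.
- by rewrite -scalemxAl -scalemxAr scalerA ee scale1r -(mulmxA (G *m E)) flip_sqr mulmx1.
- by rewrite -scalemxAl -scalemxAr scalerA ee scale1r !mulmxA -(mulmxA (G *m E)) flip_sqr mulmx1.
- rewrite adjmxZ be -scalemxAl !adjmxM adj_flip hG -!mulmxA (mulmxA (adj E)) GE.
  by rewrite -scalemxAr scalerA ee scale1r flip_sqr.
Qed.

(** Here the chain fills the space, so the chain matrix is itself the *congruence; a partner for [w]
    exists because $G$ is nondegenerate. *)
Lemma cyclic_real n (w : 'cV_N) : N = n -> (0 < n)%N -> L ^+ n = 0 -> bar lam = lam ->
  L ^+ n.-1 *m w != 0 ->
  exists2 e, e = 1 \/ e = -1 & starI bar (SqPair G A) (flip_pair e n lam).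
Proof.
move=> EN n0 Ln bl Lw; have hL := resolvent_self_adjoint bl.
have Lnw (y : 'cV_N) : L ^+ n *m y = 0 by rewrite Ln mul0mx.
have [w' h0] : exists w', hform G L w' w n.-1 != 0.
  have : G *m (L ^+ n.-1 *m w) != 0.
    by apply: contraNneq Lw => E; rewrite -[_ *m w](mulKmx uG) E mulmx0.
  case/matrix0Pn=> j [k nz]; exists (delta_mx j 0).
  rewrite /hform /adjmx trmx_delta map_delta_mx -!mulmxA -rowE mxE.
  by rewrite [k]ord1 in nz.
have [y0 Ly0 hy0] := hform_polarize hG hL (Lnw w) (Lnw w') h0.
have [e [y [He Ly Hy]]] := hform_normalize hG hL n0 Ly0 hy0.
exists e => //; have [ee be] := sign_sqr He.
have [GE AE] := gram_chain n0 Ly bl Hy.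
move: (chainmx L y n) GE AE; rewrite -EN => E GE AE.
exists E, (e *: (flip N *m adj E *m G)); split=> //=.
  have EE : (e *: (flip N *m adj E *m G)) *m E = 1%:M.
    by rewrite -scalemxAl -!mulmxA (mulmxA (adj E)) GE -scalemxAr scalerA ee scale1r flip_sqr.
  by split=> //; apply: mulmx1C.
by rewrite -mulmxA AE !mulmxA GE -scalemxAl.
Qed.

(** The chain is isotropic: its Gram matrix $H$ satisfies $HJ(\lambda)=J(\bar\lambda)^TH$, and
    $\lambda\neq\bar\lambda$ leaves only $H=0$. *)
Lemma split_nonreal_chain n (w : 'cV_N) (q : 'rV_N) : (0 < n)%N ->
  L ^+ n *m w = 0 -> q *m L ^+ n = 0 -> q *m (L ^+ n.-1 *m w) != 0 -> bar lam != lam ->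
  exists2 T : sqpair F, hermitian_pair bar T
    & starI bar (SqPair G A) (sqpair_add (hyp bar (jordan_pair n lam)) T).
Proof.
move=> n0 Lw qL qv bl.
set E := chainmx L w n; set p := cochainmx L q n.
have AE : A *m E = G *m E *m jordan_block n lam by apply/jordan_of_chain/chainmx_mul.
have pL : p *m L = shift n *m p by apply: cochainmx_mul.
have upE : p *m E \in unitmx by apply: cochain_chain_unit.
apply: (@split_hyp _ _ barK two_nz _ G A (jordan_pair n lam) E (G *m E) p (p *m invmx G)) => //.
- by split; rewrite /= ?mulmx1.
- split; rewrite /= ?mul1mx ?mulmxKV //.
  rewrite -mulmxA -[invmx G *m A](subrK lam%:M) -/L mulmxDr pL (jordan_shift n lam) mulmxDl.
  by rewrite scalar_mxC addrC.
- by rewrite mulmxA mulmxKV.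
have AE' : adj E *m A = (jordan_block n (bar lam))^T *m adj (G *m E).
  by rewrite -{1}hA -adjmxM AE adjmxM adj_jordan.
have eqH : adj (G *m E) *m E *m jordan_block n lam = (jordan_block n (bar lam))^T *m (adj (G *m E) *m E).
  rewrite adjmxM hG -!mulmxA (mulmxA G) -AE !mulmxA AE' -mulmxA.
  by rewrite adjmxM hG !mulmxA.
apply: (@nilp_sylvester _ _ _ (shift n)^T (shift n) n n (lam - bar lam)).
- have tr_exp k : (shift n)^T ^+ k = (shift n ^+ k)^T.
    elim: k => [|k IHk]; first by rewrite !expr0 -!idmxE trmx1.
    by rewrite exprS exprSr -!mulmxE trmx_mul IHk.
  by rewrite tr_exp shift_nilp trmx0.
- exact: shift_nilp.
- by rewrite subr_eq0 eq_sym.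
move: eqH; move: (_ *m E) => H.
rewrite (jordan_shift n lam) (jordan_shift n (bar lam)) [(_ + _)^T]linearD /= tr_scalar_mx.
rewrite mulmxDr mulmxDl mul_mx_scalar mul_scalar_mx => eqH.
by rewrite scalerBl -[lam *: H](addrK (H *m shift n)) eqH addrAC [_ + _ - _ *: H]addrAC subrr add0r.
Qed.

End Step.

Lemma regular_step N (G A : 'M[F]_N) : (0 < N)%N -> adj G = G -> adj A = A -> G \in unitmx ->
  exists n lam, (0 < n)%N /\
    exists2 T : sqpair F, hermitian_pair bar T &
      (bar lam != lam /\ starI bar (SqPair G A) (sqpair_add (hyp bar (jordan_pair n lam)) T))
      \/ (bar lam = lam /\ exists2 e, e = 1 \/ e = -1 &
            starI bar (SqPair G A) (sqpair_add (flip_pair e n lam) T)).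
Proof.
move=> N0 hG hA uG.
have [lam [v [v0 Lv]]] := exists_eigenvector (invmx G *m A) N0.
have [n [w [q [n0 Ew Lw qL qv]]]] := maximal_chain v0 Lv.
exists n, lam; split=> //; case: (eqVneq (bar lam) lam) => [bl|bl]; last first.
  have [|T hT sT] := split_nonreal_chain hG hA uG n0 Lw qL _ bl; first by rewrite Ew.
  by exists T => //; left.
(* The vector representing the functional [q] for the form [G]; self-adjointness of $L$ turns
   $qL^n=0$ into $L^nw'=0$. *)
pose w' := invmx G *m adj q.
have hw' : adj w' *m G = q.
  by rewrite -{1}hG -adjmxM /w' mulKVmx // (adjmxK barK).
have Lw' : (invmx G *m A - lam%:M) ^+ n *m w' = 0.
  apply: (can_inj (mulKmx uG)); rewrite mulmx0 -[LHS](adjmxK barK) mulmxA.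
  rewrite -(self_adjoint_exp (resolvent_self_adjoint hG hA uG bl)) -mulmxA adjmxM (adjmxK barK).
  by rewrite [X in adj (X *m _)]adjmxM hG hw' qL adjmx0.
have [|e [He [T hT sT]]] := split_real_chain hG hA uG n0 Lw Lw' bl.
  rewrite /hform hw' -mulmxA Ew; apply: contraNneq qv => E.
  by apply/eqP/matrixP => a b; rewrite !ord1 E mxE.
by exists T => //; right; split=> //; exists e.
Qed.

End RegularPairs.

(** * Singular pairs *)

Section WidePencils.

Variable F : fieldType.
Local Notation Fm k := (Fmx F k).
Local Notation Gm k := (Gmx F k).

Lemma mul_Gmx k n (X : 'M[F]_(k.+1, n)) j l : (Gm k *m X) j l = X (lift ord0 j) l.
Proof.
rewrite mxE (bigD1 (lift ord0 j)) //= big1 ?addr0 => [|a ne]; first by rewrite mxE eqxx mul1r.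
rewrite mxE; case: eqP => [e|_]; last by rewrite mul0r.
by case/eqP: ne; apply: ord_inj; rewrite lift0.
Qed.

Lemma mul_Fmx k n (X : 'M[F]_(k.+1, n)) j l : (Fm k *m X) j l = X (lift ord_max j) l.
Proof.
rewrite mxE (bigD1 (lift ord_max j)) //= big1 ?addr0 => [|a ne].
  by rewrite mxE lift_max eqxx mul1r.
rewrite mxE; case: eqP => [e|_]; last by rewrite mul0r.
by case/eqP: ne; apply: ord_inj; rewrite lift_max.
Qed.

Lemma mul_mx_Gmx k n (X : 'M[F]_(n, k)) i j : (X *m Gm k) i (lift ord0 j) = X i j.
Proof.
rewrite mxE (bigD1 j) //= big1 ?addr0 => [|a ne]; first by rewrite mxE lift0 eqxx mulr1.
by rewrite mxE lift0 eqSS (inj_eq (@ord_inj _)) eq_sym (negPf ne) mulr0.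
Qed.

Lemma mul_mx_Gmx0 k n (X : 'M[F]_(n, k)) i : (X *m Gm k) i ord0 = 0.
Proof. by rewrite mxE big1 // => a _; rewrite mxE mulr0. Qed.

Lemma mul_mx_Fmx k n (X : 'M[F]_(n, k)) i j : (X *m Fm k) i (lift ord_max j) = X i j.
Proof.
rewrite mxE (bigD1 j) //= big1 ?addr0 => [|a ne]; first by rewrite mxE lift_max eqxx mulr1.
by rewrite mxE lift_max (inj_eq (@ord_inj _)) eq_sym (negPf ne) mulr0.
Qed.

Lemma mul_mx_Fmx_max k n (X : 'M[F]_(n, k)) i : (X *m Fm k) i ord_max = 0.
Proof. by rewrite mxE big1 // => a _; rewrite mxE gtn_eqF ?mulr0 //= ltn_ord. Qed.

Lemma eq_mx_ord0 k n (X Y : 'M[F]_(n, k.+1)) :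
  (forall i, X i ord0 = Y i ord0) -> (forall i j, X i (lift ord0 j) = Y i (lift ord0 j)) -> X = Y.
Proof. by move=> H0 HS; apply/matrixP => i j; case: (unliftP ord0 j) => [l ->|->]. Qed.

Lemma eq_mx_ord_max k n (X Y : 'M[F]_(n, k.+1)) :
  (forall i, X i ord_max = Y i ord_max) ->
  (forall i j, X i (lift ord_max j) = Y i (lift ord_max j)) -> X = Y.
Proof. by move=> H0 HS; apply/matrixP => i j; case: (unliftP ord_max j) => [l ->|->]. Qed.

Lemma Gmx_tr k : Gm k *m (Gm k)^T = 1%:M.
Proof.
by apply/matrixP => i j; rewrite mul_Gmx !mxE lift0 eqSS (inj_eq (@ord_inj _)).
Qed.

Lemma Gmx_delta k : Gm k *m delta_mx ord0 (0 : 'I_1) = 0.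
Proof. by apply/matrixP => i j; rewrite mul_Gmx !mxE. Qed.

Lemma Fmx_delta k : Fm k.+1 *m delta_mx ord0 (0 : 'I_1) = delta_mx ord0 0.
Proof.
by apply/matrixP => i j; rewrite mul_Fmx !mxE -[lift _ _ == _](inj_eq (@ord_inj _)) lift_max.
Qed.

Lemma FGmx_tr k : Fm k.+1 *m (Gm k.+1)^T = (Gm k)^T *m Fm k.
Proof.
apply/matrixP => i j; rewrite mul_Fmx [LHS]mxE [LHS]mxE lift_max.
transitivity (((Gm k)^T *m Fm k)^T j i); last by rewrite mxE.
rewrite trmx_mul trmxK.
case: (unliftP ord0 i) => [l ->|->]; last by rewrite mul_mx_Gmx0.
by rewrite mul_mx_Gmx !mxE lift0 eqSS eq_sym.
Qed.

Lemma Gmx_decomp k : delta_mx ord0 (0 : 'I_1) *m delta_mx 0 ord0 + (Gm k)^T *m Gm k = 1%:M.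
Proof.
rewrite mul_delta_mx; apply: eq_mx_ord0 => [i|i j].
  by rewrite mxE mul_mx_Gmx0 !mxE addr0 andbT.
by rewrite mxE mul_mx_Gmx !mxE andbF add0r -[i == lift _ _](inj_eq (@ord_inj _)) lift0.
Qed.

(** The matrix $g$ is $E$ without its last row and column, and also $E$ without its first ones, so
    $E$ is Toeplitz. The first column vanishes below the top and the last column above the bottom;
    for $k<m$ the main diagonal meets the last column above the bottom. *)
Lemma wide_wide_hom m k (E : 'M[F]_(m.+1, k.+1)) (g : 'M_(m, k)) :
  Fm m *m E = g *m Fm k -> Gm m *m E = g *m Gm k ->
  [/\ forall i, i != ord0 -> E i ord0 = 0,
      forall (i : 'I_m.+1) (j : 'I_k.+1), i = j :> nat -> E i j = E ord0 ord0,
      (forall (i : 'I_m) (j : 'I_k), i = j :> nat -> g i j = E ord0 ord0)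
    & (k < m)%N -> E ord0 ord0 = 0].
Proof.
move=> EF EG.
have F1 i j : E (lift ord_max i) (lift ord_max j) = g i j by rewrite -(mul_mx_Fmx g) -EF mul_Fmx.
have F0 i : E (lift ord_max i) ord_max = 0 by rewrite -mul_Fmx EF mul_mx_Fmx_max.
have G1 i j : E (lift ord0 i) (lift ord0 j) = g i j by rewrite -(mul_mx_Gmx g) -EG mul_Gmx.
have G0 i : E (lift ord0 i) ord0 = 0 by rewrite -mul_Gmx EG mul_mx_Gmx0.
have diag : forall (i : 'I_m.+1) (j : 'I_k.+1), i = j :> nat -> E i j = E ord0 ord0.
  suff H n : forall (i : 'I_m.+1) (j : 'I_k.+1), i = n :> nat -> j = n :> nat ->
      E i j = E ord0 ord0 by move=> i j Ej; apply: (H j).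
  elim: n => [|n IHn] i j Ei Ej; first by congr (E _ _); apply: ord_inj.
  case: (unliftP ord0 i) Ei => [i' ->|->] //; rewrite lift0 => -[Ei].
  case: (unliftP ord0 j) Ej => [j' ->|->] //; rewrite lift0 => -[Ej].
  by rewrite G1 -F1; apply: IHn; rewrite lift_max.
split=> //.
- by move=> i; case: (unliftP ord0 i) => [i' ->|->]; rewrite ?eqxx // G0.
- by move=> i j Ej; rewrite -F1; apply: diag; rewrite !lift_max.
- by move=> lt; rewrite -(diag (lift ord_max (Ordinal lt)) ord_max) ?F0 // lift_max.
Qed.

(** Each diagonal below the main one starts in the first column and each one above ends in the last
    column, where the off-diagonal entries are zero. *)
Lemma wide_scalar k (S : 'M[F]_k.+1) (T : 'M_k) :
  Fm k *m S = T *m Fm k -> Gm k *m S = T *m Gm k ->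
  S = (S ord0 ord0)%:M /\ T = (S ord0 ord0)%:M.
Proof.
move=> EF EG.
have [_ diag diagT _] := wide_wide_hom EF EG.
have F1 i j : S (lift ord_max i) (lift ord_max j) = T i j by rewrite -(mul_mx_Fmx T) -EF mul_Fmx.
have F0 i : S (lift ord_max i) ord_max = 0 by rewrite -mul_Fmx EF mul_mx_Fmx_max.
have G1 i j : S (lift ord0 i) (lift ord0 j) = T i j by rewrite -(mul_mx_Gmx T) -EG mul_Gmx.
have G0 i : S (lift ord0 i) ord0 = 0 by rewrite -mul_Gmx EG mul_mx_Gmx0.
have low n : forall i j : 'I_k.+1, j = n :> nat -> (j < i)%N -> S i j = 0.
  elim: n => [|n IHn] i j Ej lt.
    have -> : j = ord0 by apply: val_inj.
    by case: (unliftP ord0 i) lt => [i' ->|->]; rewrite ?G0 // ltn0.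
  case: (unliftP ord0 i) lt => [i' ->|->] //.
  case: (unliftP ord0 j) Ej => [j' ->|->] //; rewrite !lift0 => -[Ej] lt.
  by rewrite G1 -F1; apply: IHn; rewrite !lift_max.
have up n : forall i j : 'I_k.+1, (n + j = k)%N -> (i < j)%N -> S i j = 0.
  elim: n => [|n IHn] i j Ej lt.
    have -> : j = ord_max by apply: val_inj.
    by case: (unliftP ord_max i) lt => [i' ->|->]; rewrite ?F0 // ltnNge -ltnS ltn_ord.
  case: (unliftP ord_max i) lt => [i' ->|->]; last by rewrite ltnNge -ltnS ltn_ord.
  case: (unliftP ord_max j) Ej => [j' ->|->]; rewrite !lift_max; last by rewrite /=; lia.
  by move=> Ej lt; rewrite F1 -G1; apply: IHn; rewrite !lift0 // addnS -addSn.
have ES : S = (S ord0 ord0)%:M.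
  apply/matrixP => i j; rewrite mxE; case: eqP => [->|ne]; first by rewrite mulr1n; apply: diag.
  rewrite mulr0n; case: (ltngtP i j) => [lt|lt|E]; last by case: ne; apply: val_inj.
    by apply: (up (k - j)%N) => //; rewrite subnK // -ltnS ltn_ord.
  exact: (low j).
split=> //; apply/matrixP => i j; rewrite -F1 ES !mxE eqxx mulr1n.
by rewrite (inj_eq lift_inj).
Qed.

(** Column 0 of $E$ is zero, and column $j+1$ is column $j$ moved up by one. *)
Lemma wide_tall_hom0 m k (E : 'M[F]_(m, k.+1)) (g : 'M_(m.+1, k)) :
  (Fm m)^T *m E = g *m Fm k -> (Gm m)^T *m E = g *m Gm k -> E = 0.
Proof.
move=> EF EG.
have trT (X : 'M[F]_(m.+1, k.+1)) i j : X^T j i = X i j by rewrite mxE.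
have tF i j : ((Fm m)^T *m E) (lift ord_max i) j = E i j.
  by rewrite -trT trmx_mul trmxK mul_mx_Fmx mxE.
have tFm j : ((Fm m)^T *m E) ord_max j = 0.
  by rewrite -trT trmx_mul trmxK mul_mx_Fmx_max.
have tG i j : ((Gm m)^T *m E) (lift ord0 i) j = E i j.
  by rewrite -trT trmx_mul trmxK mul_mx_Gmx mxE.
suff H n : forall i (j : 'I_k.+1), j = n :> nat -> E i j = 0.
  by apply/matrixP => i j; rewrite (H j) // mxE.
elim: n => [|n IHn] i j Ej.
  have -> : j = ord0 by apply: val_inj.
  by rewrite -tG EG mul_mx_Gmx0.
case: (unliftP ord0 j) Ej => [j' ->|->] //; rewrite lift0 => -[Ej].
rewrite -tG EG mul_mx_Gmx -mul_mx_Fmx -EF.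
case: (unliftP ord_max (lift ord0 i)) => [i' ->|->]; last by rewrite tFm.
by rewrite tF; apply: IHn; rewrite lift_max.
Qed.

Lemma mxvec_dot m n (A B : 'M[F]_(m, n)) : (mxvec A *m (mxvec B)^T) 0 0 = \tr (A *m B^T).
Proof.
rewrite mxE (reindex _ (curry_mxvec_bij m n)) /= /mxtrace.
transitivity (\sum_i \sum_j A i j * B i j).
  by rewrite pair_bigA; apply: eq_bigr => -[a b] _; rewrite mxE !mxvecE.
by apply: eq_bigr => a _; rewrite mxE; apply: eq_bigr => b _; rewrite mxE.
Qed.

(** The Fredholm alternative for the trace pairing: a functional vanishing on the kernel of [f]
    factors through [f]. *)
Lemma trace_fredholm a b c d (f : {linear 'M[F]_(a, b) -> 'M[F]_(c, d)}) (U : 'M_(b, a)) :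
  (exists2 q, f q = 0 & \tr (q *m U) != 0) \/
  (exists w : 'M_(d, c), forall q, \tr (q *m U) = \tr (f q *m w)).
Proof.
set M := lin_mx f.
case: (boolP (mxvec U^T <= M^T)%MS) => [/submxP [D HD]|].
  right; exists (vec_mx D)^T => q.
  rewrite -{1}[U]trmxK -mxvec_dot HD trmx_mul trmxK mulmxA mul_vec_lin.
  by rewrite -mxvec_dot vec_mxK.
rewrite submxE => /matrix0Pn [x [y nz]]; left.
pose q := vec_mx (col y (cokermx M^T))^T; exists q.
  apply: (can_inj mxvecK); rewrite linear0 -mul_vec_lin vec_mxK -/M.
  by rewrite -[M in _ *m M]trmxK -trmx_mul colE mulmxA mulmx_coker mul0mx trmx0.
apply: contraNneq nz => E; apply/eqP; rewrite -[RHS]E -{2}[U]trmxK -mxvec_dot vec_mxK [x]ord1 !mxE.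
by apply: eq_bigr => k _; rewrite !mxE mulrC.
Qed.

Lemma trace_nondeg m n (X Y : 'M[F]_(m, n)) : (forall q, \tr (q *m X) = \tr (q *m Y)) -> X = Y.
Proof.
move=> H; apply/matrixP => i j; have := H (delta_mx j i).
have tr_delta (Z : 'M[F]_(m, n)) : \tr (delta_mx j i *m Z) = Z i j.
  rewrite /mxtrace (bigD1 j) //= big1 ?addr0 => [|l ne].
    rewrite mxE (bigD1 i) //= big1 ?addr0 => [|a ne]; first by rewrite mxE !eqxx mul1r.
    by rewrite mxE (negPf ne) andbF mul0r.
  by rewrite mxE big1 // => a _; rewrite mxE (negPf ne) mul0r.
by rewrite !tr_delta.
Qed.

(* By duality, either there is a retraction of the morphism [(E, g)], or the
   obstruction to its existence is a kernel polynomial of lower degree. *)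
Lemma wide_retract m n (A B : 'M[F]_(m, n)) k (E : 'M_(n, k.+1)) (g : 'M_(m, k)) :
  A *m E = g *m Fm k -> B *m E = g *m Gm k -> E != 0 ->
  exists k' (E' : 'M_(n, k'.+1)) (g' : 'M_(m, k')) (p : 'M_(k'.+1, n)) (q : 'M_(k', m)) c,
    [/\ A *m E' = g' *m Fm k', B *m E' = g' *m Gm k', Fm k' *m p = q *m A, Gm k' *m p = q *m B
      & c != 0 /\ p *m E' = c%:M /\ q *m g' = c%:M].
Proof.
elim: k E g => [|k IHk] E g EF EG E0.
  have /matrix0Pn [j [l nz]] := E0.
  exists 0%N, E, g, (delta_mx 0 j), 0, (E j l); split=> //; first 2 last.
  - split=> //; split; last by apply/matrixP => -[].
    by apply/matrixP => a b; rewrite [a]ord1 [b]ord1 -rowE !mxE eqxx mulr1n [l]ord1.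
  - by apply/matrixP => -[].
  - by apply/matrixP => -[].
pose d0 k : 'M[F]_(1, k.+1) := delta_mx 0 ord0.
pose d0t k : 'M[F]_(k.+1, 1) := delta_mx ord0 0.
(* The columns of [E] are the coefficients of a kernel polynomial. If the constant one vanishes,
   dividing by the variable lowers the degree. *)
case: (eqVneq (E *m d0t k.+1) 0) => [e0|e0].
  have EE : E = E *m (Gm k.+1)^T *m Gm k.+1.
    by rewrite -{1}[E]mulmx1 -Gmx_decomp mulmxDr !mulmxA e0 mul0mx add0r.
  have gE : B *m (E *m (Gm k.+1)^T) = g by rewrite mulmxA EG -mulmxA Gmx_tr mulmx1.
  have g0 : g *m d0t k = 0 by rewrite /d0t -Fmx_delta mulmxA -EF -mulmxA e0 mulmx0.
  have gg : g = g *m (Gm k)^T *m Gm k.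
    by rewrite -{1}[g]mulmx1 -Gmx_decomp mulmxDr !mulmxA g0 mul0mx add0r.
  apply: (IHk (E *m (Gm k.+1)^T) (g *m (Gm k)^T)).
  - by rewrite mulmxA EF -mulmxA FGmx_tr mulmxA.
  - by rewrite gE -gg.
  - by apply: contraNneq E0 => EG0; rewrite EE EG0 mul0mx.
(* $Fp=qA$ and $Gp=qB$ prescribe the inner rows of [p] twice; they are consistent exactly when
   [f q = 0]. *)
pose f : {linear 'M[F]_(k.+1, m) -> 'M[F]_(k, n)} :=
  (mulmxr A \o mulmx (Gm k)) \- (mulmxr B \o mulmx (Fm k)).
have fE q : f q = Gm k *m q *m A - Fm k *m q *m B by [].
(* The functional attached to this matrix is the corner entry of [p *m E], that is, the scalar by
   which the composite acts. *)
case: (trace_fredholm f (A *m E *m d0t k.+1 *m d0 k)) => [[q fq nz]|[w Hw]].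
  have qAB : Gm k *m q *m A = Fm k *m q *m B by apply/eqP; rewrite -subr_eq0 -fE fq.
  pose p := d0t k.+1 *m (d0 k *m q *m A) + (Gm k.+1)^T *m (q *m B).
  have Gp : Gm k.+1 *m p = q *m B.
    by rewrite mulmxDr !mulmxA Gmx_delta !mul0mx add0r Gmx_tr mul1mx.
  have Fp : Fm k.+1 *m p = q *m A.
    rewrite mulmxDr !mulmxA Fmx_delta FGmx_tr -(mulmxA _ (Fm k)) -(mulmxA _ (Fm k *m q)).
    by rewrite -qAB !mulmxA -!mulmxDl Gmx_decomp mul1mx.
  have [pE qg] : p *m E = ((p *m E) ord0 ord0)%:M /\ q *m g = ((p *m E) ord0 ord0)%:M.
    by apply: wide_scalar; rewrite mulmxA ?Fp ?Gp -mulmxA ?EF ?EG mulmxA.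
  exists k.+1, E, g, p, q, ((p *m E) ord0 ord0); split=> //; split=> //.
  apply: contraNneq nz => c0.
  have pE0 : p *m E = 0 by rewrite pE c0 raddf0.
  have qAE : q *m (A *m E) = 0 by rewrite mulmxA -Fp -mulmxA pE0 mulmx0.
  by rewrite !mulmxA -(mulmxA q) qAE !mul0mx mxtrace0.
have HU : A *m E *m d0t k.+1 *m d0 k = A *m w *m Gm k - B *m w *m Fm k.
  apply: trace_nondeg => q; rewrite Hw fE mulmxBl mulmxBr !linearB /=.
  congr (_ - _).
    by rewrite -!mulmxA mxtrace_mulC !mulmxA.
  by rewrite -!mulmxA mxtrace_mulC !mulmxA.
(* The obstruction [w] continues the constant coefficient of [E] to a kernel polynomial of degree
   one less. *)
apply: (IHk (E *m d0t k.+1 *m d0 k - w *m Gm k) (- (B *m w))).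
- by rewrite mulmxBr !mulmxA HU addrC addKr mulNmx.
- rewrite mulmxBr !mulmxA EG -(mulmxA g) Gmx_delta mulmx0 mul0mx sub0r.
  by rewrite !mulNmx.
- apply: contraNneq e0 => E'0.
  have := congr1 (mulmx^~ (d0t k)) E'0; rewrite mulmxBl mul0mx -[_ *m d0 k *m _]mulmxA.
  rewrite -(mulmxA w) Gmx_delta mulmx0 subr0 mul_delta_mx.
  have -> : delta_mx 0 0 = 1%:M :> 'M[F]_1 by apply/matrixP => a b; rewrite !ord1 !mxE.
  by rewrite mulmx1 => ->.
Qed.

End WidePencils.

(** * Hermitian pairs whose determinant polynomial vanishes *)

Section SingularPairs.

Variables (F : closedFieldType) (bar : {rmorphism F -> F}) (i : F).
Hypothesis barK : involutive bar.
Hypothesis bar_nonid : exists x : F, bar x <> x.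
Hypothesis i_sqr : i ^+ 2 = -1.
Local Notation adj := (adjmx bar).

Lemma poly_nat_roots_eq0 (p : {poly F}) : (forall t : nat, p.[t%:R] = 0) -> p = 0.
Proof.
move=> Hp; apply/eqP; case: (eqVneq p 0) => // p0.
have := @max_poly_roots F p [seq t%:R | t <- iota 0 (size p)] p0.
rewrite size_map size_iota ltnn; apply.
  by apply/allP => x /mapP [t _ ->]; apply/rootP.
by rewrite map_inj_uniq ?iota_uniq //; apply: (natr_inj barK bar_nonid i_sqr).
Qed.

Lemma det_pencil_poly N (A B : 'M[F]_N) (x : F) :
  (\det (map_mx polyC B - 'X *: map_mx polyC A)).[x] = \det (B - x *: A).
Proof.
rewrite -[LHS]/(horner_eval x (\det _)) -det_map_mx; congr (\det _).
apply/matrixP => a b; rewrite !mxE.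
rewrite -[LHS]/((B a b)%:P - 'X * (A a b)%:P).[x].
by rewrite hornerD hornerN hornerM hornerX !hornerC.
Qed.

(** Natural numbers are pairwise distinct in $\mathbb F$, so a nonzero determinant polynomial has a
    non-root among them; they are also fixed by the involution, so that $B-tA$ stays Hermitian. *)
Lemma det_pencil_cases N (A B : 'M[F]_N) :
  (exists t : nat, B - t%:R *: A \in unitmx) \/ (forall t : nat, \det (B - t%:R *: A) = 0).
Proof.
pose p := \det (map_mx polyC B - 'X *: map_mx polyC A).
case: (eqVneq p 0) => [p0|p0]; first by right=> t; rewrite -det_pencil_poly -/p p0 horner0.
case: (boolP (has (fun t => p.[t%:R] != 0) (iota 0 (size p)))) => [/hasP [t _ nz]|].
  by left; exists t; rewrite unitmxE unitfE -det_pencil_poly.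
rewrite -all_predC => /allP H; case/eqP: p0; move: (@max_poly_roots F p [seq t%:R | t <- iota 0 (size p)]).
case: (eqVneq p 0) => // p0 /(_ isT); rewrite size_map size_iota ltnn.
rewrite map_inj_uniq ?iota_uniq; last exact: (natr_inj barK bar_nonid i_sqr).
move=> H'; suff: false by []; apply: H' => //.
by apply/allP => x /mapP [t /H /negPn /eqP Ht ->]; apply/rootP.
Qed.

Lemma singular_chain N (A B : 'M[F]_N) : (forall t : nat, \det (B - t%:R *: A) = 0) ->
  exists k (E : 'M_(N, k.+1)) (g : 'M_(N, k)),
    [/\ A *m E = g *m Fmx F k, B *m E = g *m Gmx F k & E != 0].
Proof.
move=> Hdet.
pose M : 'M[{poly F}]_N := map_mx polyC B - 'X *: map_mx polyC A.
have detM : \det M = 0 by apply: poly_nat_roots_eq0 => t; rewrite det_pencil_poly.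
have /eqP/det0P [v v0 vM] : \det M^T = 0 by rewrite det_tr.
have Mv : map_mx polyC B *m v^T = 'X *: (map_mx polyC A *m v^T).
  apply/eqP; rewrite -subr_eq0 scalemxAl -mulmxBl -/M.
  by rewrite -[M]trmxK -trmx_mul vM trmx0.
(* A strict bound for the degrees: coefficient [k] is zero, and this last column is what makes
   $AE=gF$ hold there. *)
pose k := \max_j size (v 0%R j).
have szk j : (size (v 0%R j) <= k)%N by apply: (leq_bigmax (F := fun j => size (v 0%R j))).
pose e l : 'cV[F]_N := \col_j (v 0 j)`_l.
have coefmul (C : 'M[F]_N) a l : ((map_mx polyC C *m v^T) a 0)`_l = (C *m e l) a 0.
  rewrite !mxE coef_sum; apply: eq_bigr => j _.
  by rewrite !mxE coefCM.
have e0 : B *m e 0%N = 0.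
  by apply/matrixP => a b; rewrite [b]ord1 -coefmul Mv !mxE coefXM.
have eS l : B *m e l.+1 = A *m e l.
  by apply/matrixP => a b; rewrite [b]ord1 -!coefmul Mv mxE coefXM.
have ek : e k = 0 by apply/matrixP => a b; rewrite !mxE nth_default.
exists k, (\matrix_(a, l) e l a 0), (\matrix_(a, l) (A *m e l) a 0).
have colE (C : 'M[F]_N) n a (l : 'I_n) : (C *m \matrix_(a < N, l < n) e l a 0) a l = (C *m e l) a 0.
  by rewrite !mxE; apply: eq_bigr => j _; rewrite !mxE.
split.
- apply: eq_mx_ord_max => [a|a l]; rewrite colE ?mul_mx_Fmx_max ?mul_mx_Fmx; first by rewrite ek mulmx0 mxE.
  by rewrite lift_max [RHS]mxE.
- apply: eq_mx_ord0 => [a|a l]; rewrite colE ?mul_mx_Gmx0 ?mul_mx_Gmx; first by rewrite e0 mxE.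
  by rewrite lift0 eS [RHS]mxE.
- have [j vj] : exists j, v 0 j != 0.
    by have /matrix0Pn [a [j nz]] := v0; exists j; rewrite [a]ord1 in nz.
  have lt : ((size (v 0%R j)).-1 < k.+1)%N.
    by rewrite ltnS (leq_trans (leq_pred _)).
  apply/matrix0Pn; exists j, (Ordinal lt).
  by rewrite !mxE /= -lead_coefE lead_coef_eq0.
Qed.

(** The chain is isotropic: composed with its adjoint it is a morphism from a wide block to a tall
    one, hence zero. *)
Lemma singular_step N (A B : 'M[F]_N) : adj A = A -> adj B = B ->
  (forall t : nat, \det (B - t%:R *: A) = 0) ->
  exists k, exists2 T : sqpair F, hermitian_pair bar T
    & starI bar (SqPair A B) (sqpair_add (hyp bar (kblock_pair (KWide k))) T).
Proof.
move=> hA hB /singular_chain [k0 [E0 [g0 [EA0 EB0 nz0]]]].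
have [k [E [g [p [q [c [EA EB pA pB [c0 [pE qg]]]]]]]]] := wide_retract EA0 EB0 nz0.
exists k; apply: (@split_hyp _ _ barK (two_neq0 barK bar_nonid) N A B (kblock_pair (KWide k)) E g p q) => //.
- by rewrite pE unitmxE det_scalar unitfE expf_neq0.
- by rewrite qg unitmxE det_scalar unitfE expf_neq0.
have adjF : adj (Fmx F k) = (Fmx F k)^T by apply/matrixP => a b; rewrite !mxE rmorph_nat.
have adjG : adj (Gmx F k) = (Gmx F k)^T by apply/matrixP => a b; rewrite !mxE rmorph_nat.
apply: (@wide_tall_hom0 _ _ _ _ (adj E *m g)).
  by rewrite -adjF mulmxA -adjmxM -EA adjmxM hA -mulmxA EA mulmxA.
by rewrite -adjG mulmxA -adjmxM -EB adjmxM hB -mulmxA EB mulmxA.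
Qed.

End SingularPairs.

(** * The canonical summands *)

Section CanonicalBlocks.

Variable F : fieldType.
Local Notation shift n := (jordan_block n (0 : F)).

Lemma upper_bidiag_unit n (x y : F) : x != 0 -> x%:M + y *: shift n \in unitmx.
Proof.
move=> x0; rewrite -unitmx_tr unitmxE det_trig.
  rewrite unitfE; apply/prodf_neq0 => j _; rewrite mxE [X in X != 0]mxE mxE eqxx mulr1n mxE shiftE.
  by rewrite gtn_eqF // mulr0 addr0.
apply/is_trig_mxP => j k lt; rewrite mxE [LHS]mxE mxE [X in _ + X]mxE shiftE.
by rewrite -(inj_eq (@ord_inj _)) !gtn_eqF ?mulr0n ?mulr0 ?addr0 // ltnS ltnW.
Qed.

(** [K] is the shift times an invertible matrix commuting with it, so its powers vanish exactly when
    those of the shift do. *)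
Lemma bidiag_cyclic n (x y z : F) : (0 < n)%N -> x != 0 -> z != 0 ->
  let K := invmx (x%:M + y *: shift n) *m (z *: shift n) in
  K ^+ n = 0 /\ exists w : 'cV_n, K ^+ n.-1 *m w != 0.
Proof.
case: n => // n _ x0 z0.
set N := shift n.+1; set C := _ + _; have uC : C \in unitmx by apply: upper_bidiag_unit.
have CN : C *m N = N *m C.
  by rewrite mulmxDl mulmxDr scalar_mxC -scalemxAl -scalemxAr.
move=> K.
have KE m : C ^+ m *m K ^+ m = z ^+ m *: N ^+ m.
  have comC : GRing.comm (invmx C) (z *: N).
    rewrite /GRing.comm -mulmxE -scalemxAl -scalemxAr; congr (_ *: _).
    by apply: (can_inj (mulKmx uC)); rewrite mulKVmx // mulmxA CN mulmxK.
  rewrite /K mulmxE exprMn_comm // mulrA -exprMn_comm.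
    have -> : C * invmx C = 1 by apply: mulmxV.
    by rewrite expr1n mul1r exprZn.
  by rewrite /GRing.comm -!mulmxE mulmxV ?mulVmx.
have uCn m : C ^+ m \in unitmx.
  elim: m => [|m IHm]; first by rewrite expr0 -idmxE unitmx1.
  by rewrite exprS -mulmxE unitmx_mul uC IHm.
split; first by apply: (can_inj (mulKmx (uCn n.+1))); rewrite KE shift_nilp scaler0 mulmx0.
exists (delta_mx ord_max 0); set w := delta_mx _ _.
apply/eqP => E; have : C ^+ n *m (K ^+ n *m w) = 0 by rewrite [K ^+ n *m w]E mulmx0.
rewrite mulmxA KE -scalemxAl -colE => /matrixP /(_ ord0 0) /eqP.
by rewrite !mxE shift_exp /= add0n eqxx mulr1 expf_eq0 (negPf z0) andbF.
Qed.

Lemma bidiag_shift_equivalent n (x y z : F) : x != 0 -> z != 0 ->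
  equivalentI (MxPair (x%:M + y *: shift n) (z *: shift n)) (MxPair 1%:M (shift n)).
Proof.
move=> x0 z0; case: (posnP n) => [->|n0].
  exists 1%:M, 1%:M, 1%:M, 1%:M; split; [exact: mxiso1 | exact: mxiso1 | |];
    by apply/matrixP => -[].
have uC : x%:M + y *: shift n \in unitmx by apply: upper_bidiag_unit.
have [] := bidiag_cyclic y n0 x0 z0.
move: (x%:M + _) uC => C uC; set K := invmx C *m _ => Kn [w Kw].
have Knw : K ^+ n *m w = 0 by rewrite Kn mul0mx.
set S := chainmx K w n.
have uS : S \in unitmx by apply: col_inj_unit; apply: chainmx_inj.
have KS : K *m S = S *m shift n by apply: chainmx_mul.
exists (invmx S *m invmx C), (C *m S), S, (invmx S); split => /=.
- by apply: mxisoM; apply/mxiso_sym/mxiso_unit.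
- exact: mxiso_unit.
- by rewrite mulmxKV // mulVmx.
- by rewrite -(mulmxA (invmx S)) -/K -mulmxA KS mulKmx.
Qed.

(** Subtracting $z/x$ times the first matrix from the second leaves $(xw-yz)/x$ times the shift. *)
Lemma equivalentI_bidiag n (x y z w : F) : x != 0 -> x * w - y * z != 0 ->
  equivalentI (MxPair (x%:M + y *: shift n) (z%:M + w *: shift n))
    (MxPair 1%:M (jordan_block n (z / x))).
Proof.
move=> x0 det0; have d0 : w - z / x * y != 0.
  apply: contraNneq det0 => E; apply/eqP; rewrite -[RHS](mulr0 x) -E; field.
  exact: x0.
have e1 : (z / x) *: (x%:M + y *: shift n) + (w - z / x * y) *: shift n = z%:M + w *: shift n.
  rewrite scalerDr scale_scalar_mx scalerA divfK // -addrA -scalerDl.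
  by congr (_ + _ *: _); rewrite addrC subrK.
have := equivalentI_lin 1 0 (z / x) 1 (bidiag_shift_equivalent n y x0 d0).
by rewrite /lin_pair /= !scale1r !scale0r !addr0 e1 scalemx1 -jordan_shift.
Qed.

Lemma equivalentI_bidiag_inf n (y z w : F) : y != 0 -> z != 0 ->
  equivalentI (MxPair (y *: shift n) (z%:M + w *: shift n)) (MxPair (shift n) 1%:M).
Proof.
move=> y0 z0; have := equivalentI_lin 0 1 1 0 (bidiag_shift_equivalent n w z0 y0).
by rewrite /lin_pair /= !scale1r !scale0r !addr0 !add0r.
Qed.

Lemma equivalentI_flip n (e : F) (A B : 'M[F]_n) : e != 0 ->
  equivalentI (MxPair (e *: (flip n *m A)) (e *: (flip n *m B))) (MxPair A B).
Proof.
move=> e0; exists (e^-1 *: flip n), (e *: flip n), 1%:M, 1%:M; split => /=.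
- by split; rewrite -scalemxAl -scalemxAr scalerA flip_sqr ?mulVf ?divff ?scale1r.
- exact: mxiso1.
- by rewrite mulmx1 -scalemxAl -scalemxAr scalerA mulVf // scale1r mulmxA flip_sqr mul1mx.
- by rewrite mulmx1 -scalemxAl -scalemxAr scalerA mulVf // scale1r mulmxA flip_sqr mul1mx.
Qed.

Lemma jordan_tr_flip n (a : F) :
  equivalentI (MxPair 1%:M (jordan_block n a)^T) (MxPair 1%:M (jordan_block n a)).
Proof.
exists (flip n), (flip n), (flip n), (flip n).
have iso : mxiso (flip n) (flip n) by split; apply: flip_sqr.
split=> //=; first by rewrite mulmx1 flip_sqr.
by rewrite -mulmxA -flip_jordan_comm mulmxA flip_sqr mul1mx.
Qed.

(** Evaluation at $b$ isolates the term $j=0$; the others are divisible by $X-b$. *)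
Lemma mixed_powers_free (a b : F) k (c : 'I_k.+1 -> F) : a != b ->
  \sum_(j < k.+1) c j *: (('X - a%:P) ^+ (k - j) * ('X - b%:P) ^+ j) = 0 -> forall j, c j = 0.
Proof.
move=> ab; elim: k c => [|k IHk] c.
  rewrite big_ord1 !expr0 mulr1 => /eqP; rewrite scaler_eq0 oner_eq0 orbF => /eqP c0 j.
  by rewrite [j]ord1.
move=> E; have c0 : c ord0 = 0.
  have := congr1 (fun p => p.[b]) E; rewrite horner_sum big_ord_recl big1 => [|j _].
    rewrite hornerZ hornerM !horner_exp !hornerXsubC expr0 mulr1 addr0 horner0 subn0 => /eqP.
    by rewrite mulf_eq0 expf_eq0 /= subr_eq0 [b == a]eq_sym (negPf ab) orbF => /eqP.
  by rewrite hornerZ hornerM !horner_exp !hornerXsubC subrr lift0 expr0n !mulr0.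
have cS : forall j, c (lift ord0 j) = 0.
  apply: IHk; apply: (mulIf (negbT (polyXsubC_eq0 b))).
  rewrite mul0r mulr_suml -[RHS]E [RHS]big_ord_recl c0 scale0r add0r; apply: eq_bigr => j _.
  by rewrite lift0 subSS exprSr -scalerAl mulrA.
by move=> j; case: (unliftP ord0 j) => [l ->|->].
Qed.

(* The kernel of [(b F + m G) - x (F + G)] over [F(x)] is spanned by the vector
   with entries [(-1)^j (x - m)^(k - j) (x - b)^j]. *)
Lemma wide_moebius k (b m : F) : b != m ->
  equivalentI (MxPair (Fmx F k + Gmx F k) (b *: Fmx F k + m *: Gmx F k))
    (MxPair (Fmx F k) (Gmx F k)).
Proof.
move=> bm.
pose v (j : nat) : {poly F} := (-1) ^+ j *: (('X - m%:P) ^+ (k - j) * ('X - b%:P) ^+ j).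
have vrec j : (j < k)%N -> b *: v j + m *: v j.+1 = 'X * (v j + v j.+1).
  move=> jk; rewrite /v; have -> : (k - j)%N = (k - j.+1).+1 by lia.
  rewrite !exprS !mulN1r -!mul_polyC !polyCN; ring.
have szv (j : 'I_k.+1) : (size (v j) <= k.+1)%N.
  rewrite (leq_trans (size_scale_leq _ _)) // (leq_trans (size_polyMleq _ _)) //.
  rewrite !size_exp_XsubC addnS /= addSn subnK // -ltnS; exact: ltn_ord.
pose E : 'M[F]_k.+1 := \matrix_(j, l) (v j)`_l.
have uE : E \in unitmx.
  rewrite -row_free_unit; apply: inj_row_free => u uE.
  have H : \sum_(j < k.+1) (u 0 j * (-1) ^+ j) *: (('X - m%:P) ^+ (k - j) * ('X - b%:P) ^+ j) = 0.
    have -> : \sum_(j < k.+1) (u 0 j * (-1) ^+ j) *: (('X - m%:P) ^+ (k - j) * ('X - b%:P) ^+ j)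
              = \sum_(j < k.+1) u 0 j *: v j :> {poly F}.
      by apply: eq_bigr => j _; rewrite scalerA.
    apply/polyP => l; rewrite coef0 coef_sum; case: (ltnP l k.+1) => [lt|ge].
      have := congr1 (fun M : 'M[F]_(1, k.+1) => M 0 (Ordinal lt)) uE; rewrite !mxE => H0.
      by rewrite -[RHS]H0; apply: eq_bigr => j _; rewrite coefZ mxE.
    by rewrite big1 // => j _; rewrite coefZ nth_default ?mulr0 // (leq_trans (szv j)).
  apply/matrixP => x j; rewrite [x]ord1 mxE.
  have mb : m != b by rewrite eq_sym.
  by have /eqP := mixed_powers_free mb H j; rewrite mulf_eq0 signr_eq0 orbF => /eqP.
pose A := Fmx F k + Gmx F k; pose B := b *: Fmx F k + m *: Gmx F k.
have AE i (l : 'I_k.+1) : (A *m E) i l = (v i + v i.+1)`_l.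
  by rewrite mulmxDl mxE mul_Fmx mul_Gmx coefD !mxE lift_max lift0.
have BE i (l : 'I_k.+1) : (B *m E) i l = ('X * (v i + v i.+1))`_l.
  rewrite -vrec // mulmxDl -!scalemxAl mxE [X in X + _]mxE [X in _ + X]mxE mul_Fmx mul_Gmx.
  by rewrite coefD (coefZ b) (coefZ m) !mxE lift_max lift0.
(* Forced by $AE=gF$, since $FF^T=1$. *)
pose g := A *m E *m (Fmx F k)^T.
have gE i j : g i j = (v i + v i.+1)`_j.
  transitivity (g^T j i); first by rewrite [RHS]mxE.
  rewrite /g trmx_mul trmxK mul_Fmx mxE AE.
  by rewrite lift_max.
(* By [vrec], $X(v_i+v_{i+1})$ has degree at most $k$, so the sum itself has degree less than
   $k$. *)
have vi0 (i : 'I_k) : (v i + v i.+1)`_k = 0.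
  have := congr1 (fun p : {poly F} => p`_k.+1) (vrec i (ltn_ord i)).
  rewrite /= coefXM /= => <-; rewrite coefD (coefZ b) (coefZ m).
  have sz1 := szv (lift ord_max i); have sz2 := szv (lift ord0 i).
  rewrite lift_max in sz1; rewrite lift0 in sz2.
  by rewrite !nth_default ?mulr0 ?addr0.
have EF : A *m E = g *m Fmx F k.
  apply: eq_mx_ord_max => [i|i j]; rewrite AE ?mul_mx_Fmx_max ?mul_mx_Fmx; first exact: vi0.
  by rewrite gE lift_max.
have EG : B *m E = g *m Gmx F k.
  apply: eq_mx_ord0 => [i|i j]; rewrite BE ?mul_mx_Gmx0 ?mul_mx_Gmx ?coefXM //.
have ug : g \in unitmx.
  rewrite -row_free_unit; apply: inj_row_free => u ug.
  have uA : u *m A = 0.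
    by apply: (can_inj (mulmxK uE)); rewrite -mulmxA EF mulmxA ug !mul0mx.
  suff H n : forall j : 'I_k, j = n :> nat -> u 0 j = 0.
    by apply/matrixP => x j; rewrite [x]ord1 mxE (H j).
  elim: n => [|n IHn] j Ej.
    have : (u *m A) 0 (lift ord_max j) = 0 by rewrite uA mxE.
    rewrite mulmxDr mxE mul_mx_Fmx.
    have -> : lift ord_max j = ord0 by apply: ord_inj; rewrite lift_max Ej.
    by rewrite mul_mx_Gmx0 addr0.
  have : (u *m A) 0 (lift ord_max j) = 0 by rewrite uA mxE.
  rewrite mulmxDr mxE mul_mx_Fmx.
  have lt : (n < k)%N by rewrite -ltnS -Ej ltnS ltnW ?ltn_ord.
  have -> : lift ord_max j = lift ord0 (Ordinal lt) by apply: ord_inj; rewrite lift_max lift0 Ej.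
  by rewrite mul_mx_Gmx (IHn (Ordinal lt)) // addr0.
exists (invmx g), g, E, (invmx E); split => /=.
- exact/mxiso_sym/mxiso_unit.
- exact: mxiso_unit.
- by rewrite -mulmxA EF mulKmx.
- by rewrite -mulmxA EG mulKmx.
Qed.

End CanonicalBlocks.

(** * Normal forms of the tridiagonal pairs *)

Section Summands.

Variables (F : closedFieldType) (bar : {rmorphism F -> F}).
Hypothesis barK : involutive bar.
Local Notation adj := (adjmx bar).
Local Notation shift n := (jordan_block n (0 : F)).

Lemma starI_reindex m m' (f : 'I_m' -> 'I_m) (A B : 'M[F]_m) : m' = m -> injective f ->
  starI bar (SqPair A B) (SqPair (mxsub f f A) (mxsub f f B)).
Proof.
move=> Em f_inj.
exists (\matrix_(j, k) (j == f k)%:R), (\matrix_(j, k) (k == f j)%:R).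
have -> : adj (\matrix_(j, k) (j == f k)%:R) = \matrix_(j, k) (k == f j)%:R.
  by apply/matrixP => j k; rewrite !mxE rmorph_nat.
by split; rewrite /= ?mxsubE_mul //; apply: mxiso_reindex.
Qed.

(** Reversing the order of the basis exchanges superdiagonal and subdiagonal. *)
Lemma typeI_conj n (mu : F) :
  starI bar (summand_pair bar (TypeI n mu)) (summand_pair bar (TypeI n (bar mu))).
Proof.
have := @starI_reindex n n (@rev_ord n) (tridiag n 0 (fun=> 1) (fun=> 1))
  (tridiag n 0 (fun=> mu) (fun=> bar mu)) erefl (@rev_ord_inj n).
congr (starI _ _ (SqPair _ _)); apply/matrixP => j k; rewrite !mxE /= ?barK;
  have := ltn_ord j; have := ltn_ord k => ltk ltj;
  by do ![case: eqP => ? //=]; lia.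
Qed.

(* Lists the indices in the order in which they occur on the path formed by the
   nonzero entries, so that reindexing turns a summand of type (ii) into a pair
   of Hankel matrices. *)
Definition fold_nat n j : nat := if (n <= j.*2)%N then (j.*2 - n)%N else (n.-1 - j.*2)%N.

Lemma fold_lt n (j : 'I_n) : (fold_nat n j < n)%N.
Proof. by rewrite /fold_nat; have := ltn_ord j; case: ifP; lia. Qed.

Definition fold_ord n (j : 'I_n) : 'I_n := Ordinal (fold_lt j).

Lemma fold_ord_inj n : injective (@fold_ord n).
Proof.
move=> j k /(congr1 val) /=; rewrite /fold_nat; have := ltn_ord j; have := ltn_ord k.
by move=> ? ?; case: ifP; case: ifP => ? ? E; apply: val_inj => /=; lia.
Qed.

Lemma fold_nat_odd n j : (j < n)%N -> odd (fold_nat n j) = (n <= j.*2)%N (+) ~~ odd n.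
Proof.
move=> lt; rewrite /fold_nat; case: leqP => le /=; first by rewrite oddB // odd_double /= negbK.
have -> : (n.-1 - j.*2)%N = (n - j.*2.+1)%N by lia.
by rewrite oddB /= ?odd_double ?addbT //; lia.
Qed.

(** Two indices are neighbours on the path, or both at its loop, exactly when $j+k$ is $n-1$ or $n$.
    The entries alternate along the path between these two antidiagonals, and the parity of $n$
    decides which of them contains the loop. *)
Lemma fold_tridiag n (d x : F) :
  mxsub (@fold_ord n) (@fold_ord n) (tridiag n d (alternate x d) (alternate x d))
  = (if odd n then d else x) *: flip n + (if odd n then x else d) *: (flip n *m shift n).
Proof.
apply/matrixP => j k; rewrite [RHS]mxE [X in _ = X + _]mxE [X in _ = _ + X]mxE flip_shiftE !mxE /alternate /=.
have := ltn_ord j; have := ltn_ord k => ltk ltj.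
rewrite !fold_nat_odd // /fold_nat; have := odd_double_half n.
case: (odd n) => /= En; case: (leqP n k.*2) => lek; case: (leqP n j.*2) => lej; do ![case: eqP => ? /=];
  first [by exfalso; lia | by rewrite ?mulr1 ?mulr0 ?addr0 ?add0r].
Qed.

Lemma typeII_hankel n (a b : F) :
  starI bar (summand_pair bar (TypeII n a b))
    (SqPair ((if odd n then a else b) *: flip n + (if odd n then b else a) *: (flip n *m shift n))
            ((if odd n then b else - a) *: flip n + (if odd n then - a else b) *: (flip n *m shift n))).
Proof. by rewrite -!fold_tridiag; apply: starI_reindex => //; apply: fold_ord_inj. Qed.

Definition kblock_typeII n (a b : F) : kblock F :=
  if odd n && (a != 0) then KJordan n (b / a)
  else if ~~ odd n && (b != 0) then KJordan n (- a / b) else KInfinite n.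

(** Without the factor [flip n], the Hankel pair is a bidiagonal pencil whose coefficients have
    determinant $\pm(a^2+b^2)=\pm1$. *)
Lemma typeII_kronecker n (a b : F) : a ^+ 2 + b ^+ 2 = 1 ->
  equivalentI (summand_pair bar (TypeII n a b)) (kblock_pair (kblock_typeII n a b)).
Proof.
move=> ab; apply: equivalentI_trans (starI_equivalentI (typeII_hankel n a b)) _.
have E x y : x *: flip n + y *: (flip n *m shift n) = 1 *: (flip n *m (x%:M + y *: shift n)).
  by rewrite scale1r mulmxDr mul_mx_scalar -scalemxAr.
rewrite /mxpair_of_sqpair /= !E.
apply: equivalentI_trans (equivalentI_flip _ _ (oner_neq0 F)) _.
rewrite /kblock_typeII; case: (odd n) => /=; rewrite ?andbT ?andbF.
  case: eqP => [a0|/eqP a0] /=.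
    have b0 : b != 0.
      by apply: contraTneq (oner_neq0 F) => b0; rewrite -ab a0 b0 expr0n addr0 eqxx.
    by rewrite a0 oppr0 raddf0 add0r; apply: equivalentI_bidiag_inf.
  apply: equivalentI_bidiag => //.
  have -> : a * - a - b * b = - (a ^+ 2 + b ^+ 2) by ring.
  by rewrite ab oppr_eq0 oner_neq0.
case: eqP => [b0|/eqP b0] /=.
  have a0 : a != 0.
    by apply: contraTneq (oner_neq0 F) => a0; rewrite -ab a0 b0 expr0n addr0 eqxx.
  rewrite b0 raddf0 add0r; apply: equivalentI_bidiag_inf => //.
  by rewrite oppr_eq0.
apply: equivalentI_bidiag => //.
have -> : b * b - a * - a = a ^+ 2 + b ^+ 2 by ring.
by rewrite ab oner_neq0.
Qed.

(** A tridiagonal matrix with zero diagonal joins only positions of opposite parity; listing the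
    even positions before the odd ones makes it block antidiagonal. *)
Lemma interleave_lt c r (x : 'I_(c + r)) : (r <= c <= r.+1)%N ->
  (match split x with inl j => j.*2 | inr j => j.*2.+1 end < c + r)%N.
Proof. by move=> le; case: splitP => j _; have := ltn_ord j; lia. Qed.

Definition interleave c r (le : (r <= c <= r.+1)%N) (x : 'I_(c + r)) : 'I_(c + r) :=
  Ordinal (interleave_lt x le).

Lemma interleave_l c r (le : (r <= c <= r.+1)%N) (j : 'I_c) :
  interleave le (lshift r j) = j.*2 :> nat.
Proof. by rewrite /= (unsplitK (inl j)). Qed.

Lemma interleave_r c r (le : (r <= c <= r.+1)%N) (j : 'I_r) :
  interleave le (rshift c j) = j.*2.+1 :> nat.
Proof. by rewrite /= (unsplitK (inr j)). Qed.

Lemma interleave_inj c r (le : (r <= c <= r.+1)%N) : injective (interleave le).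
Proof.
move=> x y /(congr1 (@nat_of_ord _)).
case: (split_ordP x) => j ->; case: (split_ordP y) => k ->;
  rewrite !(interleave_l, interleave_r) => E; try lia; congr (_ _ _); apply: ord_inj; lia.
Qed.

Lemma interleave_tridiag_even r (le : (r <= r <= r.+1)%N) (u l : F) :
  mxsub (interleave le) (interleave le) (tridiag (r + r) 0 (fun=> u) (fun=> l))
  = block_mx 0 (u%:M + l *: (shift r)^T) (l%:M + u *: shift r) 0.
Proof.
apply/matrixP => x y; case: (split_ordP x) => j ->; case: (split_ordP y) => k ->;
  rewrite ?block_mxEul ?block_mxEur ?block_mxEdl ?block_mxEdr mxE mxE !(interleave_l, interleave_r) !mxE.
- by do ![case: eqP => ? //=]; lia.
- rewrite -!(inj_eq (@ord_inj _)); do ![case: eqP => ? //=]; rewrite ?mulr0 ?mulr1 ?addr0 ?add0r //; lia.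
- rewrite -!(inj_eq (@ord_inj _)); do ![case: eqP => ? //=]; rewrite ?mulr0 ?mulr1 ?addr0 ?add0r //; lia.
- by do ![case: eqP => ? //=]; lia.
Qed.

Lemma interleave_tridiag_odd r (le : (r <= r.+1 <= r.+1)%N) (u l : F) :
  mxsub (interleave le) (interleave le) (tridiag (r.+1 + r) 0 (fun=> u) (fun=> l))
  = block_mx 0 (u *: (Fmx F r)^T + l *: (Gmx F r)^T) (l *: Fmx F r + u *: Gmx F r) 0.
Proof.
apply/matrixP => x y; case: (split_ordP x) => j ->; case: (split_ordP y) => k ->;
  rewrite ?block_mxEul ?block_mxEur ?block_mxEdl ?block_mxEdr mxE mxE !(interleave_l, interleave_r) !mxE.
- by do ![case: eqP => ? //=]; lia.
- do ![case: eqP => ? //=]; rewrite ?mulr0 ?mulr1 ?addr0 ?add0r //; lia.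
- do ![case: eqP => ? //=]; rewrite ?mulr0 ?mulr1 ?addr0 ?add0r //; lia.
- by do ![case: eqP => ? //=]; lia.
Qed.

Lemma typeI_hyp_even r (mu : F) :
  starI bar (summand_pair bar (TypeI (r + r) mu))
    (hyp bar (MxPair (1%:M + 1 *: shift r) ((bar mu)%:M + mu *: shift r))).
Proof.
have le : (r <= r <= r.+1)%N by rewrite leqnn leqnSn.
have := @starI_reindex _ _ (interleave le) (tridiag (r + r) 0 (fun=> 1) (fun=> 1))
  (tridiag (r + r) 0 (fun=> mu) (fun=> bar mu)) erefl (@interleave_inj _ _ le).
rewrite !interleave_tridiag_even /hyp /=.
have -> : 1%:M + 1 *: (shift r)^T = adj (1%:M + 1 *: shift r).
  by rewrite adjmxD adjmxZ adjmx1 rmorph1 adj_jordan rmorph0.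
have -> : mu%:M + bar mu *: (shift r)^T = adj ((bar mu)%:M + mu *: shift r).
  by rewrite adjmxD adjmxZ adj_jordan rmorph0 /adjmx tr_scalar_mx map_scalar_mx barK.
by [].
Qed.

Lemma typeI_hyp_odd r (mu : F) :
  starI bar (summand_pair bar (TypeI (r.+1 + r) mu))
    (hyp bar (MxPair (Fmx F r + Gmx F r) (bar mu *: Fmx F r + mu *: Gmx F r))).
Proof.
have le : (r <= r.+1 <= r.+1)%N by rewrite leqnn leqnSn.
have := @starI_reindex _ _ (interleave le) (tridiag (r.+1 + r) 0 (fun=> 1) (fun=> 1))
  (tridiag (r.+1 + r) 0 (fun=> mu) (fun=> bar mu)) erefl (@interleave_inj _ _ le).
rewrite !interleave_tridiag_odd /hyp /= !scale1r.
have adjF : adj (Fmx F r) = (Fmx F r)^T by apply/matrixP => a b; rewrite !mxE rmorph_nat.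
have adjG : adj (Gmx F r) = (Gmx F r)^T by apply/matrixP => a b; rewrite !mxE rmorph_nat.
by rewrite !adjmxD !adjmxZ adjF adjG barK.
Qed.

(** As $\bar\mu\neq\mu$, the lower left block is an invertible Möbius transform of the wide block,
    which has no eigenvalue to be moved. *)
Lemma typeI_odd_star r (mu : F) : bar mu != mu ->
  starI bar (summand_pair bar (TypeI r.*2.+1 mu)) (hyp bar (kblock_pair (KWide r))).
Proof.
move=> bmu; rewrite -addnn -addSn; apply: starI_trans (typeI_hyp_odd r mu) _.
by apply: starI_hyp => //; apply: wide_moebius.
Qed.

(** The coefficients of the lower left block have determinant $\mu-\bar\mu\neq0$, and the ratio of
    its constant terms is $\bar\mu$, whence the conjugate eigenvalue. *)
Lemma typeI_even_star r (mu : F) : bar mu != mu ->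
  starI bar (summand_pair bar (TypeI r.*2 mu)) (hyp bar (jordan_pair r (bar mu))).
Proof.
move=> bmu; rewrite -addnn; apply: starI_trans (typeI_hyp_even r mu) _.
apply: starI_hyp => //; rewrite -[X in jordan_pair _ X]divr1.
by apply: equivalentI_bidiag; rewrite ?oner_neq0 // !mul1r subr_eq0 eq_sym.
Qed.

Lemma adj_wide r : adj_pair bar (kblock_pair (KWide r)) = kblock_pair (KTall r) :> mxpair F.
Proof. by congr MxPair; apply/matrixP => a b; rewrite !mxE rmorph_nat. Qed.

Lemma typeI_odd_kronecker r (mu : F) : bar mu != mu ->
  equivalentI (summand_pair bar (TypeI r.*2.+1 mu))
    (mxpair_add (kblock_pair (KWide r)) (kblock_pair (KTall r))).
Proof.
move=> bmu; apply: equivalentI_trans (starI_equivalentI (typeI_odd_star r bmu)) _.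
by rewrite -adj_wide; apply: hyp_equivalent_rl.
Qed.

Lemma typeI_even_kronecker r (mu : F) : bar mu != mu ->
  equivalentI (summand_pair bar (TypeI r.*2 mu))
    (mxpair_add (kblock_pair (KJordan r mu)) (kblock_pair (KJordan r (bar mu)))).
Proof.
move=> bmu; apply: equivalentI_trans (starI_equivalentI (typeI_even_star r bmu)) _.
apply: equivalentI_trans (hyp_equivalent_lr bar _) _.
apply: equivalentI_add; last exact: equivalentI_refl.
rewrite /adj_pair /= adjmx1 adj_jordan barK.
exact: jordan_tr_flip.
Qed.

End Summands.

(** * Existence of the decomposition *)

Section Existence.

Variables (F : closedFieldType) (bar : {rmorphism F -> F}) (i : F).
Hypothesis barK : involutive bar.
Hypothesis bar_nonid : exists x : F, bar x <> x.
Hypothesis i_sqr : i ^+ 2 = -1.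
Local Notation adj := (adjmx bar).
Local Notation shift n := (jordan_block n (0 : F)).

Definition lin_sq (x y z w : F) (P : sqpair F) : sqpair F :=
  SqPair (x *: sqfst P + y *: sqsnd P) (z *: sqfst P + w *: sqsnd P).

Lemma starI_lin x y z w P Q : starI bar P Q -> starI bar (lin_sq x y z w P) (lin_sq x y z w Q).
Proof.
move=> [S [S' [iS EA EB]]]; exists S, S'.
by split=> //=; rewrite mulmxDr -!scalemxAr mulmxDl -!scalemxAl EA EB.
Qed.

Lemma lin_sq_add x y z w P Q :
  lin_sq x y z w (sqpair_add P Q) = sqpair_add (lin_sq x y z w P) (lin_sq x y z w Q).
Proof. by rewrite /lin_sq /sqpair_add /= !scale_block_mx !add_block_mx !scaler0 !addr0. Qed.

Lemma lin_sq_hyp x y z w M : bar x = x -> bar y = y -> bar z = z -> bar w = w ->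
  lin_sq x y z w (hyp bar M) = hyp bar (lin_pair x y z w M).
Proof.
move=> bx by_ bz bw; rewrite /lin_sq /hyp /= !scale_block_mx !add_block_mx !scaler0 !addr0.
by rewrite !adjmxD !adjmxZ bx by_ bz bw.
Qed.

Lemma lin_sq_hermitian x y z w P : bar x = x -> bar y = y -> bar z = z -> bar w = w ->
  hermitian_pair bar P -> hermitian_pair bar (lin_sq x y z w P).
Proof.
by move=> bx by_ bz bw [hA hB]; split; rewrite /= adjmxD !adjmxZ ?bx ?by_ ?bz ?bw hA hB.
Qed.

Lemma starI_hermitian P Q : starI bar P Q -> hermitian_pair bar P -> hermitian_pair bar Q.
Proof.
move=> [S [S' [_ EA EB]]] [hA hB].
by split; rewrite -?EA -?EB !adjmxM (adjmxK barK) ?hA ?hB mulmxA.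
Qed.

Lemma summand_hermitian c : summand_ok bar i c -> hermitian_pair bar (summand_pair bar c).
Proof.
case: c => [n mu _|n a b /and4P [_ /eqP ba /eqP bb _]]; split; apply/matrixP => j k; rewrite !mxE.
- by do ![case: eqP => ? //=]; rewrite ?rmorph0 ?rmorph1 //; lia.
- by do ![case: eqP => ? //=]; rewrite ?rmorph0 ?barK //; lia.
- rewrite /alternate; do ![case: eqP => ? //=]; rewrite ?rmorph0 ?ba //;
    do ![case: ifP => ? //]; rewrite ?ba ?bb //; lia.
- rewrite /alternate; do ![case: eqP => ? //=]; rewrite ?rmorph0 ?bb //;
    do ![case: ifP => ? //]; rewrite ?rmorphN /= ?ba ?bb //; lia.
Qed.

(** [lin_sq (- t) 1 1 0] turns $(A,B)$ into $(B-tA,A)$. Eigenvalue $\lambda$ for the latter means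
    that the diagonal coefficients of $A$ and $B$ are in the ratio $\lambda:1+\lambda t$, which
    determines a point of the circle up to sign. *)
Lemma typeII_flip n (lam t e : F) : (0 < n)%N -> bar lam = lam -> bar t = t -> e = 1 \/ e = -1 ->
  exists a b, summand_ok bar i (TypeII n a b) /\
    starI bar (lin_sq (- t) 1 1 0 (summand_pair bar (TypeII n a b))) (flip_pair e n lam).
Proof.
move=> n0 bl bt He.
have bmu : bar (1 + lam * t) = 1 + lam * t by rewrite rmorphD rmorph1 rmorphM /= bl bt.
have [r br Hr] := fixed_sqrt_sum barK bar_nonid i_sqr bl bmu.
have r0 : r != 0.
  apply/eqP => r0; rewrite r0 expr0n /= in Hr.
  have l0 := fixed_sqr_sum_eq0 barK bar_nonid i_sqr bl bmu Hr.
  by move: Hr; rewrite l0 mul0r addr0 expr0n /= add0r expr1n => /eqP; rewrite oner_eq0.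
(* The ratio $\lambda:1+\lambda t$ normalized to the circle; $r\neq0$ because a sum of two fixed
   squares vanishes only trivially. *)
pose al := lam / r; pose be := (1 + lam * t) / r.
have bal : bar al = al by rewrite rmorphM /= fmorphV bl br.
have bbe : bar be = be by rewrite rmorphM /= fmorphV bmu br.
have ab1 : al ^+ 2 + be ^+ 2 = 1 by rewrite !expr_div_n -mulrDl Hr divff // expf_neq0.
pose a := if odd n then al else - be; pose b := if odd n then be else al.
have ok : summand_ok bar i (TypeII n a b).
  rewrite /= n0 /a /b; case: (odd n); rewrite ?rmorphN ?bal ?bbe ?sqrrN ?eqxx /=; first by rewrite ab1.
  by rewrite addrC ab1.
have [e' He' H] : exists2 e', e' = 1 \/ e' = -1 &
    starI bar (lin_sq (- t) 1 1 0 (summand_pair bar (TypeII n a b))) (flip_pair e' n lam).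
  have H0 := starI_lin (- t) 1 1 0 (typeII_hankel bar n a b).
  have herm : hermitian_pair bar (lin_sq (- t) 1 1 0 (summand_pair bar (TypeII n a b))).
    by apply: lin_sq_hermitian; rewrite ?rmorphN ?rmorph1 ?rmorph0 ?bt //; apply: summand_hermitian.
  suff [e' He' H1] : exists2 e', e' = 1 \/ e' = -1 & starI bar (lin_sq (- t) 1 1 0
      (SqPair ((if odd n then a else b) *: flip n + (if odd n then b else a) *: (flip n *m shift n))
            ((if odd n then b else - a) *: flip n + (if odd n then - a else b) *: (flip n *m shift n))))
      (flip_pair e' n lam).
    by exists e' => //; apply: starI_trans H1.
  have [] := starI_hermitian H0 herm.
  pose tau : F := if odd n then 1 else -1.
  have -> : (if odd n then a else b) = al by rewrite /a /b; case: (odd n).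
  have -> : (if odd n then b else a) = tau * be by rewrite /a /b /tau; case: (odd n); rewrite ?mul1r ?mulN1r.
  have -> : (if odd n then b else - a) = be by rewrite /a /b; case: (odd n); rewrite ?opprK.
  have -> : (if odd n then - a else b) = - (tau * al).
    by rewrite /a /b /tau; case: (odd n); rewrite ?mul1r ?mulN1r ?opprK.
  have tau0 : tau != 0 by rewrite /tau; case: (odd n); rewrite ?oppr_eq0 oner_neq0.
  rewrite /lin_sq /=; set A := 1 *: _ + 0 *: _; set G := - t *: _ + _ => hG hA.
  set C := r^-1%:M + (- (tau * (al + t * be))) *: shift n.
  have GC : G = flip n *m C.
    rewrite /G /C mulmxDr mul_mx_scalar -scalemxAr !scalerDr !scalerA addrACA -!scalerDl.
    congr (_ *: _ + _ *: _); last by ring.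
    by rewrite /al /be; field.
  have uC : C \in unitmx by apply: upper_bidiag_unit; rewrite invr_eq0.
  have [uflip _] := mulmx1_unit (@flip_sqr F n).
  have uG : G \in unitmx by rewrite GC unitmx_mul uflip uC.
  (* $\lambda$ is chosen to cancel the diagonal part, so an invertible multiple of the shift remains
     and the pair is cyclic. *)
  have LE0 : invmx G *m A - lam%:M = invmx C *m ((r * tau) *: shift n).
    apply: (can_inj (mulKmx uG)); rewrite mul_resolvent // {2}GC mulmxA mulmxK //.
    rewrite -scalemxAr /A /G; move: (flip n *m shift n) (flip n) => V U.
    have e1 : al + lam * t * al - lam * be = 0 by rewrite /al /be; field.
    have e2 : tau * be + lam * t * tau * be + lam * tau * al = r * tau.
      have -> : r * tau = r ^+ 2 * tau / r by field.
      by rewrite -Hr /al /be; field.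
    apply/matrixP => j k; rewrite !mxE -e2; apply/eqP; rewrite -subr_eq0; apply/eqP.
    transitivity ((al + lam * t * al - lam * be) * U j k); last by rewrite e1 mul0r.
    by ring.
  have [Kn [w Kw]] := bidiag_cyclic (- (tau * (al + t * be))) n0 (invr_neq0 r0) (mulf_neq0 r0 tau0).
  have [| |e' He' H1] := @cyclic_real F bar barK bar_nonid n G A hG hA uG lam n w erefl n0 _ bl.
  - by rewrite LE0.
  - by rewrite LE0.
  by exists e'.
(* The sign [e'] produced by the normalization is unknown; if it is wrong, the antipodal point
   corrects it. *)
case: (eqVneq e' e) => [E|ne]; first by exists a, b; split=> //; rewrite -E.
have E : e = - e'.
  by case: He He' ne => -> [] ->; rewrite ?opprK ?eqxx.
exists (- a), (- b); split.
  by move: ok; rewrite /= !rmorphN !sqrrN !eqr_opp.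
have := starI_lin (-1) 0 0 (-1) H.
rewrite (@summand_pair_opp F bar (TypeII n a b) (TypeII n (- a) (- b))) //.
rewrite /lin_sq /flip_pair /= !scale0r !addr0 ?add0r !scaleN1r E !scaleNr !scalerN.
by rewrite !opprD !opprK.
Qed.

Lemma regular_summand N (A B : 'M[F]_N) (t : nat) : (0 < N)%N -> adj A = A -> adj B = B ->
  B - t%:R *: A \in unitmx ->
  exists c (T : sqpair F), [/\ summand_ok bar i c, hermitian_pair bar T
    & starI bar (SqPair A B) (sqpair_add (summand_pair bar c) T)].
Proof.
move=> N0 hA hB; set G := B - _ => uG.
have bt : bar t%:R = t%:R by apply: rmorph_nat.
have hG : adj G = G by rewrite adjmxB adjmxZ bt hA hB.
have AB : SqPair A B = lin_sq 0 1 1 t%:R (SqPair G A).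
  by rewrite /lin_sq /= scale0r add0r !scale1r subrK.
have [n [lam [n0 [T hT [[bl sT]|[bl [e He sT]]]]]]] := regular_step barK bar_nonid N0 hG hA uG.
  have lam0 : lam != 0 by apply: contraNneq bl => ->; rewrite rmorph0.
  (* The eigenvalue $\lambda$ of $(G,A)$ becomes $1/\lambda+t$ for $(A,G+tA)$, and it stays outside
     P. *)
  pose nu := (1 + t%:R * lam) / lam.
  have bnu : bar nu != nu.
    rewrite /nu rmorphM rmorphD rmorph1 rmorphM /= fmorphV bt.
    apply: contraNneq bl => E; have bl0 : bar lam != 0 by rewrite fmorph_eq0.
    apply/eqP; apply: (invr_inj); apply: (addrI t%:R).
    by move: E; rewrite !mulrDl !mul1r !mulfK // addrC => ->; rewrite addrC.
  (* The conjugate, because the summand with parameter $\mu$ is hyperbolic over the Jordan block of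
     $\bar\mu$. *)
  exists (TypeI n.*2 (bar nu)), (lin_sq 0 1 1 t%:R T); split.
  - by rewrite /= odd_double double_gt0 n0 (inj_eq (fmorph_inj bar)).
  - by apply: lin_sq_hermitian; rewrite ?rmorph0 ?rmorph1.
  rewrite AB; apply: starI_trans (starI_lin 0 1 1 t%:R sT) _.
  rewrite lin_sq_add; apply: starI_add; last exact: starI_refl.
  apply: starI_sym; apply: starI_trans (typeI_even_star barK _ _) _.
    by rewrite (inj_eq (fmorph_inj bar)).
  rewrite barK lin_sq_hyp ?rmorph0 ?rmorph1 //; apply: starI_sym; apply: starI_hyp => //.
  have := @equivalentI_bidiag F n lam 1 (1 + t%:R * lam) t%:R lam0.
  have -> : lam * t%:R - 1 * (1 + t%:R * lam) = -1 by ring.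
  rewrite oppr_eq0 oner_neq0 => /(_ isT).
  rewrite /lin_pair /= (jordan_shift n lam) !scale1r scale0r add0r scalerDr.
  by rewrite scale_scalar_mx addrA -raddfD.
have [a [b [ok H]]] := typeII_flip n0 bl bt He.
exists (TypeII n a b), (lin_sq 0 1 1 t%:R T); split=> //.
  by apply: lin_sq_hermitian; rewrite ?rmorph0 ?rmorph1.
rewrite AB; apply: starI_trans (starI_lin 0 1 1 t%:R sT) _.
rewrite lin_sq_add; apply: starI_add; last exact: starI_refl.
apply: starI_sym; have := starI_lin 0 1 1 t%:R H.
congr (starI _ _ _); rewrite /lin_sq; set X := sqfst _; set Y := sqsnd _ => /=.
rewrite !scale0r !scale1r !add0r !addr0.
by congr (SqPair _ _); rewrite addrAC -scalerDl addNr scale0r add0r.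
Qed.

Lemma exists_summand N (A B : 'M[F]_N) : (0 < N)%N -> adj A = A -> adj B = B ->
  exists c (T : sqpair F), [/\ summand_ok bar i c, hermitian_pair bar T
    & starI bar (SqPair A B) (sqpair_add (summand_pair bar c) T)].
Proof.
move=> N0 hA hB; case: (det_pencil_cases barK bar_nonid i_sqr A B) => [[t ut]|sing].
  exact: (regular_summand N0 hA hB ut).
have [k [T hT sT]] := singular_step barK bar_nonid i_sqr hA hB sing.
have bi : bar i != i.
  by apply/eqP; apply: (i_not_fixed barK bar_nonid i_sqr).
exists (TypeI k.*2.+1 i), T; split=> //.
  by rewrite /= odd_double /= eqxx.
apply: starI_trans sT _; apply: starI_add; last exact: starI_refl.
by apply: starI_sym; apply: typeI_odd_star.
Qed.

Lemma summand_dim_gt0 c : summand_ok bar i c -> (0 < sqdim (summand_pair bar c))%N.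
Proof. by case: c => [n mu /andP []|n a b /and4P []]. Qed.

Lemma exists_summand_sum N (A B : 'M[F]_N) : adj A = A -> adj B = B ->
  exists2 s, all (summand_ok bar i) s & starI bar (SqPair A B) (summand_sum bar s).
Proof.
elim/ltn_ind: N A B => N IHN A B hA hB.
case: (posnP N) => [N0|N0].
  move: A B {hA hB}; rewrite {}N0 => A B.
  by exists [::] => //; rewrite [A]flatmx0 [B]flatmx0; apply: starI_refl.
have [c [[d A' B'] [okc [hA' hB'] sT]]] := exists_summand N0 hA hB.
have lt : (d < N)%N.
  have [S [S' [iS _ _]]] := sT; have /= -> := mxiso_dim iS.
  by rewrite -[X in (X < _)%N]add0n ltn_add2r summand_dim_gt0.
have [s oks sS] := IHN d lt A' B' hA' hB'.
exists (c :: s); first by rewrite /= okc.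
by apply: starI_trans sT _; apply: starI_add; [apply: starI_refl|].
Qed.

End Existence.

(** * Multiplicities and Kronecker's theorem *)

Section Multiplicity.

Variable F : fieldType.
Hypothesis natr_neq0 : forall n, n.+1%:R != 0 :> F.
Local Notation shift n := (jordan_block n (0 : F)).

Definition pairing (K P : mxpair F) r (p : 'I_r -> 'M_(ncols K, ncols P))
  (E : 'I_r -> 'M_(ncols P, ncols K)) : 'M[F]_r := \matrix_(a, b) \tr (p a *m E b).

(* [mult_le] and [mult_ge] bound the rank of the trace pairing between
   [Hom(P, K)] and [Hom(K, P)]; for an indecomposable [K] this rank is the
   multiplicity of [K] as a direct summand of [P]. *)
Definition mult_le (K P : mxpair F) (m : nat) : Prop :=
  forall r E (g : 'I_r -> _) p (q : 'I_r -> _),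
    (forall a, @hom F K P (E a) (g a)) -> (forall a, @hom F P K (p a) (q a)) ->
    (\rank (pairing p E) <= m)%N.

Definition mult_ge (K P : mxpair F) (m : nat) : Prop :=
  exists r E (g : 'I_r -> _) p (q : 'I_r -> _),
    [/\ forall a, @hom F K P (E a) (g a), forall a, @hom F P K (p a) (q a)
      & (m <= \rank (pairing p E))%N].

Definition mult K P m := mult_le K P m /\ mult_ge K P m.

Lemma mult_inj K P m m' : mult K P m -> mult K P m' -> m = m'.
Proof.
suff H m1 m2 : mult_le K P m1 -> mult_ge K P m2 -> (m2 <= m1)%N.
  by move=> [le ge] [le' ge']; apply/eqP; rewrite eqn_leq !H.
move=> le [r [E [g [p [q [hE hp ge]]]]]].
exact: leq_trans ge (le _ _ _ _ _ hE hp).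
Qed.

Lemma mult_equivalent K P Q m : equivalentI P Q -> mult K P m -> mult K Q m.
Proof.
move=> eqPQ [le ge]; split.
  have [R [R' [S [S' [[RR R'R] [SS S'S] EA EB]]]]] := eqPQ.
  move=> r E g p q hE hp.
  have -> : pairing p E = pairing (fun a => p a *m S') (fun b => S *m E b).
    by apply/matrixP => a b; rewrite !mxE -mulmxA (mulmxA S') S'S mul1mx.
  apply: (le _ _ (fun b => R' *m g b) _ (fun a => q a *m R)) => a.
    have [hA hB] := hE a; split; rewrite -mulmxA -?hA -?hB -?EA -?EB !mulmxA R'R mul1mx //.
  have [hA hB] := hp a; split; rewrite mulmxA ?hA ?hB -?EA -?EB -!mulmxA SS mulmx1 //.
have [R [R' [S [S' [[RR R'R] [SS S'S] EA EB]]]]] := equivalentI_sym eqPQ.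
have [r [E [g [p [q [hE hp rk]]]]]] := ge.
exists r, (fun b => S *m E b), (fun b => R' *m g b), (fun a => p a *m S'), (fun a => q a *m R).
split=> [a|a|].
- have [hA hB] := hE a; split; rewrite -mulmxA -?hA -?hB -?EA -?EB !mulmxA R'R mul1mx //.
- have [hA hB] := hp a; split; rewrite mulmxA ?hA ?hB -?EA -?EB -!mulmxA SS mulmx1 //.
suff -> : pairing (fun a => p a *m S') (fun b => S *m E b) = pairing p E by [].
by apply/matrixP => a b; rewrite !mxE -mulmxA (mulmxA S') S'S mul1mx.
Qed.

Lemma hom_add_col K P Q (E : 'M_(ncols P, _)) (E' : 'M_(ncols Q, _))
    (g : 'M_(nrows P, _)) (g' : 'M_(nrows Q, _)) :
  @hom F K (mxpair_add P Q) (col_mx E E') (col_mx g g') <->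
  @hom F K P E g /\ @hom F K Q E' g'.
Proof.
rewrite /hom /= !mul_block_col !mul_col_mx !mul0mx !addr0 !add0r; split.
  by move=> [/eq_col_mx [-> ->] /eq_col_mx [-> ->]].
by move=> [[-> ->] [-> ->]].
Qed.

Lemma hom_add_row K P Q (p : 'M_(_, ncols P)) (p' : 'M_(_, ncols Q))
    (q : 'M_(_, nrows P)) (q' : 'M_(_, nrows Q)) :
  @hom F (mxpair_add P Q) K (row_mx p p') (row_mx q q') <->
  @hom F P K p q /\ @hom F Q K p' q'.
Proof.
rewrite /hom /= !mul_row_block !mul_mx_row !mulmx0 !addr0 !add0r; split.
  by move=> [/eq_row_mx [-> ->] /eq_row_mx [-> ->]].
by move=> [[-> ->] [-> ->]].
Qed.

(** Morphisms from or to a direct sum split, so the pairing is a sum of two pairings, of subadditive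
    rank; juxtaposing a family for each summand makes it block diagonal, with additive rank. *)
Lemma mult_add K P Q m m' : mult K P m -> mult K Q m' -> mult K (mxpair_add P Q) (m + m').
Proof.
move=> [le ge] [le' ge']; split.
  move=> r E g p q hE hp.
  have -> : pairing p E = @pairing K P r (fun a => lsubmx (p a)) (fun b => usubmx (E b))
        + @pairing K Q r (fun a => rsubmx (p a)) (fun b => dsubmx (E b)).
    apply/matrixP => a b; rewrite !mxE -linearD /=; congr (\tr _).
    by rewrite -mul_row_col hsubmxK vsubmxK.
  apply: leq_trans (mxrank_add _ _) _; apply: leq_add.
    apply: (le _ _ (fun b => usubmx (g b)) _ (fun a => lsubmx (q a))) => a.
      by have := hE a; rewrite -{1}[E a]vsubmxK -{1}[g a]vsubmxK => /hom_add_col [].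
    by have := hp a; rewrite -{1}[p a]hsubmxK -{1}[q a]hsubmxK => /hom_add_row [].
  apply: (le' _ _ (fun b => dsubmx (g b)) _ (fun a => rsubmx (q a))) => a.
    by have := hE a; rewrite -{1}[E a]vsubmxK -{1}[g a]vsubmxK => /hom_add_col [].
  by have := hp a; rewrite -{1}[p a]hsubmxK -{1}[q a]hsubmxK => /hom_add_row [].
have [r [E [g [p [q [hE hp rk]]]]]] := ge; have [r' [E' [g' [p' [q' [hE' hp' rk']]]]]] := ge'.
have hom0 T U : @hom F T U 0 0 by split; rewrite mulmx0 mul0mx.
exists (r + r')%N, (fun a => match split a with inl x => col_mx (E x) 0 | inr y => col_mx 0 (E' y) end).
exists (fun a => match split a with inl x => col_mx (g x) 0 | inr y => col_mx 0 (g' y) end).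
exists (fun a => match split a with inl x => row_mx (p x) 0 | inr y => row_mx 0 (p' y) end).
exists (fun a => match split a with inl x => row_mx (q x) 0 | inr y => row_mx 0 (q' y) end).
split=> [a|a|].
- by case: (split a) => x; apply/hom_add_col.
- by case: (split a) => x; apply/hom_add_row.
set M := pairing _ _; suff -> : M = block_mx (pairing p E) 0 0 (pairing p' E').
  by rewrite rank_diag_block_mx leq_add.
have sl x : split (lshift r' x) = inl x :> 'I_r + 'I_r' := unsplitK (inl x).
have sr x : split (rshift r x) = inr x :> 'I_r + 'I_r' := unsplitK (inr x).
apply/matrixP => a b; rewrite /M mxE.
case: (split_ordP a) => x ->; case: (split_ordP b) => y ->;
  rewrite ?block_mxEul ?block_mxEur ?block_mxEdl ?block_mxEdr ?sl ?sr;
  by rewrite mul_row_col ?mulmx0 ?mul0mx ?addr0 ?add0r !mxE ?mxtrace0.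
Qed.

Lemma mult_empty K : mult K (@MxPair F 0 0 0 0) 0.
Proof.
split; last by exists 0%N, (fun _ => 0), (fun _ => 0), (fun _ => 0), (fun _ => 0); split=> [[]|[]|].
move=> r E g p q _ _; suff -> : pairing p E = 0 by rewrite mxrank0.
by apply/matrixP => a b; rewrite !mxE [E b]flatmx0 mulmx0 mxtrace0.
Qed.

Lemma mult_orthogonal K P :
  (forall E g p q, @hom F K P E g -> @hom F P K p q -> \tr (p *m E) = 0) -> mult K P 0.
Proof.
move=> H; split; last by exists 0%N, (fun _ => 0), (fun _ => 0), (fun _ => 0), (fun _ => 0); split=> [[]|[]|].
move=> r E g p q hE hp; suff -> : pairing p E = 0 by rewrite mxrank0.
by apply/matrixP => a b; rewrite !mxE (H _ _ _ _ (hE b) (hp a)).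
Qed.

(** The product formula makes the pairing an outer product, of rank at most 1; the identity attains
    rank 1, its trace being the nonzero size of [K]. *)
Lemma mult_brick K (x y : 'M_(ncols K) -> F) : (0 < ncols K)%N ->
  (forall E g p q, @hom F K K E g -> @hom F K K p q -> \tr (p *m E) = x p * y E) -> mult K K 1.
Proof.
move=> K0 H; split.
  move=> r E g p q hE hp.
  have -> : pairing p E = (\col_a x (p a)) *m (\row_b y (E b)).
    by apply/matrixP => a b; rewrite !mxE big_ord1 !mxE (H _ _ _ _ (hE b) (hp a)).
  by rewrite (leq_trans (mxrankM_maxl _ _)) // rank_leq_col.
exists 1%N, (fun _ => 1%:M), (fun _ => 1%:M), (fun _ => 1%:M), (fun _ => 1%:M).
have h1 : @hom F K K 1%:M 1%:M by split; rewrite mulmx1 mul1mx.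
split=> //; rewrite rank_rV lt0b; apply/matrix0Pn; exists 0, 0.
by rewrite !mxE mulmx1 mxtrace1; case: (ncols K) K0.
Qed.

(** $E$ is constant along diagonals; for $m<n$ the main diagonal ends in the last row, where the
    product with the shift is zero. *)
Lemma shift_intertwine m n (E : 'M[F]_(m.+1, n.+1)) : shift m.+1 *m E = E *m shift n.+1 ->
  [/\ forall j, j != ord0 -> E j ord0 = 0,
      forall (j : 'I_m.+1) (k : 'I_n.+1), j = k :> nat -> E j k = E ord0 ord0
    & (m < n)%N -> E ord0 ord0 = 0].
Proof.
move=> EN.
have diag d : forall (j : 'I_m.+1) (k : 'I_n.+1), j = d :> nat -> k = d :> nat -> E j k = E ord0 ord0.
  elim: d => [|d IHd] j k Ej Ek; first by congr (E _ _); apply: ord_inj.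
  have ltj : (d < m.+1)%N by rewrite ltnW // -Ej.
  have ltk : (d < n.+1)%N by rewrite ltnW // -Ek.
  rewrite -(IHd (Ordinal ltj) (Ordinal ltk)) //.
  rewrite -(@mul_shift_mxS _ _ _ E (Ordinal ltj)) // EN.
  by rewrite (@mul_mx_shiftS _ _ _ _ _ _ (Ordinal ltk)).
split.
- move=> j j0; have lt : (j.-1 < m.+1)%N by rewrite (leq_ltn_trans (leq_pred _)).
  rewrite -(@mul_shift_mxS _ _ _ E (Ordinal lt)) ?EN ?mul_mx_shift0 //=.
  by rewrite prednK // lt0n; apply: contraNneq j0 => j0; apply/eqP/ord_inj.
- by move=> j k E'; apply: (diag k).
- move=> lt; have ltm : (m < n.+1)%N by rewrite ltnW.
  rewrite -(diag m ord_max (Ordinal ltm)) //.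
  have ltS : (m.+1 < n.+1)%N by [].
  by rewrite -(@mul_mx_shiftS _ _ _ E _ (Ordinal ltS) (Ordinal ltm)) // -EN mul_shift_mx_last.
Qed.

(** $pE$ commutes with a shift and so has constant diagonal; its corner entry is a single product
    since the first column of $E$ vanishes below the top. *)
Lemma shift_pairing m n (E : 'M[F]_(m.+1, n.+1)) (p : 'M_(n.+1, m.+1)) :
  shift m.+1 *m E = E *m shift n.+1 -> shift n.+1 *m p = p *m shift m.+1 ->
  \tr (p *m E) = n.+1%:R * p ord0 ord0 * E ord0 ord0.
Proof.
move=> hE hp.
have hU : shift n.+1 *m (p *m E) = p *m E *m shift n.+1 by rewrite mulmxA hp -mulmxA hE mulmxA.
have [_ diag _] := shift_intertwine hU; have [low _ _] := shift_intertwine hE.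
rewrite /mxtrace (eq_bigr (fun=> (p *m E) ord0 ord0)) => [|j _]; last exact: diag.
rewrite sumr_const card_ord -[LHS]mulr_natl -[RHS]mulrA; congr (_ * _).
by rewrite mxE (bigD1 ord0) //= big1 ?addr0 // => l l0; rewrite low ?mulr0.
Qed.

Lemma shift_pairing_eq0 m n (E : 'M[F]_(m.+1, n.+1)) (p : 'M_(n.+1, m.+1)) : m != n ->
  shift m.+1 *m E = E *m shift n.+1 -> shift n.+1 *m p = p *m shift m.+1 ->
  \tr (p *m E) = 0.
Proof.
move=> ne hE hp; rewrite (shift_pairing hE hp).
have [_ _ E0] := shift_intertwine hE; have [_ _ p0] := shift_intertwine hp.
by case: (ltngtP m n) ne => // lt _; [rewrite E0 // mulr0 | rewrite p0 // mulr0 mul0r].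
Qed.

Lemma nilp_fix m n (a : 'M[F]_m) (b : 'M_n) s (X : 'M_(m, n)) :
  a ^+ s = 0 \/ b ^+ s = 0 -> X = a *m X *m b -> X = 0.
Proof.
move=> nil EX; suff H k : X = a ^+ k *m X *m b ^+ k.
  by rewrite (H s); case: nil => ->; rewrite ?mul0mx ?mulmx0.
elim: k => [|k IHk]; first by rewrite !expr0 -!idmxE mul1mx mulmx1.
by rewrite {1}IHk {1}EX exprSr exprS -!mulmxE !mulmxA.
Qed.

(** Column $j$ of [q] is $J$ times column $j+1$, and the last column is zero. *)
Lemma wide_F_G_eq0 m n (J : 'M[F]_n) (q : 'M_(n, m)) : J *m (q *m Fmx F m) = q *m Gmx F m -> q = 0.
Proof.
move=> Eq; suff H d : forall j : 'I_m, (d + j = m.-1)%N -> forall a, q a j = 0.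
  by apply/matrixP => a j; rewrite mxE (H (m.-1 - j)%N) // subnK //; have := ltn_ord j; lia.
elim: d => [|d IHd] j Ej a; rewrite -mul_mx_Gmx -Eq mxE big1 // => b _;
  case: (unliftP ord_max (lift ord0 j)) => [l El|->]; rewrite ?mul_mx_Fmx_max ?mulr0 //;
  have := congr1 (@nat_of_ord _) El; rewrite lift0 lift_max => El'; rewrite El mul_mx_Fmx.
  by have /= := ltn_ord l; lia.
by rewrite IHd ?mulr0 //; lia.
Qed.

Lemma wide_G_F_eq0 m n (J : 'M[F]_n) (q : 'M_(n, m)) : J *m (q *m Gmx F m) = q *m Fmx F m -> q = 0.
Proof.
move=> Eq; suff H d : forall j : 'I_m, j = d :> nat -> forall a, q a j = 0.
  by apply/matrixP => a j; rewrite mxE (H j).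
elim: d => [|d IHd] j Ej a; rewrite -mul_mx_Fmx -Eq mxE big1 // => b _;
  case: (unliftP ord0 (lift ord_max j)) => [l El|->]; rewrite ?mul_mx_Gmx0 ?mulr0 //;
  have := congr1 (@nat_of_ord _) El; rewrite lift0 lift_max => El'; rewrite El mul_mx_Gmx.
  by rewrite Ej in El'.
by rewrite IHd ?mulr0 //; lia.
Qed.

Definition eq_kblock (K M : kblock F) : bool :=
  match K, M with
  | KJordan n a, KJordan m b => (m == n) && (b == a)
  | KInfinite n, KInfinite m => m == n
  | KWide n, KWide m => m == n
  | KTall n, KTall m => m == n
  | _, _ => false
  end.

(** Against a block of another kind or eigenvalue, one of the two Hom spaces is zero; for equal
    eigenvalues and different sizes the composites have trace zero. *)
Lemma mult_jordan n (a : F) M : (0 < n)%N -> kblock_ok M ->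
  mult (kblock_pair (KJordan n a)) (kblock_pair M) (eq_kblock (KJordan n a) M).
Proof.
case: n => // n _; case: M => [[|m] b|m|m|m] //= _.
- case: (eqVneq b a) => [->|ba]; rewrite ?andbT ?andbF; last first.
    apply: mult_orthogonal => E g p q [/= EA EB] _.
    suff -> : E = 0 by rewrite mulmx0 mxtrace0.
    rewrite mul1mx mulmx1 in EA; rewrite -EA (jordan_shift _ a) (jordan_shift _ b) in EB.
    apply: (@nilp_sylvester _ _ _ (shift m.+1) (shift n.+1) m.+1 n.+1 (a - b)); rewrite ?shift_nilp //.
      by rewrite subr_eq0 eq_sym.
    move: EB; rewrite mulmxDl mulmxDr mul_scalar_mx mul_mx_scalar => EB.
    by rewrite scalerBl -[a *: E](addrK (E *m shift n.+1)) -EB addrAC [_ + _ - b *: E]addrAC subrr add0r.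
  have shE m' n' (E : 'M_(m'.+1, n'.+1)) g :
      1%:M *m E = g *m 1%:M -> jordan_block m'.+1 a *m E = g *m jordan_block n'.+1 a ->
      shift m'.+1 *m E = E *m shift n'.+1.
    rewrite mul1mx mulmx1 => <-; rewrite (jordan_shift _ a) [jordan_block n'.+1 a]jordan_shift.
    by rewrite mulmxDl mulmxDr scalar_mxC => /addrI.
  rewrite eqSS; case: (eqVneq m n) => [->|mn].
    apply: (@mult_brick (kblock_pair (KJordan n.+1 a))
      (fun p : 'M_n.+1 => n.+1%:R * p ord0 ord0) (fun E : 'M_n.+1 => E ord0 ord0)) => //.
    move=> E g p q [/= EA EB] [/= pA pB].
    by apply: shift_pairing; [apply: shE EA EB | apply: shE pA pB].
  apply: mult_orthogonal => E g p q [/= EA EB] [/= pA pB].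
  by apply: (shift_pairing_eq0 mn); [apply: shE EA EB | apply: shE pA pB].
- apply: mult_orthogonal => E g p q [/= EA EB] _.
  suff -> : E = 0 by rewrite mulmx0 mxtrace0.
  rewrite mulmx1 in EA; rewrite mul1mx -EA in EB.
  by apply: (nilp_fix (or_introl (shift_nilp F m)) EB).
- apply: mult_orthogonal => E g p q _ [/= pA pB].
  suff q0 : q = 0 by rewrite -[p]mul1mx pA q0 !mul0mx mxtrace0.
  rewrite mul1mx in pA; rewrite pA in pB.
  exact: wide_F_G_eq0 pB.
- apply: mult_orthogonal => E g p q [/= EA EB] _.
  suff E0 : E^T = 0 by rewrite -[E]trmxK E0 trmx0 mulmx0 mxtrace0.
  rewrite mulmx1 in EA; rewrite -EA in EB.
  apply: (@wide_F_G_eq0 _ _ (jordan_block n.+1 a)^T).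
  by apply: trmx_inj; rewrite !trmx_mul !trmxK EB.
Qed.

Lemma mult_infinite n M : (0 < n)%N -> kblock_ok M ->
  mult (kblock_pair (KInfinite n)) (kblock_pair M) (eq_kblock (KInfinite n) M).
Proof.
case: n => // n _; case: M => [m b|[|m]|m|m] //= _.
- apply: mult_orthogonal => E g p q [/= EA EB] _.
  suff -> : E = 0 by rewrite mulmx0 mxtrace0.
  rewrite mulmx1 in EB; rewrite mul1mx -EB in EA.
  by apply: (nilp_fix (or_intror (shift_nilp F n.+1)) EA).
- have shE m' n' (E : 'M_(m'.+1, n'.+1)) g : shift m'.+1 *m E = g *m shift n'.+1 ->
      1%:M *m E = g *m 1%:M -> shift m'.+1 *m E = E *m shift n'.+1.
    by move=> EA; rewrite mul1mx mulmx1 => Eg; rewrite EA Eg.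
  rewrite eqSS; case: (eqVneq m n) => [->|mn].
    apply: (@mult_brick (kblock_pair (KInfinite n.+1))
      (fun p : 'M_n.+1 => n.+1%:R * p ord0 ord0) (fun E : 'M_n.+1 => E ord0 ord0)) => //.
    move=> E g p q [/= EA EB] [/= pA pB].
    by apply: shift_pairing; [apply: shE EA EB | apply: shE pA pB].
  apply: mult_orthogonal => E g p q [/= EA EB] [/= pA pB].
  by apply: (shift_pairing_eq0 mn); [apply: shE EA EB | apply: shE pA pB].
- apply: mult_orthogonal => E g p q _ [/= pA pB].
  suff q0 : q = 0 by rewrite -[p]mul1mx pB q0 !mul0mx mxtrace0.
  rewrite mul1mx in pB; rewrite pB in pA.
  exact: wide_G_F_eq0 pA.
- apply: mult_orthogonal => E g p q [/= EA EB] _.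
  suff E0 : E^T = 0 by rewrite -[E]trmxK E0 trmx0 mulmx0 mxtrace0.
  rewrite mulmx1 in EB; rewrite -EB in EA.
  apply: (@wide_G_F_eq0 _ _ (shift n.+1)^T).
  by apply: trmx_inj; rewrite !trmx_mul !trmxK EA.
Qed.

Lemma mult_wide k M : kblock_ok M ->
  mult (kblock_pair (KWide k)) (kblock_pair M) (eq_kblock (KWide k) M).
Proof.
case: M => [m b|m|m|m] //= _.
- apply: mult_orthogonal => E g p q [/= EA EB] _.
  rewrite mul1mx in EA; rewrite EA in EB.
  by rewrite EA (wide_F_G_eq0 EB) mul0mx mulmx0 mxtrace0.
- apply: mult_orthogonal => E g p q [/= EA EB] _.
  rewrite mul1mx in EB; rewrite EB in EA.
  by rewrite EB (wide_G_F_eq0 EA) mul0mx mulmx0 mxtrace0.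
- have trE (E : 'M_(m.+1, k.+1)) g (p : 'M_(k.+1, m.+1)) q :
      Fmx F m *m E = g *m Fmx F k -> Gmx F m *m E = g *m Gmx F k ->
      Fmx F k *m p = q *m Fmx F m -> Gmx F k *m p = q *m Gmx F m ->
      \tr (p *m E) = k.+1%:R * p ord0 ord0 * E ord0 ord0.
    move=> EF EG pF pG; have [low _ _ _] := wide_wide_hom EF EG.
    have [-> _] : p *m E = ((p *m E) ord0 ord0)%:M /\ q *m g = ((p *m E) ord0 ord0)%:M.
      by apply: wide_scalar; rewrite mulmxA ?pF ?pG -mulmxA ?EF ?EG mulmxA.
    rewrite mxtrace_scalar -[LHS]mulr_natl -[RHS]mulrA; congr (_ * _).
    by rewrite mxE (bigD1 ord0) //= big1 ?addr0 // => l l0; rewrite low ?mulr0.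
  case: (eqVneq m k) => [mk|mk].
    move: trE; rewrite {}mk => trE.
    apply: (@mult_brick (kblock_pair (KWide k))
      (fun p : 'M_k.+1 => k.+1%:R * p ord0 ord0) (fun E : 'M_k.+1 => E ord0 ord0)) => //.
    by move=> E g p q [/= EA EB] [/= pA pB]; apply: trE EA EB pA pB.
  apply: mult_orthogonal => E g p q [/= EA EB] [/= pA pB].
  rewrite (trE _ _ _ _ EA EB pA pB).
  have [_ _ _ E0] := wide_wide_hom EA EB; have [_ _ _ p0] := wide_wide_hom pA pB.
  by case: (ltngtP m k) mk => // lt _; [rewrite p0 // mulr0 mul0r | rewrite E0 // mulr0].
- apply: mult_orthogonal => E g p q [/= EA EB] _.
  by rewrite (wide_tall_hom0 EA EB) mulmx0 mxtrace0.
Qed.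

End Multiplicity.

(** * Recognizing a summand by one Kronecker block *)

Section Classes.

Variables (F : closedFieldType) (bar : {rmorphism F -> F}) (i : F).
Hypothesis barK : involutive bar.
Hypothesis bar_nonid : exists x : F, bar x <> x.
Hypothesis i_sqr : i ^+ 2 = -1.

Definition same_typeI (n : nat) (mu : F) n' mu' := (n' == n) && ((mu' == mu) || (mu' == bar mu)).

Definition exact_class (c d : summand F) : bool :=
  match c, d with
  | TypeI n mu, TypeI n' mu' => same_typeI n mu n' mu'
  | TypeII n a b, TypeII n' a' b' => (n' == n) && ((a' == a) && (b' == b))
  | _, _ => false
  end.

Definition sign_class (c d : summand F) : bool :=
  match c, d with
  | TypeI n mu, TypeI n' mu' => same_typeI n mu n' mu'
  | TypeII n a b, TypeII n' a' b' =>
      (n' == n) && ((a' == a) && (b' == b) || (a' == - a) && (b' == - b))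
  | _, _ => false
  end.

Lemma exact_classP c d : reflect (eq_summand bar c d) (exact_class c d).
Proof.
apply: (iffP idP); case: c d => [n mu|n a b] [n' mu'|n' a' b'] //=.
- by move=> /andP [/eqP -> /orP [] /eqP ->]; split=> //; [left | right].
- by move=> /andP [/eqP -> /andP [/eqP -> /eqP ->]].
- by move=> [-> [] ->]; rewrite /same_typeI !eqxx ?orbT.
- by move=> [-> -> ->]; rewrite !eqxx.
Qed.

Lemma sign_classP c d : reflect (eq_summand_sign bar c d) (sign_class c d).
Proof.
apply: (iffP idP); rewrite /eq_summand_sign; case: c d => [n mu|n a b] [n' mu'|n' a' b'] //=.
- by move=> /andP [/eqP -> /orP [] /eqP ->]; left; split=> //; [left | right].
- by move=> /andP [/eqP -> /orP [] /andP [/eqP -> /eqP ->]]; [left | right].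
- by move=> [[-> [] ->]|//]; rewrite /same_typeI !eqxx ?orbT.
- by case.
- by case.
- by move=> [] [-> -> ->]; rewrite !eqxx ?orbT.
Qed.

Lemma same_typeI_trans n mu n' mu' n'' mu'' :
  same_typeI n mu n' mu' -> same_typeI n mu n'' mu'' = same_typeI n' mu' n'' mu''.
Proof. by rewrite /same_typeI => /andP [/eqP -> /orP [] /eqP ->] //; rewrite barK orbC. Qed.

Lemma exact_class_refl c : exact_class c c.
Proof. by case: c => [n mu|n a b]; rewrite /= /same_typeI !eqxx. Qed.

Lemma exact_class_trans c d : exact_class c d -> exact_class c =1 exact_class d.
Proof.
case: c d => [n mu|n a b] [n' mu'|n' a' b'] //= H [n'' mu''|n'' a'' b''] //=.
  exact: same_typeI_trans.
by case/andP: H => /eqP -> /andP [/eqP -> /eqP ->].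
Qed.

Lemma sign_class_refl c : sign_class c c.
Proof. by case: c => [n mu|n a b]; rewrite /= /same_typeI !eqxx. Qed.

Lemma sign_class_trans c d : sign_class c d -> sign_class c =1 sign_class d.
Proof.
case: c d => [n mu|n a b] [n' mu'|n' a' b'] //= H [n'' mu''|n'' a'' b''] //=.
  exact: same_typeI_trans.
by case/andP: H => /eqP -> /orP [] /andP [/eqP -> /eqP ->] //; rewrite !opprK orbC.
Qed.

(** One block is enough to recognize a summand: the two blocks of type (i) are exchanged by duality
    and always occur together. *)
Definition summand_kblock (c : summand F) : kblock F :=
  match c with
  | TypeI n mu => if odd n then KWide n./2 else KJordan n./2 mu
  | TypeII n a b => kblock_typeII n a b
  end.

(** A line through the origin meets the circle in two antipodal points: with slope $m$, both $x^2$
    and $x'^2$ are inverse to $1+m^2$. *)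
Lemma ratio_eq (x y x' y' : F) : x ^+ 2 + y ^+ 2 = 1 -> x' ^+ 2 + y' ^+ 2 = 1 ->
  x != 0 -> x' != 0 ->
  (y' / x' == y / x) = (x' == x) && (y' == y) || (x' == - x) && (y' == - y).
Proof.
move=> E E' x0 x'0; apply/eqP/orP => [Er|]; last first.
  by move=> [] /andP [/eqP -> /eqP ->] //; rewrite invrN mulrNN.
have Ey : y' = y / x * x' by rewrite -Er divfK.
have : x' ^+ 2 == x ^+ 2.
  have m0 : 1 + (y / x) ^+ 2 != 0.
    apply: contraNneq (oner_neq0 F) => m0; rewrite -E.
    have -> : x ^+ 2 + y ^+ 2 = x ^+ 2 * (1 + (y / x) ^+ 2) by field.
    by rewrite m0 mulr0.
  rewrite -(inj_eq (mulIf m0)).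
  have -> : x ^+ 2 * (1 + (y / x) ^+ 2) = x ^+ 2 + y ^+ 2 by field.
  have -> : x' ^+ 2 * (1 + (y / x) ^+ 2) = x' ^+ 2 + y' ^+ 2 by rewrite Ey; ring.
  by rewrite E E'.
rewrite eqf_sqr => /orP [] /eqP Ex; [left | right]; rewrite Ex eqxx Ey Ex /=.
  by rewrite divfK.
by rewrite mulrN divfK.
Qed.

Lemma ratio_inf (x y x' y' : F) : x ^+ 2 + y ^+ 2 = 1 -> x' ^+ 2 + y' ^+ 2 = 1 ->
  x = 0 -> x' = 0 -> (x' == x) && (y' == y) || (x' == - x) && (y' == - y).
Proof.
move=> E E' x0 x'0; rewrite x0 x'0 oppr0 !eqxx /=.
by rewrite -eqf_sqr -(inj_eq (addrI (0 ^+ 2))) -{1}x'0 E' -x0 E.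
Qed.

Lemma kblock_typeII_eq n a b n' a' b' : a ^+ 2 + b ^+ 2 = 1 -> a' ^+ 2 + b' ^+ 2 = 1 ->
  eq_kblock (kblock_typeII n a b) (kblock_typeII n' a' b') = sign_class (TypeII n a b) (TypeII n' a' b').
Proof.
move=> E E'; rewrite /kblock_typeII /=; case: (eqVneq n' n) => [->|nn]; last first.
  by do ![case: ifP => _ //=]; rewrite (negPf nn).
have sw (x y : F) : x ^+ 2 + y ^+ 2 = 1 -> y ^+ 2 + (- x) ^+ 2 = 1 by rewrite sqrrN addrC.
case: (odd n) => /=.
  case: (eqVneq a 0) => [a0|a0]; case: (eqVneq a' 0) => [a'0|a'0] /=.
  - by rewrite eqxx ratio_inf.
  - by rewrite a0 oppr0 (negPf a'0).
  - by rewrite a'0 ![0 == _]eq_sym oppr_eq0 (negPf a0).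
  - by rewrite eqxx /= ratio_eq.
(* For even $n$ the eigenvalue $-a/b$ is the slope of the rotated point $(b,-a)$, which reduces to
   the odd case. *)
have -> : (a' == a) && (b' == b) || (a' == - a) && (b' == - b)
    = (b' == b) && (- a' == - a) || (b' == - b) && (- a' == - - a).
  by rewrite !eqr_opp ![(b' == _) && _]andbC.
case: (eqVneq b 0) => [b0|b0]; case: (eqVneq b' 0) => [b'0|b'0] /=.
- by rewrite eqxx ratio_inf ?sw.
- by rewrite b0 oppr0 (negPf b'0).
- by rewrite b'0 ![0 == _]eq_sym oppr_eq0 (negPf b0).
- by rewrite eqxx /= ratio_eq ?sw.
Qed.

Definition not_tall (K : kblock F) : bool := if K is KTall _ then false else true.

Lemma mult_kblock K M : kblock_ok K -> kblock_ok M -> not_tall K ->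
  mult (kblock_pair K) (kblock_pair M) (@eq_kblock F K M).
Proof.
have n0 n : n.+1%:R != 0 :> F := natr_neq0 barK bar_nonid i_sqr n.
case: K => // [n a|n|n] okK okM _; [exact: mult_jordan | exact: mult_infinite | exact: mult_wide].
Qed.

(** The three kinds never meet: type (i) of even size has eigenvalues outside P, type (ii) has one
    in P or infinity, and type (i) of odd size consists of singular blocks. *)
Lemma mult_summand c d : summand_ok bar i c -> summand_ok bar i d ->
  mult (kblock_pair (summand_kblock c)) (summand_pair bar d) (sign_class c d).
Proof.
move=> okc okd.
have okK : kblock_ok (summand_kblock c) /\ not_tall (summand_kblock c).
  case: c okc => [n mu|n a b] /=; last first.
    by move=> /and4P [n0 _ _ _]; rewrite /kblock_typeII; do ![case: ifP => _ //].
  by case: ifP => //= on /andP [n0 _]; rewrite half_gt0; case: n n0 on => [|[]].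
case: okK => okK tK.
have real_ratio a b : bar a = a -> bar b = b -> bar (b / a) = b / a.
  by move=> ba bb; rewrite rmorphM /= fmorphV ba bb.
have kI n a b x : summand_ok bar i (TypeII n a b) -> bar x != x ->
    forall m, eq_kblock (kblock_typeII n a b) (KJordan m x) = false /\
      eq_kblock (KJordan m x) (kblock_typeII n a b) = false.
  move=> /and4P [_ /eqP ba /eqP bb _] bx m.
  have ne y : bar y = y -> (x == y) = false /\ (y == x) = false.
    by move=> by_; split; apply/eqP => E; case/eqP: bx; rewrite ?E ?by_ // -E by_.
  have bNa : bar (- a) = - a by rewrite rmorphN ba.
  have [e1 e2] := ne _ (real_ratio _ _ ba bb); have [e3 e4] := ne _ (real_ratio _ _ bb bNa).
  by rewrite /kblock_typeII; do ![case: ifP => _ //=]; rewrite ?e1 ?e2 ?e3 ?e4 ?andbF.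
have bi : bar i = - i := bar_i barK bar_nonid i_sqr.
have bi0 : bar i != i by apply/eqP; apply: (i_not_fixed barK bar_nonid i_sqr).
have odd_nonreal (mu : F) : (mu == i) || (mu == - i) -> bar mu != mu.
  by move=> /orP [] /eqP ->; rewrite ?rmorphN ?eqr_opp.
case: d okd => [n' mu'|n' a' b'] okd; last first.
  case/and4P: (okd) => n'0 _ _ /eqP E'.
  apply: mult_equivalent (equivalentI_sym (typeII_kronecker bar n' E')) _.
  have okM : kblock_ok (kblock_typeII n' a' b') by rewrite /kblock_typeII; do ![case: ifP => _ //].
  have := mult_kblock okK okM tK; congr mult; congr nat_of_bool.
  case: c okc {okK tK} => [n mu|n a b] okc; last first.
    by case/and4P: (okc) => _ _ _ /eqP E; apply: kblock_typeII_eq.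
  case/andP: okc => _ /=; case: ifP => _ Hmu; first by rewrite /kblock_typeII; do ![case: ifP => _ //].
  by have [_ ->] := kI _ _ _ mu okd Hmu n./2.
case: (boolP (odd n')) => on'.
  have En' : n' = (n'./2).*2.+1 by rewrite -[LHS]odd_double_half on'.
  move: okd; rewrite {}En'; move: (n'./2) => r okd {on'}.
  have Hmu' : (mu' == i) || (mu' == - i) by move: okd; rewrite /= odd_double.
  apply: mult_equivalent (equivalentI_sym (typeI_odd_kronecker barK r (odd_nonreal _ Hmu'))) _.
  have := mult_add (mult_kblock (M := KWide r) okK isT tK) (mult_kblock (M := KTall r) okK isT tK).
  congr mult; case: c okc {okK tK} => [n mu|n a b] okc /=; last first.
    by rewrite /kblock_typeII; do ![case: ifP => _ //].
  case/andP: okc => _; rewrite /same_typeI; case: ifP => on Hmu.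
    rewrite /= addn0; congr nat_of_bool.
    have -> : (mu' == mu) || (mu' == bar mu).
      by case/orP: Hmu => /eqP ->; case/orP: Hmu' => /eqP ->; rewrite ?rmorphN bi ?opprK eqxx ?orbT.
    rewrite andbT -{2}(odd_double_half n) on add1n eqSS.
    by rewrite -!muln2 eqn_pmul2r.
  by rewrite /=; case: eqP => // E; move: on; rewrite -E /= odd_double.
have En' : n' = (n'./2).*2 by rewrite -[LHS]odd_double_half (negPf on').
move: okd; rewrite {}En'; move: (n'./2) => r okd {on'}.
have Hmu' : bar mu' != mu' by move: okd; rewrite /= odd_double => /andP [].
have r0 : (0 < r)%N by move: okd; rewrite /= double_gt0 => /andP [].
apply: mult_equivalent (equivalentI_sym (typeI_even_kronecker barK r Hmu')) _.
have := mult_add (mult_kblock (M := KJordan r mu') okK r0 tK)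
  (mult_kblock (M := KJordan r (bar mu')) okK r0 tK).
congr mult; case: c okc {okK tK} => [n mu|n a b] okc; last first.
  have [e1 _] := kI _ _ _ _ okc Hmu' r.
  by have [|e2 _] := kI _ _ _ (bar mu') okc _ r; rewrite ?barK 1?eq_sym //= e1 e2.
case/andP: okc => _ /=; case: ifP => on Hmu.
  by rewrite /= /same_typeI; case: eqP => // E; move: on; rewrite -E odd_double.
rewrite /= /same_typeI -{3}(odd_double_half n) on add0n -!muln2 eqn_pmul2r //.
(* At most one of $\mu'$ and $\bar\mu'$ equals $\mu$, so the two contributions add up to a truth
   value. *)
case: (r == n./2) => //=; rewrite -[bar mu' == mu](inj_eq (inv_inj barK)) barK.
case: (eqVneq mu' mu) => [->|//].
by rewrite eq_sym (negPf Hmu).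
Qed.

Lemma mult_summand_sum c s : summand_ok bar i c -> all (summand_ok bar i) s ->
  mult (kblock_pair (summand_kblock c)) (summand_sum bar s) (count (sign_class c) s).
Proof.
move=> okc; elim: s => [_|d s IHs /andP [okd oks]]; first exact: mult_empty.
exact: (mult_add (mult_summand okc okd) (IHs oks)).
Qed.

Lemma equivalent_count c s t : summand_ok bar i c ->
  all (summand_ok bar i) s -> all (summand_ok bar i) t ->
  equivalentI (summand_sum bar s) (summand_sum bar t) ->
  count (sign_class c) s = count (sign_class c) t.
Proof.
move=> okc oks okt eqst; apply: mult_inj (mult_summand_sum okc okt).
by apply: mult_equivalent eqst _; apply: mult_summand_sum.
Qed.

End Classes.

(** * Signs of the summands of type (ii) *)

Section Signature.

Variables (F : closedFieldType) (bar : {rmorphism F -> F}) (i : F).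
Hypothesis barK : involutive bar.
Hypothesis bar_nonid : exists x : F, bar x <> x.
Hypothesis i_sqr : i ^+ 2 = -1.
Local Notation adj := (adjmx bar).
Local Notation shift n := (jordan_block n (0 : F)).

(** The adjoint of a morphism with components [E] and [g] has components [adj g] and [adj E]; hence
    [g] in the first factor of the trace form. *)
Definition gram (T P : sqpair F) r (E : 'I_r -> 'M_(sqdim P, sqdim T))
  (g : 'I_r -> 'M_(sqdim P, sqdim T)) : 'M[F]_r := \matrix_(a, b) \tr (adj (g a) *m E b).

(* For a Hermitian [T] of size [n], the Hermitian form [tr (phi^* psi)] on
   [Hom(T, P)] has positive index equal to the multiplicity of [T] (as opposed
   to [- T]) in [P]. *)
Definition pos_le (T P : sqpair F) m : Prop :=
  forall r (E g : 'I_r -> _), (forall a, @hom F T P (E a) (g a)) ->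
    exists (X : 'M_(m, r)) m' (Y : 'M_(m', r)),
      (sqdim T)%:R *: gram E g = adj X *m X - adj Y *m Y.

Definition pos_ge (T P : sqpair F) m : Prop :=
  exists E g : 'I_m -> _,
    (forall a, @hom F T P (E a) (g a)) /\ gram E g = (sqdim T)%:R%:M.

Lemma adj_mul_self n (u : 'cV[F]_n) : (adj u *m u) 0 0 = \sum_j u j 0 * bar (u j 0).
Proof. by rewrite mxE; apply: eq_bigr => j _; rewrite !mxE mulrC. Qed.

Lemma adj_mul_self_eq0 m n (u : 'cV[F]_m) (v : 'cV_n) : adj u *m u + adj v *m v = 0 -> u = 0.
Proof.
move=> /matrixP /(_ 0 0); rewrite mxE [X in _ = X]mxE !adj_mul_self.
have [z Hz] : exists z, \sum_j u j 0 * bar (u j 0) = z * bar z.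
  exact: (norm_sum barK bar_nonid i_sqr (fun j => u j 0)).
have [w Hw] : exists w, \sum_j v j 0 * bar (v j 0) = w * bar w.
  exact: (norm_sum barK bar_nonid i_sqr (fun j => v j 0)).
rewrite Hz Hw => /(norm_add_eq0 barK bar_nonid i_sqr) z0.
move: Hz; rewrite z0 mul0r => /(norm_sum_eq0 barK bar_nonid i_sqr) u0.
by apply/matrixP => a b; rewrite [b]ord1 u0 mxE.
Qed.

(** Sylvester's law of inertia: on the kernel of [X] a positive form would equal a nonpositive one,
    so [X] is injective. *)
Lemma pos_le_ge T P m m' : (0 < sqdim T)%N -> pos_le T P m -> pos_ge T P m' -> (m' <= m)%N.
Proof.
move=> n0 le [E [g [hE EG]]]; have [X [k [Y]]] := le _ _ _ hE.
rewrite EG scale_scalar_mx => EXY; apply: (@col_inj_leq F _ _ X) => u Xu.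
pose c : F := (sqdim T)%:R.
have c0 : c != 0.
  by rewrite /c; case: (sqdim T) n0 => // l _; apply: (natr_neq0 barK bar_nonid i_sqr).
have bc : bar c = c by apply: rmorph_nat.
suff : c *: u = 0 by move/eqP; rewrite scaler_eq0 (negPf c0) => /eqP.
apply: (@adj_mul_self_eq0 _ _ _ (Y *m u)).
have := congr1 (fun M => adj u *m M *m u) EXY.
rewrite mulmxBr mulmxBl -!(mulmxA _ _ u) Xu !mulmx0 sub0r mul_scalar_mx => H.
rewrite adjmxZ bc -scalemxAl adjmxM.
have -> : c *: (adj u *m (c *: u)) = adj u *m ((c * c) *: u) by rewrite -!scalemxAr scalerA.
by rewrite H !mulmxA addNr.
Qed.

Lemma gram_transport (T P Q : sqpair F) : starI bar P Q -> forall r (E g : 'I_r -> _),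
  (forall a, @hom F T Q (E a) (g a)) ->
  exists E' g' : 'I_r -> 'M_(sqdim P, sqdim T),
    (forall a, @hom F T P (E' a) (g' a)) /\ gram E' g' = gram E g.
Proof.
move=> [S [S' [[SS S'S] EA EB]]] r E g hE.
have aS : adj S' *m adj S = 1%:M by rewrite -adjmxM SS adjmx1.
exists (fun a => S *m E a), (fun a => adj S' *m g a); split=> [a|].
  have [/= hA hB] := hE a; split => /=; rewrite -(mulmxA (adj S')).
    by rewrite -hA -EA !mulmxA aS mul1mx.
  by rewrite -hB -EB !mulmxA aS mul1mx.
apply/matrixP => a b; rewrite !mxE adjmxM (adjmxK barK) -mulmxA (mulmxA S') S'S mul1mx.
by [].
Qed.

Lemma pos_le_star T P Q m : starI bar P Q -> pos_le T P m -> pos_le T Q m.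
Proof.
move=> sPQ le r E g hE; have [E' [g' [hE' <-]]] := gram_transport sPQ hE.
exact: le.
Qed.

Lemma pos_ge_star T P Q m : starI bar Q P -> pos_ge T P m -> pos_ge T Q m.
Proof.
move=> sQP [E [g [hE EG]]]; have [E' [g' [hE' EG']]] := gram_transport sQP hE.
by exists E', g'; rewrite EG'.
Qed.

Lemma pos_le_add T P Q m m' : pos_le T P m -> pos_le T Q m' -> pos_le T (sqpair_add P Q) (m + m').
Proof.
move=> le le' r E g hE.
have hE1 a : @hom F T P (usubmx (E a)) (usubmx (g a)) /\ @hom F T Q (dsubmx (E a)) (dsubmx (g a)).
  by apply/(@hom_add_col F T P Q); rewrite !vsubmxK; apply: hE.
have [X [k [Y H]]] := le _ _ _ (fun a => proj1 (hE1 a)).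
have [X' [k' [Y' H']]] := le' _ _ _ (fun a => proj2 (hE1 a)).
exists (col_mx X X'), (k + k')%N, (col_mx Y Y').
rewrite /adjmx !tr_col_mx !map_row_mx !mul_row_col opprD addrACA -H -H' -scalerDr.
congr (_ *: _); apply/matrixP => a b; rewrite !mxE -linearD /=; congr (\tr _).
rewrite -{1}[E b]vsubmxK -{1}[g a]vsubmxK /adjmx tr_col_mx map_row_mx mul_row_col.
by [].
Qed.

Lemma pos_ge_add T P Q m m' : pos_ge T P m -> pos_ge T Q m' -> pos_ge T (sqpair_add P Q) (m + m').
Proof.
move=> [E [g [hE EG]]] [E' [g' [hE' EG']]].
have hom0 U V : @hom F U V 0 0 by split; rewrite mulmx0 mul0mx.
exists (fun a => match split a with inl x => col_mx (E x) 0 | inr y => col_mx 0 (E' y) end).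
exists (fun a => match split a with inl x => col_mx (g x) 0 | inr y => col_mx 0 (g' y) end).
split=> [a|]; first by case: (split a) => x; apply/(@hom_add_col F T P Q).
have sl x : split (lshift m' x) = inl x :> 'I_m + 'I_m' := unsplitK (inl x).
have sr x : split (rshift m x) = inr x :> 'I_m + 'I_m' := unsplitK (inr x).
rewrite scalar_mx_block -EG -EG'; apply/matrixP => a b; rewrite mxE.
case: (split_ordP a) => x ->; case: (split_ordP b) => y ->;
  rewrite ?block_mxEul ?block_mxEur ?block_mxEdl ?block_mxEdr ?sl ?sr /adjmx tr_col_mx map_row_mx mul_row_col;
  by rewrite ?trmx0 ?map_mx0 ?mulmx0 ?mul0mx ?addr0 ?add0r !mxE ?mxtrace0.
Qed.

Lemma pos_ge0 T P : pos_ge T P 0.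
Proof. by exists (fun _ => 0), (fun _ => 0); split=> [[]|] //; apply/matrixP => -[]. Qed.

Lemma pos_le0 (T P : sqpair F) :
  (forall E g E' g', @hom F T P E g -> @hom F T P E' g' -> \tr (adj g *m E') = 0) -> pos_le T P 0.
Proof.
move=> H r E g hE; exists 0, 0%N, 0; rewrite !mulmx0 subr0.
have -> : gram E g = 0 by apply/matrixP => a b; rewrite !mxE (H _ _ _ _ (hE a) (hE b)).
by rewrite scaler0.
Qed.

Lemma mult_le_test (K K' P : mxpair F) m : equivalentI K K' -> mult_le K P m -> mult_le K' P m.
Proof.
move=> [R [R' [S [S' [[RR R'R] [SS S'S] EA EB]]]]] le r E g p q hE hp.
have -> : pairing p E = @pairing F K P r (fun a => S *m p a) (fun b => E b *m S').
  apply/matrixP => a b; rewrite !mxE [RHS]mxtrace_mulC -mulmxA (mulmxA S') S'S mul1mx.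
  exact: mxtrace_mulC.
apply: (le _ _ (fun b => g b *m R) _ (fun a => R' *m q a)) => a.
  have [hA hB] := hE a.
  split; rewrite mulmxA ?hA ?hB -?EA -?EB -!mulmxA SS mulmx1 //.
have [hA hB] := hp a.
split; rewrite -mulmxA -?hA -?hB -?EA -?EB !mulmxA R'R mul1mx //.
Qed.

(** Endomorphisms are polynomials in the shift, and the trace sees only the constant term,
    multiplied by the size. *)
Lemma kblock_end_trace K : kblock_ok K ->
  (match K with KJordan _ _ | KInfinite _ => true | _ => false end) ->
  forall E g E' g', @hom F (kblock_pair K) (kblock_pair K) E g ->
  @hom F (kblock_pair K) (kblock_pair K) E' g' ->
  (ncols (kblock_pair K))%:R * \tr (E *m E') = \tr E * \tr E' /\ \tr E = \tr g.
Proof.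
have main n (E E' : 'M[F]_n) : (0 < n)%N -> shift n *m E = E *m shift n -> shift n *m E' = E' *m shift n ->
    n%:R * \tr (E *m E') = \tr E * \tr E'.
  case: n E E' => // n E E' _ hE hE'.
  have h1 : shift n.+1 *m 1%:M = 1%:M *m shift n.+1 :> 'M[F]_n.+1 by rewrite mulmx1 mul1mx.
  rewrite (shift_pairing hE' hE) -[E in \tr E * _]mul1mx -[E' in _ * \tr E']mul1mx.
  rewrite (shift_pairing hE h1) (shift_pairing hE' h1) mxE eqxx mulr1n; ring.
case: K => [n a|n|n|n] //= n0 _ E g E' g'.
  rewrite /hom /= !mul1mx !mulmx1 => -[<- hE] [<- hE']; split=> //; apply: main => //.
    move: hE; rewrite jordan_shift mulmxDl mulmxDr scalar_mxC => /addrI //.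
  by move: hE'; rewrite jordan_shift mulmxDl mulmxDr scalar_mxC => /addrI.
rewrite /hom /= !mul1mx !mulmx1 => -[hE Eg] [hE' Eg']; split; last by rewrite Eg.
by apply: main => //; rewrite ?hE ?hE' ?Eg ?Eg'.
Qed.

Lemma end_trace_equivalent (K T : mxpair F) : equivalentI T K ->
  (forall E g E' g', @hom F K K E g -> @hom F K K E' g' ->
     (ncols K)%:R * \tr (E *m E') = \tr E * \tr E' /\ \tr E = \tr g) ->
  (forall E g E' g', @hom F T T E g -> @hom F T T E' g' ->
     (ncols T)%:R * \tr (E *m E') = \tr E * \tr E' /\ \tr E = \tr g).
Proof.
move=> [R [R' [S [S' [[RR R'R] [SS S'S] EA EB]]]]] H E g E' g' hE hE'.
have tr E0 g0 : @hom F T T E0 g0 -> @hom F K K (S' *m E0 *m S) (R *m g0 *m R').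
  move=> [hA hB]; split; rewrite -?EA -?EB !mulmxA -(mulmxA _ S S') SS mulmx1.
    by rewrite -(mulmxA R) hA !mulmxA -(mulmxA _ R' R) R'R mulmx1.
  by rewrite -(mulmxA R) hB !mulmxA -(mulmxA _ R' R) R'R mulmx1.
have trS (M : 'M_(ncols T)) : \tr (S' *m M *m S) = \tr M.
  by rewrite -mulmxA mxtrace_mulC -mulmxA SS mulmx1.
have trR (M : 'M_(nrows T)) : \tr (R *m M *m R') = \tr M.
  by rewrite -mulmxA mxtrace_mulC -mulmxA R'R mulmx1.
have trM : \tr (S' *m E *m S *m (S' *m E' *m S)) = \tr (E *m E').
  rewrite -[RHS]trS; congr (\tr _); rewrite !mulmxA -(mulmxA _ S S') SS mulmx1.
  by [].
have [] := H _ _ _ _ (tr _ _ hE) (tr _ _ hE').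
by rewrite !trS trR trM -(mxiso_dim (conj SS S'S)).
Qed.

Lemma typeII_end_trace n a b : summand_ok bar i (TypeII n a b) ->
  forall E g E' g', let T := summand_pair bar (TypeII n a b) in
  @hom F T T E g -> @hom F T T E' g' ->
  n%:R * \tr (E *m E') = \tr E * \tr E' /\ \tr E = \tr g.
Proof.
move=> /and4P [n0 _ _ /eqP ab] E g E' g' T.
apply: (end_trace_equivalent (typeII_kronecker bar n ab)).
apply: kblock_end_trace; rewrite /kblock_typeII; do ![case: ifP => _ //].
Qed.

Lemma hom_adj (P Q : sqpair F) E g : hermitian_pair bar P -> hermitian_pair bar Q ->
  @hom F P Q E g -> @hom F Q P (adj g) (adj E).
Proof.
case: P Q E g => [m A B] [n A' B'] E g [/= hA hB] [/= hA' hB'] [/= EA EB].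
split=> /=; first by rewrite -{1}hA -adjmxM -EA adjmxM hA'.
by rewrite -{1}hB -adjmxM -EB adjmxM hB'.
Qed.

(** On endomorphisms of [T], $n$ times the form is the rank one positive form given by the trace. A
    target [- T] amounts to replacing $g$ by $-g$, which makes it negative. If the classes differ
    even up to sign, adjoints are morphisms back to [T], and multiplicity 0 makes all these traces
    vanish. *)
Lemma pos_typeII n a b d : summand_ok bar i (TypeII n a b) -> summand_ok bar i d ->
  let T := summand_pair bar (TypeII n a b) in
  pos_le T (summand_pair bar d) (exact_class bar (TypeII n a b) d) /\
  pos_ge T (summand_pair bar d) (exact_class bar (TypeII n a b) d).
Proof.
move=> okc okd T.
have hT : hermitian_pair bar T by apply: summand_hermitian okc.
have adj_end E g : @hom F T T E g -> @hom F T T (adj g) (adj E) by apply: hom_adj.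
have end_gram E g E' g' : @hom F T T E g -> @hom F T T E' g' ->
    n%:R * \tr (adj g *m E') = bar (\tr E) * \tr E'.
  move=> hE hE'; have [-> _] := typeII_end_trace okc (adj_end _ _ hE) hE'.
  have [_ ->] := typeII_end_trace okc hE hE'.
  by rewrite mxtrace_adj.
case: (boolP (exact_class bar (TypeII n a b) d)) => [|ne].
  case: d okd => // n' a' b' okd /andP [/eqP -> /andP [/eqP -> /eqP ->]]; split.
    move=> r E g hE; exists (\row_a \tr (E a)), 0%N, 0; rewrite mulmx0 subr0.
    apply/matrixP => x y; rewrite !mxE big_ord1 !mxE.
    exact: end_gram (hE x) (hE y).
  exists (fun _ => 1%:M), (fun _ => 1%:M); split=> [x|]; first by split; rewrite mulmx1 mul1mx.
  by apply/matrixP => x y; rewrite !ord1 !mxE mulmx1 adjmx1 mxtrace1.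
split; last exact: pos_ge0.
case: (boolP (sign_class bar (TypeII n a b) d)) => [sg|sg].
  case: d okd ne sg => // n' a' b' okd ne /andP [/eqP En /orP [H|/andP [/eqP Ea /eqP Eb]]].
    by move: ne; rewrite /= En eqxx H.
  move: okd ne; rewrite {}En {}Ea {}Eb => okd _.
  rewrite (@summand_pair_opp F bar (TypeII n a b) (TypeII n (- a) (- b))) //.
  move=> r E g hE; exists 0, 1%N, (\row_a \tr (E a)); rewrite mulmx0 sub0r.
  have hE' x : @hom F T T (E x) (- g x).
    by have [/= hA hB] := hE x; split; rewrite mulNmx -?hA -?hB mulNmx opprK.
  apply/matrixP => x y; rewrite !mxE big_ord1 !mxE -(end_gram _ _ _ _ (hE' x) (hE' y)).
  by rewrite adjmxN mulNmx linearN mulrN opprK.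
apply: pos_le0 => E g E' g' hE hE'.
have [_ _ _ /eqP ab] := and4P okc.
have [le _] := mult_summand barK bar_nonid i_sqr okc okd.
have le' := mult_le_test (equivalentI_sym (typeII_kronecker bar n ab)) le.
have hp : @hom F (summand_pair bar d) T (adj g) (adj E).
  by apply: hom_adj hE => //; apply: summand_hermitian okd.
have := le' 1%N (fun _ => E') (fun _ => g') (fun _ => adj g) (fun _ => adj E)
  (fun _ => hE') (fun _ => hp).
rewrite (negPf sg) leqn0 mxrank_eq0 => /eqP /matrixP /(_ 0 0).
by rewrite !mxE.
Qed.

(** For type (i) the class up to sign is already the exact class, so equivalence suffices; type (ii)
    needs the positive index. *)
Lemma star_count c s t : summand_ok bar i c ->
  all (summand_ok bar i) s -> all (summand_ok bar i) t ->
  starI bar (summand_sum bar s) (summand_sum bar t) ->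
  count (exact_class bar c) s = count (exact_class bar c) t.
Proof.
case: c => [n mu|n a b] okc oks okt sst.
  have := equivalent_count barK bar_nonid i_sqr okc oks okt (starI_equivalentI sst).
  have E : sign_class bar (TypeI n mu) =1 exact_class bar (TypeI n mu) by case.
  by rewrite !(eq_count E).
pose T := summand_pair bar (TypeII n a b).
have T0 : (0 < sqdim T)%N by apply: summand_dim_gt0 okc.
have pos u : all (summand_ok bar i) u ->
    pos_le T (summand_sum bar u) (count (exact_class bar (TypeII n a b)) u) /\
    pos_ge T (summand_sum bar u) (count (exact_class bar (TypeII n a b)) u).
  elim: u => [_|d u IHu /andP [okd oku]].
    split; last exact: pos_ge0.
    by apply: pos_le0 => E g E' g' _ _; rewrite [E']flatmx0 mulmx0 mxtrace0.
  have [le ge] := pos_typeII okc okd; have [le' ge'] := IHu oku.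
  by split; [apply: pos_le_add le le' | apply: pos_ge_add ge ge'].
have [les ges] := pos _ oks; have [let_ get_] := pos _ okt.
apply/eqP; rewrite eqn_leq.
rewrite (pos_le_ge T0 (pos_le_star sst les) get_) andbT.
exact: (pos_le_ge T0 let_ (pos_ge_star (starI_sym sst) ges)).
Qed.

End Signature.

(** * Uniqueness up to permutation *)

Section Permutations.

Variable T : eqType.

Lemma perm_upto_count (R : rel T) (s t : seq T) : reflexive R ->
  (forall x y, R x y -> R x =1 R y) ->
  {in s ++ t, forall c, count (R c) s = count (R c) t} -> perm_upto (fun x y => R x y) s t.
Proof.
(* The key of an element is the position of the first element related to it, so equivalence becomes
   equality of numbers and [perm_eq] applies. *)
move=> Rrefl Rtrans Hcount; pose w := s ++ t; pose key c := find (R c) w.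
have keyP c d : c \in w -> d \in w -> (key d == key c) = R c d.
  move=> cw dw; apply/eqP/idP => [E|Rcd]; last by apply: eq_find => x; rewrite (Rtrans _ _ Rcd).
  have hasR e : e \in w -> has (R e) w by move=> ew; apply/hasP; exists e.
  have := nth_find c (hasR c cw); have := nth_find c (hasR d dw); rewrite -/(key d) -/(key c) E.
  by move=> /Rtrans Ed /Rtrans ->; rewrite -Ed.
have perm_key : perm_eq (map key s) (map key t).
  apply/allP => k; rewrite -map_cat => /mapP [c cw ->] /=; rewrite !count_map; apply/eqP.
  have E u : {subset u <= w} -> count (preim key (pred1 (key c))) u = count (R c) u.
    by move=> uw; apply: eq_in_count => d /uw dw /=; apply: keyP.
  by rewrite !E ?Hcount // => d du; rewrite mem_cat du ?orbT.
have size_st : size s = size t by have := perm_size perm_key; rewrite !size_map.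
have /tuple_permP [p Ep] : perm_eq (map key s) (map_tuple key (in_tuple t)) by [].
have f_bij : bijective (fun j : 'I_(size s) => p (cast_ord size_st j)).
  exists (fun j => cast_ord (esym size_st) (p^-1%g j)) => j; first by rewrite permK cast_ordK.
  by rewrite cast_ordKV permKV.
exists (fun j => p (cast_ord size_st j)) => // j.
have x0 : T := tnth (in_tuple s) j.
rewrite -keyP ?mem_cat ?(mem_tnth _ (in_tuple s)) ?(mem_tnth _ (in_tuple t)) ?orbT //; apply/eqP.
have := congr1 (fun l => nth 0%N l j) Ep; rewrite (nth_map x0) // -(tnth_nth x0 (in_tuple s)) => ->.
have -> : nth 0%N [tuple tnth (map_tuple key (in_tuple t)) (p k) | k < size t] j
    = tnth [tuple tnth (map_tuple key (in_tuple t)) (p k) | k < size t] (cast_ord size_st j).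
  by rewrite (tnth_nth 0%N).
by rewrite tnth_mktuple tnth_map.
Qed.

Lemma perm_upto_matching (r : T -> T -> Prop) s t : perm_upto r s t ->
  exists n (f g : 'I_n -> T),
    [/\ s = map f (enum 'I_n), perm_eq (map g (enum 'I_n)) t & forall j, r (f j) (g j)].
Proof.
move=> [f f_bij Hr]; exists (size s), (tnth (in_tuple s)), (fun j => tnth (in_tuple t) (f j)).
split=> //; first by rewrite map_tnth_enum.
suff: perm_eq (map (fun j => tnth (in_tuple t) (f j)) (enum 'I_(size s)))
    (map (tnth (in_tuple t)) (enum 'I_(size t))) by rewrite map_tnth_enum.
rewrite (map_comp (tnth (in_tuple t)) f); apply: perm_map; apply: uniq_perm.
- by rewrite map_inj_uniq ?enum_uniq //; apply: bij_inj.
- exact: enum_uniq.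
- move=> x; rewrite mem_enum inE; have [g fK gK] := f_bij.
  by apply/mapP; exists (g x); rewrite ?mem_enum // gK.
Qed.

End Permutations.

Section SumPermutation.

Variables (F : fieldType) (bar : {rmorphism F -> F}).

Lemma starI_sum_perm (T : eqType) (P : T -> sqpair F) u t : perm_eq u t ->
  starI bar (sqpair_sum (map P u)) (sqpair_sum (map P t)).
Proof.
have mid x u1 u2 : starI bar (sqpair_sum (map P (x :: u1 ++ u2))) (sqpair_sum (map P (u1 ++ x :: u2))).
  elim: u1 => [|y u1 IHu1]; first exact: starI_refl.
  apply: starI_trans (starI_swap _ _ _ _) _; apply: starI_add; first exact: starI_refl.
  exact: IHu1.
elim: u t => [|x u IHu] t ut.
  by rewrite perm_sym in ut; rewrite (perm_nilP ut); apply: starI_refl.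
have xt : x \in t by rewrite -(perm_mem ut) mem_head.
case/splitPr: xt ut => t1 t2 ut.
apply: starI_trans (mid x t1 t2); apply: starI_add; first exact: starI_refl.
apply: IHu; rewrite -(perm_cons x) (permPl ut).
by rewrite (perm_catCA t1 [:: x] t2).
Qed.

Lemma starI_sum_map (I : Type) (P Q : I -> sqpair F) (l : seq I) :
  (forall j, starI bar (P j) (Q j)) -> starI bar (sqpair_sum (map P l)) (sqpair_sum (map Q l)).
Proof.
move=> PQ; elim: l => [|j l IHl] /=; first exact: starI_refl.
exact: starI_add.
Qed.

Lemma equivalentI_sum_map (I : Type) (P Q : I -> sqpair F) (l : seq I) :
  (forall j, equivalentI (P j) (Q j)) ->
  equivalentI (sqpair_sum (map P l)) (sqpair_sum (map Q l)).
Proof.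
move=> PQ; elim: l => [|j l IHl] /=; first exact: equivalentI_refl.
exact: (equivalentI_add (PQ j) IHl).
Qed.

End SumPermutation.

Definition summand_code (F : fieldType) (c : summand F) : nat * F + nat * F * F :=
  match c with TypeI n mu => inl (n, mu) | TypeII n a b => inr (n, a, b) end.

Definition summand_decode (F : fieldType) (x : nat * F + nat * F * F) : summand F :=
  match x with inl (n, mu) => TypeI n mu | inr (n, a, b) => TypeII n a b end.

Lemma summand_codeK (F : fieldType) : cancel (@summand_code F) (@summand_decode F).
Proof. by case. Qed.

HB.instance Definition _ (F : fieldType) :=
  Equality.copy (summand F) (can_type (@summand_codeK F)).

(** * Classification by permutations of the summands *)

Section MainTheorem.

Variables (F : closedFieldType) (bar : {rmorphism F -> F}) (i : F).
Hypothesis barK : involutive bar.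
Hypothesis bar_nonid : exists x : F, bar x <> x.
Hypothesis i_sqr : i ^+ 2 = -1.

Lemma perm_upto_impl (T : Type) (r r' : T -> T -> Prop) s t :
  (forall x y, r x y -> r' x y) -> perm_upto r s t -> perm_upto r' s t.
Proof. by move=> rr' [f f_bij Hf]; exists f => // j; apply/rr'/Hf. Qed.

Lemma star_iff_perm s t : all (summand_ok bar i) s -> all (summand_ok bar i) t ->
  starI bar (summand_sum bar s) (summand_sum bar t) <-> perm_upto (eq_summand bar) s t.
Proof.
move=> oks okt; split=> [sst|pst].
  apply: (@perm_upto_impl _ (fun c d => exact_class bar c d)) => [c d /exact_classP //|].
  apply: perm_upto_count => [c|c d|c cst]; first exact: exact_class_refl.
    exact: exact_class_trans.
  apply: (star_count barK bar_nonid i_sqr) => //.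
  by move: cst; rewrite mem_cat => /orP [] H; [apply: (allP oks) | apply: (allP okt)].
have [n [f [g [-> gt fg]]]] := perm_upto_matching pst.
apply: starI_trans _ (starI_sum_perm bar (summand_pair bar) gt).
rewrite /summand_sum -!map_comp; apply: starI_sum_map => j /=.
have := fg j; case: (f j) (g j) => [m mu|m a b] [m' mu'|m' a' b'] //=.
  move=> [-> [] ->]; first exact: starI_refl.
  exact: typeI_conj.
by move=> [-> -> ->]; apply: starI_refl.
Qed.

Lemma equivalent_iff_perm s t : all (summand_ok bar i) s -> all (summand_ok bar i) t ->
  equivalentI (summand_sum bar s) (summand_sum bar t) <-> perm_upto (eq_summand_sign bar) s t.
Proof.
move=> oks okt; split=> [sst|pst].
  apply: (@perm_upto_impl _ (fun c d => sign_class bar c d)) => [c d /sign_classP //|].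
  apply: perm_upto_count => [c|c d|c cst]; first exact: sign_class_refl.
    exact: sign_class_trans.
  apply: (equivalent_count barK bar_nonid i_sqr) => //.
  by move: cst; rewrite mem_cat => /orP [] H; [apply: (allP oks) | apply: (allP okt)].
have [n [f [g [-> gt fg]]]] := perm_upto_matching pst.
apply: equivalentI_trans _ (starI_equivalentI (starI_sum_perm bar (summand_pair bar) gt)).
rewrite /summand_sum -!map_comp; apply: equivalentI_sum_map => j /=.
have [fgj|opp] := fg j.
  apply: starI_equivalentI; move: fgj.
  case: (f j) (g j) => [m mu|m a b] [m' mu'|m' a' b'] //=.
    move=> [-> [] ->]; first exact: starI_refl.
    exact: typeI_conj.
  by move=> [-> -> ->]; apply: starI_refl.
rewrite (summand_pair_opp bar opp).
(* An equivalence can put the sign into the row factor alone, leaving the column factor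
   unchanged. *)
exists (- 1%:M), (- 1%:M), 1%:M, 1%:M; split.
- by split; rewrite mulmxN mulNmx opprK mulmx1.
- exact: mxiso1.
- by rewrite mulmx1 mulNmx mul1mx.
- by rewrite mulmx1 mulNmx mul1mx.
Qed.

Lemma star_classification n (A B : 'M[F]_n) : is_hermitian bar A -> is_hermitian bar B ->
  exists s : seq (summand F),
    [/\ all (summand_ok bar i) s,
        star_congruent bar (SqPair A B) (summand_sum bar s)
      & forall t : seq (summand F), all (summand_ok bar i) t ->
          (star_congruent bar (SqPair A B) (summand_sum bar t) <->
           perm_upto (eq_summand bar) s t)].
Proof.
move=> hA hB; have [s oks sS] := exists_summand_sum barK bar_nonid i_sqr (esym hA) (esym hB).
exists s; split=> //; first exact/star_congruentP.
move=> t okt; rewrite -star_iff_perm //; split.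
  by move=> /star_congruentP /(starI_trans (starI_sym sS)).
by move=> st; apply/star_congruentP; apply: starI_trans sS st.
Qed.

Lemma kronecker_classification n n' (A B : 'M[F]_n) (A' B' : 'M[F]_n') s s' ks :
  all (summand_ok bar i) s -> all (summand_ok bar i) s' ->
  star_congruent bar (SqPair A B) (summand_sum bar s) ->
  star_congruent bar (SqPair A' B') (summand_sum bar s') ->
  kronecker_form (SqPair A B) ks ->
  (kronecker_form (SqPair A' B') ks <-> perm_upto (eq_summand_sign bar) s s').
Proof.
move=> oks oks' /star_congruentP /starI_equivalentI es /star_congruentP /starI_equivalentI es'.
move=> [okks /equivalentP eks]; split.
  move=> [_ /equivalentP eks']; apply/equivalent_iff_perm => //.
  apply: equivalentI_trans (equivalentI_sym es) _; apply: equivalentI_trans es'.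
  exact: equivalentI_trans eks (equivalentI_sym eks').
move=> /(equivalent_iff_perm oks oks') ss'; split=> //; apply/equivalentP.
apply: equivalentI_trans es' _; apply: equivalentI_trans (equivalentI_sym ss') _.
exact: equivalentI_trans (equivalentI_sym es) eks.
Qed.

End MainTheorem.

Lemma involution_rmorphism (F : fieldType) (bar : F -> F) : is_involution bar ->
  exists b : {rmorphism F -> F}, bar = b.
Proof.
move=> [bij barD barM barK].
have bar0 : bar 0 = 0 by apply: (addrI (bar 0)); rewrite -barD !addr0.
have barN x : bar (- x) = - bar x by apply/eqP; rewrite -addr_eq0 -barD addNr bar0.
have bar1 : bar 1 = 1.
  have b1 : bar 1 != 0 by rewrite -bar0 (inj_eq (bij_inj bij)) oner_neq0.
  by apply: (mulfI b1); rewrite -barM !mulr1.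
have barB : {morph bar : x y / x - y} by move=> x y; rewrite barD barN.
pose zm := GRing.isZmodMorphism.Build F F bar barB.
pose mm := GRing.isMonoidMorphism.Build F F bar (conj bar1 barM).
pose b : {rmorphism F -> F} := HB.pack bar zm mm.
by exists b.
Qed.

Theorem theorem8p1 (F : closedFieldType) (bar : F -> F) (i : F)
    (bar_involution : is_involution bar)
    (bar_nonid : exists x : F, bar x <> x)
    (i_sqr : i ^+ 2 = -1) :
  (forall (n : nat) (A B : 'M[F]_n), is_hermitian bar A -> is_hermitian bar B ->
     exists s : seq (summand F),
       [/\ all (summand_ok bar i) s,
           star_congruent bar (SqPair A B) (summand_sum bar s)
         & forall t : seq (summand F), all (summand_ok bar i) t ->
             (star_congruent bar (SqPair A B) (summand_sum bar t) <->
              perm_upto (eq_summand bar) s t)])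
  /\ (forall (n n' : nat) (A B : 'M[F]_n) (A' B' : 'M[F]_n')
        (s s' : seq (summand F)) (ks : seq (kblock F)),
       is_hermitian bar A -> is_hermitian bar B ->
       is_hermitian bar A' -> is_hermitian bar B' ->
       all (summand_ok bar i) s -> all (summand_ok bar i) s' ->
       star_congruent bar (SqPair A B) (summand_sum bar s) ->
       star_congruent bar (SqPair A' B') (summand_sum bar s') ->
       kronecker_form (SqPair A B) ks ->
       (kronecker_form (SqPair A' B') ks <->
        perm_upto (eq_summand_sign bar) s s'))
  /\ (forall (k : nat) (mu : F), summand_ok bar i (TypeI k.*2.+1 mu) ->
       kronecker_form (summand_pair bar (TypeI k.*2.+1 mu))
         [:: KWide k; KTall k])
  /\ (forall (k : nat) (mu : F), summand_ok bar i (TypeI k.*2 mu) ->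
       kronecker_form (summand_pair bar (TypeI k.*2 mu))
         [:: KJordan k mu; KJordan k (bar mu)])
  /\ (forall (n : nat) (a b : F), summand_ok bar i (TypeII n a b) ->
       kronecker_form (summand_pair bar (TypeII n a b))
         [:: if odd n && (a != 0) then KJordan n (b / a)
             else if ~~ odd n && (b != 0) then KJordan n (- a / b)
             else KInfinite n]).
Proof.
have [_ _ _ barK] := bar_involution.
have [b Eb] := involution_rmorphism bar_involution; move: barK bar_nonid; rewrite {}Eb => barK nonid.
split; first by move=> n A B; apply: (star_classification barK nonid i_sqr).
split.
  move=> n n' A B A' B' s s' ks _ _ _ _ oks oks'.
  exact: (kronecker_classification barK nonid i_sqr oks oks').
split.
  move=> k mu ok; split=> //; apply/equivalentP.
  have bmu : b mu != mu.
    have bi : b i = - i := bar_i barK nonid i_sqr.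
    have bi0 : b i != i by apply/eqP; apply: (i_not_fixed barK nonid i_sqr).
    by move: ok; rewrite /= odd_double /= => /orP [] /eqP ->; rewrite ?rmorphN ?eqr_opp.
  apply: equivalentI_trans (typeI_odd_kronecker barK k bmu) _.
  by apply: equivalentI_add; [apply: equivalentI_refl | apply: equivalentI_addn0].
split.
  move=> k mu ok; have [k0 bmu] : (0 < k)%N /\ b mu != mu.
    by move: ok; rewrite /= odd_double double_gt0 => /andP [].
  split; first by rewrite /= k0.
  apply/equivalentP; apply: equivalentI_trans (typeI_even_kronecker barK k bmu) _.
  by apply: equivalentI_add; [apply: equivalentI_refl | apply: equivalentI_addn0].
move=> n x y /and4P [n0 _ _ /eqP xy].
split; first by rewrite /=; do ![case: ifP => _ /=]; rewrite n0.
apply/equivalentP; apply: equivalentI_trans (typeII_kronecker b n xy) _.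
exact: equivalentI_addn0.
Qed.
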